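(* Let $n\in\{1,2,3\}$ and $\gamma>1$. Suppose $\lambda>1$ and $\mu\ge 0$. Let $A>0$, $\overline\rho>0$, $R>0$ be constants and $\varepsilon>0$, and consider the Cauchy problem for the compressible isentropic Euler equations with time dependent damping $$\begin{cases}\rho_t+\nabla\cdot(\rho u)=0, & (t,x)\in(0,T)\times\mathbb{R}^n,\\ (\rho u)_t+\nabla\cdot(\rho u\otimes u)+\nabla p+\dfrac{\mu\,\rho u}{(1+t)^{\lambda}}=0, & (t,x)\in(0,T)\times\mathbb{R}^n,\\ u(0,x)=\varepsilon u_0(x),\qquad \rho(0,x)=\overline\rho+\varepsilon\rho_0(x),\end{cases}$$ with pressure $p=p(\rho)=A\rho^\gamma$. Assume that $\rho_0\in C_0^\infty(\mathbb{R}^n;\mathbb{R})$ and $u_0\in C_0^\infty(\mathbb{R}^n;\mathbb{R}^n)$ satisfy $$\operatorname{supp}\rho_0,\ \operatorname{supp}u_0\subseteq\{x\in\mathbb{R}^n:|x|\le R\}$$ and $$\int_{\mathbb{R}^n}\rho_0\,\phi\,dx>0,\qquad \int_{\mathbb{R}^n}u_0\cdot\nabla\phi\,dx>0,$$ where $\phi$ is the function defined in the context. Then there exist a constant $\varepsilon_0>0$, depending only on $n,\lambda,\mu,\gamma,u_0,\rho_0$ (and on the fixed constants $A,\overline\rho,R$), and a constant $C>0$ independent of $\varepsilon$, such that, provided $0<\varepsilon\le\varepsilon_0$, the system has no global solutions and the lifespan $T_\varepsilon$ satisfies $$T_\varepsilon\le\begin{cases}C\,\varepsilon^{-\frac{2}{3-n}}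 & \text{if } n\in\{1,2\},\\ \exp\left(C\varepsilon^{-1}\right) & \text{if } n=3.\end{cases}$$
   Context: Here $\rho:[0,T)\times\mathbb{R}^n\to\mathbb{R}$ is the density, $u:[0,T)\times\mathbb{R}^n\to\mathbb{R}^n$ the velocity and $p$ the pressure of the fluid. Solutions are $C^1$ solutions $(\rho,u)$. The lifespan $T_\varepsilon$ is the largest time such that the solution exists and is $C^1$ on $[0,T_\varepsilon)\times\mathbb{R}^n$; a global solution is one with $T_\varepsilon=+\infty$. The positive function $\phi:\mathbb{R}^n\to\mathbb{R}$ is defined by $$\phi(x)=\frac{1}{n\omega_n}\int_{\mathbb{S}^{n-1}}e^{x\cdot\sigma}\,d\sigma\ \text{ if } n\ge2,\qquad \phi(x)=\frac{e^x+e^{-x}}{2}\ \text{ if } n=1,$$ where $\omega_n=\pi^{n/2}/\Gamma(\frac n2+1)$ is the volume of the $n$-dimensional unit ball, so that $n\omega_n$ is the surface measure of the unit sphere $\mathbb{S}^{n-1}$. *)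

(* Defs.v *)
From HB Require Import structures.
From mathcomp Require Import all_boot all_order all_algebra.
From mathcomp Require Import all_classical all_reals all_analysis.

Set Implicit Arguments.
Unset Strict Implicit.
Unset Printing Implicit Defensive.

Import Order.TTheory GRing.Theory Num.Theory.
Import numFieldNormedType.Exports.

Local Open Scope classical_set_scope.
Local Open Scope ring_scope.

Section TupleMeasure.
Context d (T : measurableType d) (R : realType).

Definition tuple_cons n (z : T * n.-tuple T) : n.+1.-tuple T :=
  [the n.+1.-tuple T of z.1 :: z.2].

Lemma measurable_tuple_cons n : measurable_fun setT (@tuple_cons n).
Proof. exact: measurable_cons. Qed.

HB.instance Definition _ (n : nat) :=
  isMeasurableFun.Build _ _ _ _ (@tuple_cons n) (@measurable_tuple_cons n).

Section cons_measure.
Variables (n : nat) (m1 : {sigma_finite_measure set T -> \bar R}).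
Variable m2 : {sigma_finite_measure set (n.-tuple T) -> \bar R}.

Definition cons_measure : set (n.+1.-tuple T) -> \bar R :=
  pushforward (product_measure1 m1 m2) (@tuple_cons n).

Lemma cons_measure0 : cons_measure set0 = 0%E.
Proof. by rewrite /cons_measure /pushforward preimage_set0 measure0. Qed.

Lemma cons_measure_ge0 A : (0 <= cons_measure A)%E.
Proof. exact: measure_ge0. Qed.

Lemma cons_measure_sigma_additive : semi_sigma_additive cons_measure.
Proof.
exact: (@measure_semi_sigma_additive _ _ _
  (pushforward (product_measure1 m1 m2) (@tuple_cons n : {mfun _ >-> _}))).
Qed.

HB.instance Definition _ := isMeasure.Build _ _ _ cons_measure
  cons_measure0 cons_measure_ge0 cons_measure_sigma_additive.

Lemma cons_measure_sigma_finite : sigma_finite setT cons_measure.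
Proof.
have /sigma_finiteP[F [TF ndF Foo]] := sigma_finiteT m1.
have /sigma_finiteP[G [TG ndG Goo]] := sigma_finiteT m2.
pose split_tuple (t : n.+1.-tuple T) : T * n.-tuple T :=
  (tnth t ord0, [tuple of behead t]).
have msplit : measurable_fun setT split_tuple.
  apply/measurable_fun_pairP; split.
    exact: measurable_tnth.
  exact: measurable_behead.
have consK : cancel (@tuple_cons n) split_tuple.
  by case=> x t; congr pair; apply/val_inj.
exists (fun k => split_tuple @^-1` (F k `*` G k)).
  rewrite -preimage_bigcup (_ : \bigcup_k _ = setT) ?preimage_setT//.
  rewrite -setXTT TF TG predeqE => -[x y]; split.
    by move=> [k _ []/= ? ?]; split; exists k.
  move=> [/= [k _ Fkx] [l _ Gly]]; exists (maxn k l) => //; split.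
  - by move: x Fkx; exact/subsetPset/ndF/leq_maxl.
  - by move: y Gly; exact/subsetPset/ndG/leq_maxr.
move=> k; have [? ?] := Foo k; have [? ?] := Goo k; split.
  by rewrite -[X in measurable X]setTI; apply: msplit => //; exact: measurableX.
rewrite /cons_measure /pushforward -comp_preimage.
rewrite (_ : _ @^-1` _ = F k `*` G k); last first.
  by apply/funext => z; exact: (congr1 (F k `*` G k) (consK z)).
by rewrite product_measure1E// lte_mul_pinfty// ge0_fin_numE.
Qed.

HB.instance Definition _ := Measure_isSigmaFinite.Build _ _ _
  cons_measure cons_measure_sigma_finite.

End cons_measure.

(* The n-fold product of m. *)
Fixpoint tuple_measure (m : {sigma_finite_measure set T -> \bar R}) (n : nat) :
    {sigma_finite_measure set (n.-tuple T) -> \bar R} :=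
  match n with
  | 0 => \d_([tuple] : 0.-tuple T)
  | k.+1 => cons_measure m (tuple_measure m k)
  end.

End TupleMeasure.

Section EuclideanSpace.
Context {R : realType}.

Definition tuple_rV n (t : n.-tuple R) : 'rV[R]_n := \row_i tnth t i.

(* 'rV[R]_n carries no measurable structure in the library, hence the transport
   to tuples. *)
Definition integral_Rn n (D : set 'rV[R]_n) (f : 'rV[R]_n -> R) : R :=
  \int[tuple_measure (@lebesgue_measure R) n]_(t in [set t | D (tuple_rV t)])
    f (tuple_rV t).

Definition dotrv n (x y : 'rV[R]_n) : R := \sum_i x 0 i * y 0 i.

(* The library norm `|x| of 'rV[R]_n is the sup norm. *)
Definition enorm n (x : 'rV[R]_n) : R := Num.sqrt (dotrv x x).

(* Integration against the surface measure of the unit sphere, which is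
   sigma(E) = n * Lebesgue measure of {r s | 0 < r < 1, s in E}. *)
Definition sphere_integral n (f : 'rV[R]_n -> R) : R :=
  n%:R * integral_Rn [set y | enorm y < 1] (fun y => f ((enorm y)^-1 *: y)).

Definition Gamma (s : R) : R :=
  \int[@lebesgue_measure R]_(t in `]0, +oo[) (t `^ (s - 1) * expR (- t)).

Definition unit_ball_volume (n : nat) : R :=
  pi `^ (n%:R / 2) / Gamma (n%:R / 2 + 1).

Definition phi (n : nat) : 'rV[R]_n -> R :=
  match n return 'rV[R]_n -> R with
  | 1 => fun x => (expR (x 0 0) + expR (- x 0 0)) / 2
  | m => fun x => (m%:R * unit_ball_volume m)^-1 *
                  sphere_integral (fun s => expR (dotrv x s))
  end.

Definition partial n (i : 'I_n) (f : 'rV[R]_n -> R) : 'rV[R]_n -> R :=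
  'D_(delta_mx 0 i) f.

Definition gradient n (f : 'rV[R]_n -> R) (x : 'rV[R]_n) : 'rV[R]_n :=
  \row_i partial i f x.

Definition smooth n (f : 'rV[R]_n -> R) : Prop :=
  forall s : seq 'I_n,
    let g := foldr (@partial n) f s in
    continuous g /\ forall i x, derivable g x (delta_mx 0 i).

Definition supp n (V : zmodType) (f : 'rV[R]_n -> V) : set 'rV[R]_n :=
  closure [set x | f x != 0].

End EuclideanSpace.

Section Euler.
Context {R : realType} (n : nat).
Implicit Types (T : \bar R) (rho : R -> 'rV[R]_n -> R)
  (u : R -> 'rV[R]_n -> 'rV[R]_n).

Definition slab T : set (R * 'rV[R]_n) :=
  [set z | 0 <= z.1 /\ (z.1%:E < T)%E].

(* f is C^1 on [0, T) x R^n.  The time derivative is taken within [0, +oo): it is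
   one-sided at t = 0 and the usual one at t > 0. *)
Definition C1_slab T (f : R -> 'rV[R]_n -> R) : Prop :=
  exists (ft : R -> 'rV[R]_n -> R) (fx : 'I_n -> R -> 'rV[R]_n -> R),
  [/\ forall t x, slab T (t, x) ->
        h^-1 * (f (t + h) x - f t x)
          @[h --> within [set h | 0 <= t + h] 0^'] --> ft t x,
      forall i t x, slab T (t, x) ->
        is_derive x (delta_mx 0 i) (f t) (fx i t x),
      {within slab T, continuous (fun z => f z.1 z.2)},
      {within slab T, continuous (fun z => ft z.1 z.2)} &
      forall i, {within slab T, continuous (fun z => fx i z.1 z.2)}].

Definition pressure (A gamma r : R) : R := A * r `^ gamma.

Definition mass_equation rho u (t : R) (x : 'rV[R]_n) : Prop :=
  derive1 (rho^~ x) t +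
  \sum_i partial i (fun y => rho t y * u t y 0 i) x = 0.

Definition momentum_equation (A gamma lambda mu : R) rho u
    (t : R) (x : 'rV[R]_n) (j : 'I_n) : Prop :=
  derive1 (fun s => rho s x * u s x 0 j) t +
  \sum_i partial i (fun y => rho t y * u t y 0 i * u t y 0 j) x +
  partial j (fun y => pressure A gamma (rho t y)) x +
  mu * (rho t x * u t x 0 j) / (1 + t) `^ lambda = 0.

(* T may be +oo.  Nonnegativity of rho is what makes rho ^ gamma meaningful: powR
   takes a junk value on negative reals. *)
Definition C1_solution (A gamma lambda mu : R)
    (rho_init : 'rV[R]_n -> R) (u_init : 'rV[R]_n -> 'rV[R]_n) T rho u : Prop :=
  [/\ C1_slab T rho /\ (forall i, C1_slab T (fun t x => u t x 0 i)),
      forall t x, slab T (t, x) -> 0 <= rho t x,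
      forall t x, 0 < t -> (t%:E < T)%E -> mass_equation rho u t x,
      forall t x j, 0 < t -> (t%:E < T)%E ->
        momentum_equation A gamma lambda mu rho u t x j &
      forall x, rho 0 x = rho_init x /\ u 0 x = u_init x].

Definition global_solution_exists (A gamma lambda mu : R)
    (rho_init : 'rV[R]_n -> R) (u_init : 'rV[R]_n -> 'rV[R]_n) : Prop :=
  exists rho u, C1_solution A gamma lambda mu rho_init u_init +oo%E rho u.

Definition lifespan (A gamma lambda mu : R)
    (rho_init : 'rV[R]_n -> R) (u_init : 'rV[R]_n -> 'rV[R]_n) : \bar R :=
  ereal_sup [set T | (0 < T)%E /\
    exists rho u, C1_solution A gamma lambda mu rho_init u_init T rho u].

End Euler.

(* Main.v *)
Require Import Defs.
From mathcomp Require Import all_boot all_order all_algebra.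
From mathcomp Require Import all_classical all_reals all_analysis.
From mathcomp Require Import measurable_realfun lebesgue_integral_under.
From mathcomp Require Import ring lra.
Set Implicit Arguments.
Unset Strict Implicit.
Unset Printing Implicit Defensive.
Import Order.TTheory GRing.Theory Num.Theory.
Import numFieldNormedType.Exports.
Local Open Scope classical_set_scope.
Local Open Scope ring_scope.

(* phi is an average of the plane waves e^{x.s}, |s| = 1, so the two positivity
   assumptions provide a combination Phi = p1 e^{x.s1} + p2 e^{x.s2}, p1, p2 >= 0, with
   int rho0 Phi > 0 and int u0 . grad Phi > 0.  By a relative entropy estimate on backward
   cones the solution is constant for |x| > Rad + c t, where c is the sound speed.  Hence
   X = int (rho - rhobar) Phi satisfies X'' + b X' >= c^2 X + N with b = mu / (1 + t)^lambda,
   where N is the integral of the relative pressure against Phi.  Convexity of the pressure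
   gives N >= k X^2 / (X + M), M being comparable to the mass of Phi on the ball of radius
   Rad + c t, which is O((1 + t)^((n - 1) / 2) e^{c t}).

   Since lambda > 1, b has an integrating factor m with 1 <= m <= C.  The function
   W = m e^{- c t} (X' + c X) is nondecreasing and >= C eps, and with w = e^{- 2 c t}
   int_0^t e^{2 c s} W one has w <= m e^{- c t} X, so F = W + c w satisfies
   F' >= d F^2 / ((1 + t)^((n - 1) / 2) + F).  Conservation of mass bounds F by a power of
   1 + t, which forces int_0^T (1 + t)^(- (n - 1) / 2) dt <= D / eps. *)

(** * Integrals over finite products *)

(** Plane waves make every derivative explicit (the Laplacian of [e^{x.s}] is [e^{x.s}] when
    [|s| = 1]) and dispense with the asymptotics of [phi]. One direction may miss one of the two
    positivity conditions; a separation argument in the plane shows that two suffice.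

    Densities are only nonnegative, so vacuum is allowed and the system cannot be symmetrised there.
    Finite speed rests on the relative energy, whose flux is compared with it only near the constant
    state.

    No direct bound on [X'] is at hand, whence the pair [W], [w]. When [W] is large compared with
    [c w], the equation [w' = W - 2 c w] makes [F] grow; otherwise [F] is comparable to [w], a lower
    bound of [m e^{- c t} X], and the pressure makes [W] grow. The bound given by the mass enters
    through a logarithm. The exponents of the lifespan come from the integral of
    [(1 + t)^(- (n - 1) / 2)] up to [T], of order [T^((3 - n) / 2)] for [n = 1, 2] and equal to
    [log (1 + T)] for [n = 3]. *)

Section TupleIntegral.
Context {R : realType}.
Notation mu := (@lebesgue_measure R).
Notation tm := (tuple_measure (@lebesgue_measure R)).

(** An open set is a countable union of sup-norm balls with rational centres and radii
    [1 / (k + 1)], and each of them pulls back to a product of intervals. *)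
Lemma measurable_tuple_rV_preimage n (U : set 'rV[R]_n) :
  open U -> measurable ((@tuple_rV R n) @^-1` U).
Proof.
move=> oU.
pose F (p : 'rV[rat]_n * nat) : set 'rV[R]_n :=
  let B := ball (map_mx ratr p.1 : 'rV[R]_n) (p.2.+1%:R^-1) in
  if `[< B `<=` U >] then B else set0.
have -> : (@tuple_rV R n) @^-1` U = \bigcup_p ((@tuple_rV R n) @^-1` F p).
  apply/seteqP; split=> [t /= Ut|t [p _]]; last first.
    by rewrite /F /=; case: asboolP => // + Bt; apply.
  have /nbhs_ballP[e /= e0 eU] : nbhs (tuple_rV t) U by apply: open_nbhs_nbhs.
  have [k ke] : exists k : nat, k.+1%:R^-1 < e / 2.
    exists (Num.truncn (e/2)^-1).
    rewrite invf_plt ?posrE ?divr_gt0//.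
    exact: truncnS_gt.
  have /choice[q qP] : forall i : 'I_n, exists q : rat,
      ball (tuple_rV t 0 i) (k.+1%:R^-1) (ratr q : R).
    move=> i; have [q] := @rat_in_itvoo R (tuple_rV t 0 i - k.+1%:R^-1)
       (tuple_rV t 0 i + k.+1%:R^-1) ltac:(rewrite ltrD2l gtrN// invr_gt0//).
    by rewrite in_itv/= => qq; exists q; rewrite /ball/= ltr_distlC.
  exists (\row_i q i, k) => //=; rewrite /F/=.
  case: asboolP => [_|]; last first.
    move=> nBU; exfalso; apply: nBU => y By; apply: eU; split=> // a b; rewrite ord1.
    have {}By := By.2 0 b; rewrite !mxE in By.
    have := @ball_triangle _ _ _ _ _ _ _ (qP b) By.
    apply: le_ball.
    by rewrite (splitr e) ltW// ltrD.
  split=> [|a b]; first by rewrite invr_gt0.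
  rewrite ord1 !mxE; apply: ball_sym.
  by have := qP b; rewrite mxE.
apply: countable_bigcupT_measurable; first exact: countableP.
move=> p; rewrite /F; case: asboolP => _; last by rewrite preimage_set0.
have -> : (@tuple_rV R n) @^-1` ball (map_mx ratr p.1 : 'rV[R]_n) (p.2.+1%:R^-1)
  = \bigcap_(i in [set: 'I_n]) ((@tnth n R ^~ i) @^-1`
      ball (ratr (p.1 0 i) : R) (p.2.+1%:R^-1)).
  apply/seteqP; split=> [t /= H i _/=|t H].
    by have := H.2 0 i; rewrite !mxE.
  split=> [|a b]; first by rewrite invr_gt0.
  by rewrite ord1 !mxE; exact: (H b).
apply: fin_bigcap_measurable; first exact: finite_finset.
move=> i _; rewrite -[X in measurable X]setTI.
apply: measurable_tnth => //.
by rewrite ball_itv; exact: measurable_itv.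
Qed.

Lemma measurable_continuous_tuple n (f : 'rV[R]_n -> R) : continuous f ->
  measurable_fun setT (f \o @tuple_rV R n).
Proof.
move=> cf; apply: (measurability _ (RGenOpens.measurableE R)).
move=> _ [_ [a [b ->]] <-]; rewrite setTI comp_preimage.
apply: measurable_tuple_rV_preimage.
by apply: open_comp => // x _; exact: cf.
Qed.

Local Open Scope ereal_scope.

Lemma integral_tuple_cons n (f : n.+1.-tuple (measurableTypeR R) -> \bar R) :
  measurable_fun setT f -> (forall t, 0 <= f t) ->
  \int[tm n.+1]_t f t =
  \int[mu]_x \int[tm n]_t f [the n.+1.-tuple (measurableTypeR R) of x :: t].
Proof.
move=> mf f0; rewrite /=.
transitivity (\int[product_measure1 mu (tm n)]_z f (tuple_cons z)).
  rewrite /cons_measure.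
  rewrite (@ge0_integral_pushforward _ _ _ _ _ _ (@measurable_tuple_cons _ _ n))//.
rewrite fubini_tonelli1//.
exact: measurableT_comp (@measurable_tuple_cons _ _ n).
Qed.

Lemma integral_tuple0 (f : 0.-tuple (measurableTypeR R) -> \bar R) :
  measurable_fun setT f -> \int[tm 0]_t f t = f [tuple].
Proof. by move=> mf; rewrite /= integral_dirac//= diracT mul1e. Qed.

(** Tonelli for separated variables; the cube and Gaussian majorants used below have this form. *)
Lemma ge0_integral_tuple_prod n (f : 'I_n -> measurableTypeR R -> R) (a : 'I_n -> R) :
  (forall i, measurable_fun setT (f i)) -> (forall i x, (0 <= f i x)%R) ->
  (forall i, \int[mu]_x (f i x)%:E = (a i)%:E) ->
  \int[tm n]_t (\prod_(i < n) f i (tnth t i))%:E = (\prod_(i < n) a i)%:E.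
Proof.
elim: n f a => [|n IHn] f a mf f0 fa.
  rewrite integral_tuple0; first by rewrite !big_ord0.
  by rewrite (_ : (fun _ => _) = cst 1)//; apply/funext => t; rewrite big_ord0.
have mprod k (g : 'I_k -> measurableTypeR R -> R) : (forall i, measurable_fun setT (g i)) ->
    measurable_fun setT (fun t : k.-tuple (measurableTypeR R) => \prod_(i < k) g i (tnth t i))%R.
  move=> mg; apply: measurable_prod => i _.
  by apply: (measurableT_comp (mg i)); exact: measurable_tnth.
rewrite integral_tuple_cons; last 2 first.
- by apply/measurable_EFinP; exact: mprod.
- by move=> t; rewrite lee_fin; apply: prodr_ge0.
transitivity (\int[mu]_x ((f ord0 x)%:E * (\prod_(i < n) a (lift ord0 i))%:E)).
  apply: eq_integral => x _.
  rewrite -(IHn (fun i => f (lift ord0 i)))//.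
  rewrite -ge0_integralZl//.
  - apply: eq_integral => t _; rewrite big_ord_recl /= EFinM.
    congr (_ * _%:E); apply: eq_bigr => i _; congr (f _ _).
    by rewrite (tnth_nth x) /= [RHS](tnth_nth x).
  - by apply/measurable_EFinP; apply: (mprod _ (fun i => f (lift ord0 i))) => i.
  - by move=> t _; rewrite lee_fin; apply: prodr_ge0.
  - by rewrite lee_fin.
rewrite ge0_integralZr//.
- by rewrite fa -EFinM big_ord_recl.
- exact/measurable_EFinP.
- by move=> x _; rewrite lee_fin.
- rewrite lee_fin; apply: prodr_ge0 => i _; rewrite -lee_fin -fa.
  by apply: integral_ge0 => x _; rewrite lee_fin.
Qed.

Definition tuple_shift n (v : 'rV[R]_n) (t : n.-tuple (measurableTypeR R)) :
  n.-tuple (measurableTypeR R) := [tuple (tnth t i + v 0%R i)%R | i < n].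

Lemma tuple_rV_shift n (v : 'rV[R]_n) t : tuple_rV (tuple_shift v t) = (tuple_rV t + v)%R.
Proof. by apply/rowP => i; rewrite !mxE tnth_mktuple. Qed.

Lemma measurable_tuple_shift n (v : 'rV[R]_n) : measurable_fun setT (tuple_shift v).
Proof.
apply/measurable_fun_tnthP => i.
rewrite (_ : _ \o _ = fun t => (tnth t i + v 0%R i)%R); last first.
  by apply/funext => t /=; rewrite tnth_mktuple.
by apply: measurable_funD => //; exact: measurable_tnth.
Qed.

Lemma ge0_integral_translate (a : R) (f : measurableTypeR R -> \bar R) :
  measurable_fun setT f -> (forall x, 0 <= f x) ->
  \int[mu]_x f (x + a)%R = \int[mu]_x f x.
Proof.
move=> mf f0.
pose T : measurableTypeR R -> measurableTypeR R := fun x => (x + a)%R.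
have mT : measurable_fun setT T by exact: measurable_funD.
rewrite [LHS](_ : _ = \int[pushforward mu T]_x f x).
  apply: eq_measure_integral => //= A mA _.
  (* Lebesgue measure is determined by its values on half-open intervals, which a translation
     preserves. *)
  apply/esym/lebesgue_measure_unique => //= _ [[b c]] _ <-.
  rewrite /pushforward (_ : T @^-1` _ = `](b - a)%R, (c - a)%R]%classic).
    rewrite !lebesgue_measure_itv/= !lte_fin ltrD2r.
    by case: ifP => // _; rewrite -!EFinD; congr EFin; ring.
  by apply/seteqP; split => x /=; rewrite !in_itv/= ltrBlDr lerBrDr.
by rewrite ge0_integral_pushforward.
Qed.

Lemma ge0_integral_tuple_shift n (v : 'rV[R]_n) (f : n.-tuple (measurableTypeR R) -> \bar R) :
  measurable_fun setT f -> (forall t, 0 <= f t) ->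
  \int[tm n]_t f (tuple_shift v t) = \int[tm n]_t f t.
Proof.
elim: n v f => [|n IHn] v f mf f0.
  by apply: eq_integral => t _; rewrite (tuple0 t) (tuple0 (tuple_shift _ _)).
have mcons x : measurable_fun setT (fun t : n.-tuple (measurableTypeR R) =>
     f [the n.+1.-tuple (measurableTypeR R) of x :: t]).
  apply: measurableT_comp => //.
  exact: measurable_cons.
rewrite integral_tuple_cons//; last first.
  by apply: measurableT_comp => //; exact: measurable_tuple_shift.
rewrite [RHS](integral_tuple_cons mf f0).
pose g (x : measurableTypeR R) := \int[tm n]_t f [the n.+1.-tuple (measurableTypeR R) of x :: t].
rewrite -(@ge0_integral_translate (v 0%R ord0) g).
- apply: eq_integral => x _; rewrite /g.
  rewrite -[RHS](IHn (\row_i v 0%R (lift ord0 i))%R)//.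
  apply: eq_integral => t _; congr f.
  apply: eq_from_tnth => i; rewrite tnth_mktuple.
  case: (unliftP ord0 i) => [j ->|->]; last by rewrite !(tnth_nth x).
  by rewrite !tnthS tnth_mktuple mxE.
- apply: (@measurable_fun_fubini_tonelli_F _ _ _ _ _ (tm n) (fun z => f (tuple_cons z))).
    exact: measurableT_comp (@measurable_tuple_cons _ _ n).
  by move=> z; exact: f0.
- by move=> x; apply: integral_ge0.
Qed.

Lemma integral_tuple_shift n (v : 'rV[R]_n) (f : n.-tuple (measurableTypeR R) -> \bar R) :
  measurable_fun setT f ->
  \int[tm n]_t f (tuple_shift v t) = \int[tm n]_t f t.
Proof.
move=> mf; rewrite [LHS]integralE [RHS]integralE; congr (_ - _).
  rewrite -[RHS](@ge0_integral_tuple_shift n v f^\+)//; last exact: measurable_funepos.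
  by apply: eq_integral => t _; rewrite !funeposE.
rewrite -[RHS](@ge0_integral_tuple_shift n v f^\-)//; last exact: measurable_funeneg.
by apply: eq_integral => t _; rewrite !funenegE.
Qed.

End TupleIntegral.

(** * Bounded functions with compact support *)

Section BoundedCompactSupport.
Context {R : realType} {n : nat}.
Notation mu := (@lebesgue_measure R).
Notation tm := (tuple_measure (@lebesgue_measure R)).
Notation E := 'rV[R]_n.
Notation I f := (integral_Rn [set: E] f).
Implicit Types (f g : E -> R) (v : E).

Lemma ler_coord_norm (x : E) i : `|x 0 i| <= `|x|.
Proof.
rewrite [`|x|]/Num.norm/= mx_normrE.
exact: (@le_bigmax _ _ _ _ (fun ij : 'I_1 * 'I_n => `|x ij.1 ij.2|) (0, i)).
Qed.

Lemma ler_norm_coord (x : E) K : 0 <= K -> (forall i, `|x 0 i| <= K) -> `|x| <= K.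
Proof.
move=> K0 H; rewrite [`|x|]/Num.norm/= mx_normrE.
by apply: bigmax_le => // -[i j] _ /=; rewrite ord1.
Qed.

Definition lift_tuple f (t : n.-tuple (measurableTypeR R)) : R := f (tuple_rV t).

(* bcs: (measurable) bounded function with compact support *)
Definition bcs f := measurable_fun setT (lift_tuple f) /\
  exists K, forall x, `|f x| <= K /\ (K < `|x| -> f x = 0).

Lemma integral_RnE f : I f = \int[tm n]_t (lift_tuple f t).
Proof. by []. Qed.

(** Indicator of a cube rather than of a ball: as a product of one-variable indicators it has an
    explicit integral. *)
Let box K (t : n.-tuple (measurableTypeR R)) : R :=
  \prod_(i < n) \1_(`[(- K)%R, K]%classic : set R) (tnth t i).

Let measurable_box K : measurable_fun setT (box K).
Proof.
apply: measurable_prod => i _.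
apply: (@measurableT_comp _ _ _ _ _ _ (\1_(`[(- K)%R, K]%classic : set (measurableTypeR R)) : _ -> R)).
  by apply: measurable_indic; exact: measurable_itv.
exact: measurable_tnth.
Qed.

Let box_ge0 K t : 0 <= box K t.
Proof. by apply: prodr_ge0 => i _; rewrite indicE. Qed.

Let integrable_box K : 0 <= K -> (tm n).-integrable setT (EFin \o box K).
Proof.
move=> K0; apply/integrableP; split; first by apply/measurable_EFinP; exact: measurable_box.
under eq_integral do rewrite /= ger0_norm ?box_ge0//.
rewrite (@ge0_integral_tuple_prod _ _ (fun _ => \1_(`[(- K)%R, K]%classic : set R))
   (fun _ => (K + K))).
- exact: ltry.
- by move=> i; apply: measurable_indic; exact: measurable_itv.
- by move=> i x; rewrite indicE.
- move=> i; rewrite integral_indic//= setIT lebesgue_measure_itv/= lte_fin.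
  case: ifPn => [_|]; first by rewrite -EFinB opprK.
  by rewrite -leNgt => KK; congr EFin; lra.
Qed.

Lemma bcs_le_box f : bcs f -> exists2 K, 0 <= K & forall t, `|lift_tuple f t| <= K * box K t.
Proof.
move=> [mf [K HK]]; exists `|K| => // t.
have [allK|] := pselect (forall i, `|tnth t i| <= `|K|).
  rewrite /box big1 ?mulr1; last first.
    by move=> i _; rewrite indicE mem_set//= in_itv/= -ler_norml.
  by apply: le_trans (HK _).1 _; exact: ler_norm.
move=> /existsNP[i /negP]; rewrite -ltNge => Ki.
rewrite /lift_tuple (HK _).2 ?normr0 ?mulr_ge0 ?box_ge0//.
apply: le_lt_trans (ler_norm _) _; apply: lt_le_trans Ki _.
by have := ler_coord_norm (tuple_rV t) i; rewrite mxE.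
Qed.

Lemma bcs_integrable f : bcs f -> (tm n).-integrable setT (EFin \o lift_tuple f).
Proof.
move=> bf; have [K K0 HK] := bcs_le_box bf.
apply: (@le_integrable _ _ _ _ _ measurableT _ (fun t => (K * box K t)%:E)).
- by apply/measurable_EFinP; exact: bf.1.
- move=> t _; rewrite /= lee_fin [leRHS]ger0_norm ?mulr_ge0 ?box_ge0//.
- under [X in _.-integrable _ X]eq_fun do rewrite EFinM.
  exact: integrableZl (integrable_box K0).
Qed.

Lemma bcs0 : bcs (fun=> 0).
Proof. by split; [exact: measurable_cst|exists 0 => x; rewrite normr0]. Qed.

Lemma bcsD f g : bcs f -> bcs g -> bcs (fun x => f x + g x).
Proof.
move=> [mf [K HK]] [mg [L HL]]; split; first exact: measurable_funD.
exists (`|K| + `|L|) => x; split.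
  apply: le_trans (ler_normD _ _) (lerD _ _).
    exact: le_trans (HK x).1 (ler_norm _).
  exact: le_trans (HL x).1 (ler_norm _).
move=> KLx; rewrite (HK x).2 ?(HL x).2 ?addr0//.
  by have := ler_norm L; have := normr_ge0 K; lra.
by have := ler_norm K; have := normr_ge0 L; lra.
Qed.

Lemma bcsMl f g : measurable_fun setT (lift_tuple f) ->
  (forall K, exists L, forall x, `|x| <= K -> `|f x| <= L) ->
  bcs g -> bcs (fun x => f x * g x).
Proof.
move=> mf fb [mg [K HK]]; split; first exact: measurable_funM.
have [L HL] := fb K.
exists (`|K| + `|L| * `|K|) => x; split; last first.
  move=> Kx; rewrite (HK x).2 ?mulr0//; apply: le_lt_trans Kx.
  by have := ler_norm K; have : 0 <= `|L| * `|K| by []; lra.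
have [xK|Kx] := leP `|x| K; last by rewrite (HK x).2// mulr0 normr0.
rewrite normrM; apply: ler_wpDl => //; apply: ler_pM => //.
  exact: le_trans (HL _ xK) (ler_norm _).
exact: le_trans (HK x).1 (ler_norm _).
Qed.

Lemma continuous_bounded_on_balls f : continuous f ->
  forall K, exists L, forall x, `|x| <= K -> `|f x| <= L.
Proof.
move=> cf K.
have [K0|K0] := leP 0 K; last first.
  by exists 0 => x xK; have := normr_ge0 x; lra.
pose A := [set x : E | `|x| <= K].
have cA : compact A.
  apply: bounded_closed_compact.
    exists K; split; first exact: num_real.
    by move=> y Ky x /= xK; exact: le_trans xK (ltW Ky).
  apply: (@closed_comp _ _ (@Num.norm _ E) [set y | y <= K]); last exact: closed_le.
  by move=> x _; exact: norm_continuous.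
have [||c cA' Hc] := @EVT_max_rV R n (fun x => `|f x|) A _ cA.
- by exists 0; rewrite /A/= normr0.
- apply: continuous_subspaceT => x.
  apply: continuous_comp; [exact: cf|exact: norm_continuous].
by exists `|f c| => x xK; apply: Hc; rewrite inE.
Qed.

Lemma bcsM f g : continuous f -> bcs g -> bcs (fun x => f x * g x).
Proof.
move=> cf; apply: bcsMl; last exact: continuous_bounded_on_balls.
exact: measurable_continuous_tuple.
Qed.

Lemma bcsZ (a : R) f : bcs f -> bcs (fun x => a * f x).
Proof. by apply: bcsM => x; exact: cst_continuous. Qed.

Lemma bcs_continuous f K : continuous f -> (forall x, K < `|x| -> f x = 0) -> bcs f.
Proof.
move=> cf fK; split; first exact: measurable_continuous_tuple.
have [L HL] := continuous_bounded_on_balls cf K.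
exists (`|L| + `|K|) => x.
have ? : K <= `|K| := ler_norm K.
have ? : L <= `|L| := ler_norm L.
have ? : 0 <= `|K| := normr_ge0 K.
have ? : 0 <= `|L| := normr_ge0 L.
split; last by move=> ?; apply: fK; lra.
have [xK|Kx] := leP `|x| K; first by have := HL _ xK; lra.
by rewrite fK// normr0 addr_ge0.
Qed.

Lemma bcs_indicator f (A : set E) K : measurable_fun setT (lift_tuple f) ->
  (forall K, exists L, forall x, `|x| <= K -> `|f x| <= L) ->
  closed A -> (forall x, A x -> `|x| <= K) -> bcs (fun x => f x * \1_A x).
Proof.
move=> mf fb cA AK; apply: bcsMl => //; split.
  rewrite (_ : lift_tuple _ = \1_((@tuple_rV R n : n.-tuple (measurableTypeR R) -> E) @^-1` A)); last first.
    by apply/funext => t; rewrite /lift_tuple !indicE.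
  apply: measurable_indic; rewrite -[X in measurable X]setCK.
  apply: measurableC; rewrite preimage_setC.
  by apply: measurable_tuple_rV_preimage; exact: closed_openC.
exists (1 + `|K|) => x; split; first by rewrite indicE ger0_norm// ler_wpDr// lern1 leq_b1.
move=> Kx; rewrite indicE memNset// => /AK; apply/negP; rewrite -ltNge.
by have := ler_norm K; lra.
Qed.

Lemma integral_RnD f g : bcs f -> bcs g -> I (fun x => f x + g x) = I f + I g.
Proof. by move=> bf bg; exact: RintegralD (bcs_integrable bf) (bcs_integrable bg). Qed.

Lemma integral_RnZ (a : R) f : bcs f -> I (fun x => a * f x) = a * I f.
Proof. by move=> bf; exact: RintegralZl (bcs_integrable bf). Qed.

Lemma integral_RnB f g : bcs f -> bcs g -> I (fun x => f x - g x) = I f - I g.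
Proof. by move=> bf bg; exact: RintegralB (bcs_integrable bf) (bcs_integrable bg). Qed.

Lemma le_integral_Rn f g : bcs f -> bcs g -> (forall x, f x <= g x) -> I f <= I g.
Proof.
move=> bf bg fg; rewrite !integral_RnE; apply: le_Rintegral => //; [exact: bcs_integrable bf|exact: bcs_integrable bg|].
by move=> t _; exact: fg.
Qed.

Lemma integral_Rn_ge0 f : (forall x, 0 <= f x) -> 0 <= I f.
Proof. by move=> f0; apply: Rintegral_ge0 => t _; exact: f0. Qed.

Lemma integral_Rn_sum m (f : 'I_m -> E -> R) : (forall i, bcs (f i)) ->
  bcs (fun x => \sum_i f i x) /\ I (fun x => \sum_i f i x) = \sum_i I (f i).
Proof.
elim: m f => [|m IHm] f bf.
  rewrite big_ord0 (_ : (fun x => _) = fun=> 0); last by apply/funext => x; rewrite big_ord0.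
  by split; [exact: bcs0|rewrite /integral_Rn Rintegral_cst ?mul0r//; exact: measurableT].
have [b1 e1] := IHm _ (fun i => bf (lift ord0 i)).
rewrite (_ : (fun x => _) = fun x => f ord0 x + \sum_i f (lift ord0 i) x); last first.
  by apply/funext => x; rewrite big_ord_recl.
by split; [exact: bcsD|rewrite integral_RnD// e1 big_ord_recl].
Qed.

Lemma integral_Rn_shift v f : bcs f -> I (fun x => f (x + v)) = I f.
Proof.
move=> bf; have mf := bf.1.
rewrite !integral_RnE /Rintegral -(@integral_tuple_shift _ _ v (EFin \o lift_tuple f)); last first.
  exact/measurable_EFinP.
by congr fine; apply: eq_integral => t _; rewrite /= /lift_tuple tuple_rV_shift.
Qed.

End BoundedCompactSupport.

(** * Differentiation and integration by parts *)

Section CalculusUnderIntegral.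
Context {R : realType} {n : nat}.
Notation mu := (@lebesgue_measure R).
Notation tm := (tuple_measure (@lebesgue_measure R)).
Notation E := 'rV[R]_n.
Notation I f := (integral_Rn [set: E] f).

Lemma compact_closed_ball (K : R) : compact [set x : E | `|x| <= K].
Proof.
apply: bounded_closed_compact.
  exists K; split; first exact: num_real.
  by move=> y Ky x /= xK; exact: le_trans xK (ltW Ky).
apply: (@closed_comp _ _ (@Num.norm _ E) [set y | y <= K]); last exact: closed_le.
by move=> x _; exact: norm_continuous.
Qed.

Lemma closed_closed_ball (K : R) : closed [set x : E | `|x| <= K].
Proof.
apply: (@closed_comp _ _ (@Num.norm _ E) [set y | y <= K]); last exact: closed_le.
by move=> x _; exact: norm_continuous.
Qed.

Lemma continuous_bounded_rectangle (F : R -> E -> R) (u v K : R) :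
  continuous (fun z : R * E => F z.1 z.2) ->
  exists2 L, 0 <= L & forall t x, u <= t <= v -> `|x| <= K -> `|F t x| <= L.
Proof.
move=> cF.
have [uv|vu] := leP u v; last first.
  by exists 0 => // t x /andP[ut tv]; have := le_trans ut tv; rewrite leNgt vu.
have [K0|K0] := leP 0 K; last first.
  by exists 0 => // t x _ xK; have := normr_ge0 x; lra.
pose A := `[u, v]%classic `*` [set x : E | `|x| <= K].
have cA : compact A.
  by apply: compact_setX; [exact: segment_compact|exact: compact_closed_ball].
have [||c cA' Hc] := @compact_EVT_max (R * E)%type R (fun z => `|F z.1 z.2|) A _ cA.
- by exists (u, 0); split => /=; rewrite ?in_itv/= ?lexx ?uv ?normr0.
- apply: continuous_subspaceT => x.
  by apply: continuous_comp; [exact: cF|exact: norm_continuous].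
exists `|F c.1 c.2| => // t x tuv xK.
by apply: (Hc (t, x)); rewrite inE; split => //=; rewrite in_itv/=.
Qed.

Lemma cvg_slice (t : R) (x : E) : (t, y) @[y --> x] --> (t, x).
Proof. by apply: (@cvg_pair _ _ _ (nbhs x) (nbhs t) (nbhs x) _ _ _ (fun=> t) id); [exact: cvg_cst|exact: cvg_id]. Qed.

Lemma cvg_slice_time (t : R) (x : E) : (s, x) @[s --> t] --> (t, x).
Proof. by apply: (@cvg_pair _ _ _ (nbhs t) (nbhs t) (nbhs x) _ _ _ id (fun=> x)); [exact: cvg_id|exact: cvg_cst]. Qed.

Lemma cvg_translate (x v : E) : y + v @[y --> x] --> x + v.
Proof. by apply: (@cvgD _ _ _ (nbhs x) _ id (fun=> v)); [exact: cvg_id|exact: cvg_cst]. Qed.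

Lemma continuous_slice (F : R -> E -> R) t : continuous (fun z : R * E => F z.1 z.2) ->
  continuous (F t).
Proof.
move=> cF x.
apply: (@cvg_comp _ _ _ (fun y => (t, y)) (fun z : R * E => F z.1 z.2) _ (nbhs (t, x))); [exact: cvg_slice|exact: (cF (t, x))].
Qed.

Lemma continuous_slice_time (F : R -> E -> R) x : continuous (fun z : R * E => F z.1 z.2) ->
  continuous (F ^~ x).
Proof.
move=> cF t.
apply: (@cvg_comp _ _ _ (fun s => (s, x)) (fun z : R * E => F z.1 z.2) _ (nbhs (t, x))); [exact: cvg_slice_time|exact: (cF (t, x))].
Qed.

Let bcs_ball (L K : R) : bcs (fun x : E => L * \1_[set x : E | `|x| <= K] x).
Proof.
apply: (@bcs_indicator _ _ (fun=> L) _ K) => //.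
- exact: measurable_cst.
- by move=> K'; exists `|L|.
- exact: closed_closed_ball.
Qed.

(** Dominated convergence: on a compact time interval [ft] is bounded by a constant times the
    indicator of the ball of radius [K]. *)
Lemma integral_Rn_derive (f ft : R -> E -> R) (a b K : R) :
  (forall t, a < t < b -> bcs (f t)) ->
  (forall t x, a < t < b -> is_derive t 1 (f ^~ x) (ft t x)) ->
  continuous (fun z : R * E => ft z.1 z.2) ->
  (forall t x, a < t < b -> K < `|x| -> ft t x = 0) ->
  forall t, a < t < b -> is_derive t 1 (fun s => I (f s)) (I (ft t)).
Proof.
move=> bf df cft ft0 t /andP[at_ tb].
pose u := (a + t) / 2; pose v := (t + b) / 2.
have au : a < u by rewrite /u; lra.
have ut : u < t by rewrite /u; lra.
have tv : t < v by rewrite /v; lra.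
have vb : v < b by rewrite /v; lra.
have uvab s : `]u, v[%classic s -> a < s < b.
  by rewrite /= in_itv/= => /andP[us sv]; rewrite (lt_trans au us) (lt_trans sv vb).
have [L L0 HL] := @continuous_bounded_rectangle ft u v K cft.
have Itv : `]u, v[%classic t by rewrite /= in_itv/= ut tv.
have d1 s (y : n.-tuple (measurableTypeR R)) : `]u, v[%classic s ->
    partial1of2 (fun s => lift_tuple (f s)) s y = lift_tuple (ft s) y.
  move=> /uvab sab; rewrite /partial1of2 derive1E /lift_tuple.
  by have [_ ->] := df s (tuple_rV y) sab.
have := @cvg_differentiation_under_integral R _ _ (tm n) (fun s => lift_tuple (f s)) setT
  measurableT t u v Itv _ _ (lift_tuple (fun x : E => L * \1_[set x : E | `|x| <= K] x)).
move=> H.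
have {}H : h^-1 *: (I (f (h + t)) - I (f t)) @[h --> 0^'] --> I (ft t).
  rewrite (_ : I (ft t) = \int[tm n]_y (partial1of2 (fun s => lift_tuple (f s)) t y)); last first.
    rewrite integral_RnE; apply: eq_Rintegral => y _; exact/esym/d1.
  apply: H.
  - by move=> s /uvab /bf /bcs_integrable.
  - by move=> s y /uvab sab _; have [] := df s (tuple_rV y) sab.
  - by move=> y; rewrite /lift_tuple mulr_ge0// indicE.
  - exact: (bcs_integrable (bcs_ball L K)).
  - move=> s y Is _; rewrite d1// /lift_tuple indicE.
    have [yK|Ky] := leP `|tuple_rV y| K.
      rewrite mem_set// mulr1; apply: HL => //.
      by move: Is; rewrite /= in_itv/= => /andP[/ltW -> /ltW ->].
    by rewrite ft0 ?normr0 ?mulr_ge0//; exact: uvab.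
have D : derivable (fun s => I (f s)) t 1.
  apply/cvg_ex; exists (I (ft t)).
  by under eq_fun do rewrite scaler1.
split => //; rewrite /derive; apply/cvg_lim => //.
by under eq_fun do rewrite scaler1.
Qed.

Lemma integral_Rn_continuous (f : R -> E -> R) (K : R) :
  continuous (fun z : R * E => f z.1 z.2) ->
  (forall t x, K < `|x| -> f t x = 0) ->
  continuous (fun t => I (f t)).
Proof.
move=> cf f0 t.
have cft s : continuous (f s) by exact: continuous_slice.
have cfx x : continuous (f ^~ x) by exact: continuous_slice_time.
have [L L0 HL] := @continuous_bounded_rectangle f (t - 1) (t + 1) K cf.
have tI : t \in `]t - 1, t + 1[%classic.
  by rewrite inE/= in_itv/=; apply/andP; split; lra.
apply: (@continuity_under_integral R _ _ (tm n) (fun s => lift_tuple (f s)) setT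
  measurableT (t - 1) (t + 1) _ _ (lift_tuple (fun x : E => L * \1_[set x : E | `|x| <= K] x)) _ _ t tI).
- move=> s _; apply: bcs_integrable; apply: bcs_continuous (f0 s); exact: cft.
- by apply: aeW => y _ s _; exact: cfx.
- exact: (bcs_integrable (bcs_ball L K)).
- move=> s; rewrite /= in_itv/= => /andP[ts st]; apply: aeW => y _; rewrite /lift_tuple indicE.
  have [yK|Ky] := leP `|tuple_rV y| K.
    by rewrite mem_set// mulr1; apply: HL => //; rewrite (ltW ts) (ltW st).
  by rewrite f0 ?normr0 ?mulr_ge0.
Qed.

Lemma is_derive_line (f : E -> R) (x v : E) (h l : R) :
  is_derive (x + h *: v) v f l -> is_derive h 1 (fun s : R => f (x + s *: v)) l.
Proof.
move=> [df dl].
have e : (fun s : R => s^-1 *: (f (x + (s *: 1 + h) *: v) - f (x + h *: v))) =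
    (fun s : R => s^-1 *: (f (s *: v + (x + h *: v)) - f (x + h *: v))).
  apply/funext => s; congr (_ *: (f _ - _)).
  by rewrite [s *: 1]mulr1 scalerDl addrCA addrA.
by split; rewrite /derivable /derive e.
Qed.

Lemma is_derive_of_line (f : E -> R) (x v : E) (l : R) :
  is_derive (0 : R) 1 (fun s : R => f (x + s *: v)) l -> is_derive x v f l.
Proof.
move=> [df dl].
have e : (fun s : R => s^-1 *: (f (x + (s *: 1 + 0) *: v) - f (x + 0 *: v))) =
    (fun s : R => s^-1 *: (f (s *: v + x) - f x)).
  apply/funext => s; congr (_ *: (f _ - f _)); last by rewrite scale0r addr0.
  by rewrite [s *: 1]mulr1 addr0 addrC.
by split; [move: df; rewrite /derivable e|move: dl; rewrite /derive e].
Qed.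

(** By translation invariance the integral of [f (x + h v)] does not depend on [h], and its
    derivative at [h = 0] is the integral of [g]. *)
Lemma integral_Rn_partial (f g : E -> R) (v : E) (K : R) :
  (forall x, is_derive x v f (g x)) -> continuous f -> continuous g ->
  (forall x, K < `|x| -> f x = 0) -> (forall x, K < `|x| -> g x = 0) -> I g = 0.
Proof.
move=> dfg cf cg f0 g0.
have bf : bcs f by apply: bcs_continuous f0.
(* For [|h| < 1] all translates vanish outside one ball, of radius [K + |v|]. *)
have Kh h (x : E) : -1 < h < 1 -> K + `|v| < `|x| -> K < `|x + h *: v|.
  move=> /andP[h1 h2] Kx.
  have hv : `|h *: v| <= `|v|.
    by rewrite normrZ ler_piMl// ler_norml; apply/andP; split; lra.
  have : `|x| <= `|x + h *: v| + `|h *: v|.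
    by rewrite -{1}(addrK (h *: v) x); exact: ler_normB.
  by move: hv Kx; lra.
have [D Dl] : is_derive (0:R) 1 (fun h : R => I (fun x => f (x + h *: v))) (I (fun x => g (x + 0 *: v))).
  apply: (@integral_Rn_derive _ (fun h x => g (x + h *: v)) (-1) 1 (K + `|v|)).
  - move=> t tI; apply: (bcs_continuous (K := K + `|v|)).
      by move=> x; apply: (@cvg_comp _ _ _ (fun y => y + t *: v) f _ (nbhs (x + t *: v))); [exact: cvg_translate|exact: cf].
    by move=> x Kx; apply: f0; exact: Kh.
  - by move=> t x _; apply: is_derive_line; exact: dfg.
  - move=> z; apply: (@cvg_comp _ _ _ (fun z : R * E => z.2 + z.1 *: v) g _ (nbhs (z.2 + z.1 *: v))); last exact: cg.
    apply: cvgD; first exact: cvg_snd.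
    apply: cvgZr_tmp; exact: cvg_fst.
  - by move=> t x tI Kx; apply: g0; exact: Kh.
  - by rewrite ltrN10 ltr01.
rewrite (_ : (fun x => _) = g) in Dl; last by apply/funext => x; rewrite scale0r addr0.
rewrite -Dl (_ : (fun h => _) = cst (I f)) ?derive_cst//.
by apply/funext => h /=; exact: integral_Rn_shift.
Qed.

(** If [f x > 0], then [f >= f x / 2] on a cube around [x], whose volume is positive. *)
Lemma integral_Rn_eq0 (f : E -> R) (K : R) : continuous f ->
  (forall x, K < `|x| -> f x = 0) -> (forall x, 0 <= f x) -> I f = 0 -> forall x, f x = 0.
Proof.
move=> cf fK f0 If0 x; apply/eqP; rewrite eq_le f0 andbT leNgt; apply/negP => fx.
have bf : bcs f by apply: bcs_continuous fK.
have /cf/nbhs_ballP[e /= e0 He] : nbhs (f x) `](f x / 2), +oo[%classic.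
  by apply: open_nbhs_nbhs; split; [exact: interval_open|rewrite /= in_itv/= andbT; lra].
pose d := e / 2.
have d0 : 0 < d by rewrite divr_gt0.
pose B (i : 'I_n) : set R := `[x 0 i - d, x 0 i + d]%classic.
have mB i : measurable_fun setT (\1_(B i) : measurableTypeR R -> R).
  by apply: measurable_indic; exact: measurable_itv.
have IB : (\int[tm n]_t (\prod_(i < n) (\1_(B i) (tnth t i) : R))%:E = (\prod_(i < n) (d + d))%:E)%E.
  apply: (@ge0_integral_tuple_prod R n (fun i => \1_(B i)) (fun _ => d + d)).
  - by [].
  - by move=> i y; rewrite indicE.
  - move=> i; rewrite integral_indic//= ?setIT; last exact: measurable_itv.
    rewrite lebesgue_measure_itv/= lte_fin ifT; last lra.
    by rewrite -EFinB; congr EFin; ring.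
have : (\int[tm n]_t ((f x / 2) * \prod_(i < n) (\1_(B i) (tnth t i) : R))%:E <=
       \int[tm n]_t (lift_tuple f t)%:E)%E.
  apply: ge0_le_integral => //.
  - move=> t _; rewrite lee_fin mulr_ge0 ?divr_ge0//.
    by apply: prodr_ge0 => i _; rewrite indicE.
  - apply/measurable_EFinP; apply: measurable_funM => //.
    apply: measurable_prod => i _; apply: (measurableT_comp (mB i)); exact: measurable_tnth.
  - by apply/measurable_EFinP; exact: bf.1.
  - move=> t _; rewrite lee_fin /lift_tuple.
    have [tB|] := pselect (forall i, B i (tnth t i)); last first.
      move=> /existsNP[i Bi]; rewrite (bigD1 i)//= indicE memNset// mul0r mulr0; exact: f0.
    rewrite big1 ?mulr1; last by move=> i _; rewrite indicE mem_set.
    have : ball x e (tuple_rV t).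
      split => // j i; rewrite ord1 /ball/= mxE.
      have := tB i; rewrite /B /= in_itv/= => /andP[t1 t2].
      apply: (@le_lt_trans _ _ d); last by rewrite /d; lra.
      by rewrite ler_distl; apply/andP; split; lra.
    by move=> /He; rewrite /= in_itv/= andbT => /ltW.
under eq_integral do rewrite EFinM.
rewrite ge0_integralZl//; first last.
- by rewrite lee_fin divr_ge0.
- by move=> t _; rewrite lee_fin; apply: prodr_ge0 => i _; rewrite indicE.
- apply/measurable_EFinP.
  apply: measurable_prod => i _; apply: (measurableT_comp (mB i)); exact: measurable_tnth.
rewrite IB; move: If0; rewrite integral_RnE /Rintegral => If0.
have : (\int[tm n]_t (lift_tuple f t)%:E)%E \is a fin_num.
  by apply: integrable_fin_num => //; exact: bcs_integrable bf.
move=> /fineK <-; rewrite If0 -EFinM lee_fin.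
apply/negP; rewrite -ltNge mulr_gt0 ?divr_gt0//.
by apply: prodr_gt0 => i _; rewrite addr_gt0.
Qed.

End CalculusUnderIntegral.

(** * The mass of a plane wave on a ball *)

Section EuclideanNorm.
Context {R : realType} {n : nat}.
Notation E := 'rV[R]_n.
Implicit Types (x y s : E).

Lemma dotrvC x y : dotrv x y = dotrv y x.
Proof. by apply: eq_bigr => i _; rewrite mulrC. Qed.

Lemma dotrvDl x y s : dotrv (x + y) s = dotrv x s + dotrv y s.
Proof. by rewrite -big_split/=; apply: eq_bigr => i _; rewrite mxE mulrDl. Qed.

Lemma dotrvZl (a : R) x y : dotrv (a *: x) y = a * dotrv x y.
Proof. by rewrite mulr_sumr; apply: eq_bigr => i _; rewrite mxE mulrA. Qed.

Lemma dotrvNl x y : dotrv (- x) y = - dotrv x y.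
Proof. by rewrite -scaleN1r dotrvZl mulN1r. Qed.

Lemma dotrvDr x y s : dotrv s (x + y) = dotrv s x + dotrv s y.
Proof. by rewrite !(dotrvC s) dotrvDl. Qed.

Lemma dotrvZr (a : R) x y : dotrv x (a *: y) = a * dotrv x y.
Proof. by rewrite !(dotrvC x) dotrvZl. Qed.

Lemma dotrvNr x y : dotrv x (- y) = - dotrv x y.
Proof. by rewrite !(dotrvC x) dotrvNl. Qed.

Lemma dotrvv_ge0 x : 0 <= dotrv x x.
Proof. by apply: sumr_ge0 => i _; rewrite -expr2 sqr_ge0. Qed.

Lemma enorm_ge0 x : 0 <= enorm x.
Proof. exact: sqrtr_ge0. Qed.

Lemma sqr_enorm x : enorm x ^+ 2 = dotrv x x.
Proof. by rewrite sqr_sqrtr ?dotrvv_ge0. Qed.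

Lemma enorm_le x (r : R) : 0 <= r -> (enorm x <= r) = (dotrv x x <= r ^+ 2).
Proof. by move=> r0; rewrite -sqr_enorm ler_pXn2r// ?nnegrE ?enorm_ge0. Qed.

Lemma sqr_dotrv_le x y : dotrv x y ^+ 2 <= dotrv x x * dotrv y y.
Proof.
have [y0|y0] := eqVneq (dotrv y y) 0.
  have y00 i : y 0 i = 0.
    apply/eqP; rewrite -sqrf_eq0 expr2 eq_le -{1}y0; apply/andP; split.
      by rewrite /dotrv (bigD1 i)//= lerDl; apply: sumr_ge0 => j _; rewrite -expr2 sqr_ge0.
    by rewrite -expr2 sqr_ge0.
  by rewrite y0 mulr0 /dotrv big1 ?expr0n// => i _; rewrite y00 mulr0.
have yp : 0 < dotrv y y by rewrite lt_def y0 dotrvv_ge0.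
(* Expanding this square gives [dotrv y y] times the defect in the Cauchy-Schwarz inequality. *)
have := dotrvv_ge0 (dotrv y y *: x - dotrv x y *: y).
rewrite !(dotrvDl, dotrvDr, dotrvNl, dotrvNr, dotrvZl, dotrvZr) (dotrvC y x).
set a := dotrv x x; set b := dotrv x y; set c := dotrv y y in yp *.
have -> : c * (c * a - b * b) + (c * - (b * b) - b * - (b * c)) = c * (a * c - b ^+ 2) by ring.
by rewrite pmulr_rge0// subr_ge0.
Qed.

Lemma dotrv_le x y : dotrv x y <= enorm x * enorm y.
Proof.
have [xy0|xy0] := leP (dotrv x y) 0.
  by apply: le_trans xy0 _; rewrite mulr_ge0 ?enorm_ge0.
rewrite -(@ler_pXn2r _ 2)// ?nnegrE ?mulr_ge0 ?enorm_ge0 ?(ltW xy0)//.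
by rewrite exprMn !sqr_enorm; exact: sqr_dotrv_le.
Qed.

Lemma enormN x : enorm (- x) = enorm x.
Proof. by rewrite /enorm dotrvNl dotrvNr opprK. Qed.

Lemma enormZ (a : R) x : enorm (a *: x) = `|a| * enorm x.
Proof. by rewrite /enorm dotrvZl dotrvZr mulrA -expr2 sqrtrM ?sqr_ge0// sqrtr_sqr. Qed.

Lemma ler_enormD x y : enorm (x + y) <= enorm x + enorm y.
Proof.
rewrite enorm_le ?addr_ge0 ?enorm_ge0// dotrvDl !dotrvDr (dotrvC y x) sqrrD !sqr_enorm.
by have := dotrv_le x y; lra.
Qed.

Lemma ler_coord_enorm x i : `|x 0 i| <= enorm x.
Proof.
rewrite -(@ler_pXn2r _ 2)// ?nnegrE ?enorm_ge0// sqr_enorm real_normK ?num_real//.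
by rewrite /dotrv (bigD1 i)//= -expr2 lerDl; apply: sumr_ge0 => j _; rewrite -expr2 sqr_ge0.
Qed.

Lemma ler_norm_enorm x : `|x| <= enorm x.
Proof. by apply: ler_norm_coord => [|i]; [exact: enorm_ge0|exact: ler_coord_enorm]. Qed.

Lemma continuous_sum (V : topologicalType) m (f : 'I_m -> V -> R) : (forall i, continuous (f i)) ->
  continuous (fun z => \sum_i f i z).
Proof.
elim: m f => [|m IH] f cf z.
  rewrite (_ : (fun z => _) = fun=> 0); first exact: cst_continuous.
  by apply/funext => w; rewrite big_ord0.
rewrite (_ : (fun z => _) = fun z => f ord0 z + \sum_i f (lift ord0 i) z); last first.
  by apply/funext => w; rewrite big_ord_recl.
by apply: (@cvgD _ _ _ (nbhs z)); [exact: cf|apply: IH => i; exact: cf].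
Qed.

Lemma continuous_dotrvl s : continuous (fun x => dotrv x s).
Proof.
apply: continuous_sum => i x.
apply: (@cvgM _ _ (nbhs x)); [exact: coord_continuous|exact: cvg_cst].
Qed.

Lemma continuous_dotrvv : continuous (fun x => dotrv x x).
Proof. by apply: continuous_sum => i x; apply: (@cvgM _ _ (nbhs x)); exact: coord_continuous. Qed.

Lemma continuous_enorm : continuous (@enorm R n).
Proof.
move=> x; apply: (@cvg_comp _ _ _ (fun x => dotrv x x) Num.sqrt _ (nbhs (dotrv x x))).
  exact: continuous_dotrvv.
exact: sqrt_continuous.
Qed.

Lemma closed_eball (r : R) : closed [set x : E | enorm x <= r].
Proof.
apply: (@closed_comp _ _ (@enorm R n) [set y | y <= r]); last exact: closed_le.
by move=> x _; exact: continuous_enorm.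
Qed.

Lemma continuous_comp_real (V : topologicalType) (h : R -> R) (f : V -> R) : continuous h -> continuous f ->
  continuous (fun z => h (f z)).
Proof.
move=> ch cf z; apply: (@cvg_comp _ _ _ f h _ (nbhs (f z))); [exact: cf|exact: ch].
Qed.

Lemma continuousM2 (V : topologicalType) (f g : V -> R) : continuous f -> continuous g -> continuous (fun z => f z * g z).
Proof. by move=> cf cg z; apply: (@cvgM _ _ (nbhs z)); [exact: cf|exact: cg]. Qed.

Lemma continuousD2 (V : topologicalType) (f g : V -> R) : continuous f -> continuous g -> continuous (fun z => f z + g z).
Proof. by move=> cf cg z; apply: (@cvgD _ _ _ (nbhs z)); [exact: cf|exact: cg]. Qed.

Lemma bcs_eball (f : E -> R) (r : R) : continuous f -> bcs (fun x => f x * \1_[set x : E | enorm x <= r] x).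
Proof.
move=> cf; apply: (@bcs_indicator _ _ f _ r).
- exact: measurable_continuous_tuple.
- exact: continuous_bounded_on_balls.
- exact: closed_eball.
- by move=> x; apply: le_trans; exact: ler_norm_enorm.
Qed.

Lemma bcs_shift (v : E) (f : E -> R) : bcs f -> bcs (fun x => f (x + v)).
Proof.
move=> [mf [K HK]]; split.
  rewrite (_ : lift_tuple _ = lift_tuple f \o tuple_shift v); last first.
    by apply/funext => t; rewrite /lift_tuple /= tuple_rV_shift.
  exact: measurableT_comp mf (measurable_tuple_shift v).
exists (`|K| + `|v|) => x; split.
  by apply: le_trans (HK _).1 _; apply: le_trans (ler_norm K) _; rewrite lerDl.
move=> Kx; apply: (HK _).2.
have : `|x| <= `|x + v| + `|v| by rewrite -{1}(addrK v x); exact: ler_normB.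
by move: Kx; have := ler_norm K; lra.
Qed.

End EuclideanNorm.

Section ExponentialBall.
Context {R : realType}.
Notation mu := (@lebesgue_measure R).
Notation tm := (tuple_measure (@lebesgue_measure R)).

Lemma integral_Rn_le_prod n (f : 'rV[R]_n -> R) (g : 'I_n -> measurableTypeR R -> R) (a : 'I_n -> R) :
  bcs f -> (forall x, 0 <= f x) -> (forall x, f x <= \prod_(i < n) g i (x 0 i)) ->
  (forall i, measurable_fun setT (g i)) -> (forall i x, 0 <= g i x) ->
  (forall i, \int[mu]_x (g i x)%:E = (a i)%:E)%E ->
  integral_Rn setT f <= \prod_(i < n) a i.
Proof.
move=> bf f0 fg mg g0 ga; rewrite -lee_fin -(ge0_integral_tuple_prod mg g0 ga).
have : (\int[tm n]_t (lift_tuple f t)%:E)%E \is a fin_num.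
  by apply: integrable_fin_num => //; exact: bcs_integrable bf.
move=> /fineK; rewrite integral_RnE /Rintegral => ->.
apply: ge0_le_integral => //.
- by move=> t _; rewrite lee_fin; exact: f0.
- by apply/measurable_EFinP; exact: bf.1.
- apply/measurable_EFinP; apply: measurable_prod => i _.
  by apply: (measurableT_comp (mg i)); exact: measurable_tnth.
- move=> t _; rewrite lee_fin /lift_tuple; apply: le_trans (fg _) _.
  by under eq_bigr do rewrite mxE.
Qed.

Lemma integral_eball_le n (r : R) : 0 <= r ->
  integral_Rn setT (fun x : 'rV[R]_n => 1 * \1_[set x | enorm x <= r] x) <= (r + r) ^+ n.
Proof.
move=> r0; have -> : (r + r) ^+ n = \prod_(i < n) (r + r) by rewrite prodr_const card_ord.
apply: (@integral_Rn_le_prod _ _ (fun _ => \1_(`[(- r)%R, r]%classic : set R))).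
- by apply: bcs_eball => x; exact: cst_continuous.
- by move=> x; rewrite mul1r indicE.
- move=> x; rewrite mul1r indicE; have [|_] := boolP (x \in _); last first.
    by apply: prodr_ge0 => i _; rewrite indicE.
  rewrite inE/= => xr; rewrite big1// => i _; rewrite indicE mem_set//= in_itv/= -ler_norml.
  exact: le_trans (ler_coord_enorm _ _) xr.
- by move=> i; apply: measurable_indic; exact: measurable_itv.
- by move=> i y; rewrite indicE.
- move=> i; rewrite integral_indic//= setIT lebesgue_measure_itv/= lte_fin.
  case: ifPn => [_|]; first by rewrite -EFinB opprK.
  by rewrite -leNgt => rr; congr EFin; lra.
Qed.

Lemma integral_gauss (m r : R) : 0 < r ->
  (\int[mu]_x (expR (- (x - m) ^+ 2 / (8 * r)))%:E = (Num.sqrt (8 * pi * r))%:E)%E.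
Proof.
(* The standard deviation for which [2 s^2 = 8 r]. *)
move=> r0; pose s := 2 * Num.sqrt r.
have s0 : s != 0 by rewrite gt_eqF// mulr_gt0// sqrtr_gt0.
have s2 : s ^+ 2 = 4 * r by rewrite exprMn sqr_sqrtr ?ltW//; ring.
have p0 : 0 < 8 * pi * r by rewrite mulr_gt0// mulr_gt0// pi_gt0.
have pk : normal_peak s = (Num.sqrt (8 * pi * r))^-1.
  by rewrite /normal_peak s2; congr (Num.sqrt _)^-1; ring.
under eq_integral => x _.
  rewrite (_ : expR _ = Num.sqrt (8 * pi * r) * normal_pdf m s x); last first.
    have -> : normal_pdf m s x = normal_peak s * normal_fun m s x by rewrite normal_pdfE.
    rewrite pk mulrA divff ?mul1r ?gt_eqF ?sqrtr_gt0//.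
    by rewrite /normal_fun s2; congr (expR (_ / _)); ring.
  rewrite EFinM.
  over.
rewrite integralZl//; last exact: integrable_normal_pdf.
by rewrite integral_normal_pdf mule1.
Qed.

(** A geometric series of ratio [exp (- 1 / 2)] whose first nonzero term is at most 1, hence a bound
    uniform in [a] and [N]. *)
Lemma sum_expR_shift_le (N : nat) (a : R) :
  \sum_(j < N) (if 0 <= a + j%:R then expR (- (a + j%:R) / 2) else 0)
    <= (1 - expR (- (1 / 2)))^-1.
Proof.
set q := expR (- (1 / 2)).
have q1 : 0 < 1 - q by rewrite subr_gt0 /q expR_lt1 oppr_lt0.
set K := (1 - q)^-1.
have K0 : 0 < K by rewrite invr_gt0.
have KE : 1 + K * q = K by rewrite /K; field; rewrite gt_eqF.
(* The induction on [N] shifts [a] by 1, so it needs the decay in [a]. *)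
suff H : \sum_(j < N) (if 0 <= a + j%:R then expR (- (a + j%:R) / 2) else 0)
    <= K * (if 0 <= a then expR (- a / 2) else 1).
  apply: le_trans H _; case: ifPn => [a0|_]; last by rewrite mulr1.
  by rewrite ler_piMr ?(ltW K0)// expR_le1; lra.
elim: N a => [|N IH] a.
  by rewrite big_ord0 mulr_ge0 ?(ltW K0)//; case: ifP => // _; exact: expR_ge0.
rewrite big_ord_recl /= addr0.
have -> : \sum_(i < N) (if 0 <= a + (bump 0 i)%:R then expR (- (a + (bump 0 i)%:R) / 2) else 0)
  = \sum_(i < N) (if 0 <= (a + 1) + i%:R then expR (- ((a + 1) + i%:R) / 2) else 0).
  by apply: eq_bigr => i _; rewrite /bump/= add1n -natr1 [i%:R + 1]addrC addrA.
have {}IH := IH (a + 1).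
case: ifPn => [a0|a0].
  rewrite ifT in IH; last lra.
  apply: le_trans (lerD (lexx _) IH) _.
  rewrite (_ : - (a + 1) / 2 = - a / 2 + (- (1 / 2))); last by field.
  rewrite expRD -/q.
  by rewrite [leRHS](_ : _ = (1 + K * q) * expR (- a / 2)); [lra|rewrite KE].
rewrite add0r mulr1; apply: le_trans IH _; case: ifPn => [a1|_]; last by rewrite mulr1.
by rewrite ler_piMr ?(ltW K0)// expR_le1; lra.
Qed.

(* On the ball, exp (x . s) concentrates in a cap of height O(1) and width O(sqrt r)
   around r s.  Averaging over the translates by j s for j <= sqrt r saves a factor
   sqrt r with respect to the Gaussian bound of width sqrt r in all directions. *)
Lemma exp_eball_pointwise n (s x : 'rV[R]_n) (r : R) (j : nat) : 0 < r ->
  dotrv s s = 1 -> j%:R ^+ 2 <= r ->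
  expR (dotrv (x - j%:R *: s) s) * \1_[set x | enorm x <= r] (x - j%:R *: s) <=
  expR r * expR (1 / 4) * (\prod_(i < n) expR (- (x 0 i - r * s 0 i) ^+ 2 / (8 * r))) *
   (if 0 <= r - dotrv x s + j%:R then expR (- (r - dotrv x s + j%:R) / 2) else 0).
Proof.
move=> r0 s1 jr; set y := x - j%:R *: s.
have ys : dotrv y s = dotrv x s - j%:R.
  by rewrite /y dotrvDl dotrvNl dotrvZl s1 mulr1.
have prodE : \prod_(i < n) expR (- (x 0 i - r * s 0 i) ^+ 2 / (8 * r))
    = expR (- dotrv (x - r *: s) (x - r *: s) / (8 * r)).
  rewrite -expR_sum; congr expR; rewrite /dotrv -sumrN mulr_suml; apply: eq_bigr => i _.
  by rewrite !mxE expr2.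
rewrite prodE indicE; have [|_] := boolP (y \in _); last first.
  rewrite mulr0 !mulr_ge0 ?expR_ge0//; case: ifP => // _; exact: expR_ge0.
rewrite inE/= => yr; rewrite mulr1.
have es : enorm s = 1 by rewrite /enorm s1 sqrtr1.
have yle : dotrv y s <= r by apply: le_trans (dotrv_le _ _) _; rewrite es mulr1.
rewrite ifT; last by move: yle; rewrite ys; lra.
rewrite -!expRD ler_expR.
have yy : dotrv y y <= r ^+ 2 by rewrite -enorm_le ?(ltW r0).
have yE : dotrv y y = dotrv x x - 2 * j%:R * dotrv x s + j%:R ^+ 2.
  rewrite /y !(dotrvDl, dotrvDr, dotrvNl, dotrvNr, dotrvZl, dotrvZr) (dotrvC s x) s1; ring.
have zE : dotrv (x - r *: s) (x - r *: s) = dotrv x x - 2 * r * dotrv x s + r ^+ 2.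
  rewrite !(dotrvDl, dotrvDr, dotrvNl, dotrvNr, dotrvZl, dotrvZr) (dotrvC s x) s1; ring.
rewrite ys zE.
have xs2 : dotrv x s ^+ 2 <= dotrv x x by have := sqr_dotrv_le x s; rewrite s1 mulr1.
move: yy yle; rewrite yE ys; move: xs2.
set X := dotrv x x; set S := dotrv x s => xs2 yy yle.
have -> : r + 1 / 4 + - (X - 2 * r * S + r ^+ 2) / (8 * r) + - (r - S + j%:R) / 2 =
   (S - j%:R) + (4 * r * (r - S + j%:R) + 2 * r - (X - 2 * r * S + r ^+ 2)) / (8 * r).
  by field; rewrite gt_eqF.
rewrite lerDl divr_ge0 ?mulr_ge0 ?(ltW r0)//.
(* Since [|y| <= r], the numerator is at least [2 (r + j) (r - S + j) + 2 r - j^2], which is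
   nonnegative because [S - j <= r] and [j^2 <= r]. *)
have := sqr_ge0 (S - r - 2 * j%:R); nra.
Qed.

(** This is growth of order [r^((n - 1) / 2) e^r], the factor [sqrt r] on the left avoiding a
    subtraction in the exponent. The averaged pointwise bound is integrated: the sum over [j] is a
    bounded geometric series and the Gaussian product contributes [sqrt (8 pi r)^n]. *)
Lemma integral_exp_eball_le n : exists2 C : R, 0 < C & forall (s : 'rV[R]_n) (r : R),
  0 < r -> dotrv s s = 1 ->
  Num.sqrt r * integral_Rn setT (fun x => expR (dotrv x s) * \1_[set x | enorm x <= r] x)
   <= C * expR r * Num.sqrt r ^+ n.
Proof.
pose K : R := (1 - expR (- (1 / 2)))^-1.
have K0 : 0 < K by rewrite invr_gt0 subr_gt0 expR_lt1 oppr_lt0.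
exists (K * expR (1 / 4) * Num.sqrt (8 * pi) ^+ n).
  by rewrite !mulr_gt0 ?expR_gt0// exprn_gt0// sqrtr_gt0 mulr_gt0// pi_gt0.
move=> s r r0 s1.
set g := fun x => _.
have bg : bcs g.
  by apply: bcs_eball; apply: (continuous_comp_real (@continuous_expR R)); exact: continuous_dotrvl.
have g0 x : 0 <= g x by rewrite mulr_ge0 ?expR_ge0// indicE.
(* Indices [j < N] satisfy [j <= sqrt r], while there are at least [sqrt r] of them; all translates
   have the same integral. *)
pose N := (Num.truncn (Num.sqrt r)).+1.
have sr0 : 0 <= Num.sqrt r := sqrtr_ge0 r.
have rN : Num.sqrt r <= N%:R by rewrite ltW// truncnS_gt.
have jr (j : 'I_N) : j%:R ^+ 2 <= r.
  rewrite -[leRHS](sqr_sqrtr (ltW r0)) ler_pXn2r ?nnegrE//.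
  apply: (@le_trans _ _ (Num.truncn (Num.sqrt r))%:R); last by rewrite truncn_le.
  by rewrite ler_nat -ltnS.
have Ig0 : 0 <= integral_Rn setT g by exact: integral_Rn_ge0.
apply: (@le_trans _ _ (N%:R * integral_Rn setT g)); first exact: ler_wpM2r.
pose h (j : 'I_N) x := g (x + - (j%:R *: s)).
have bh j : bcs (h j) by exact: bcs_shift.
have [bH IH] := integral_Rn_sum bh.
have -> : N%:R * integral_Rn setT g = integral_Rn setT (fun x => \sum_j h j x).
  rewrite IH (eq_bigr (fun _ => integral_Rn setT g)); last by move=> j _; exact: integral_Rn_shift.
  by rewrite sumr_const card_ord mulr_natl.
have er0 : 0 < K * expR (1 / 4) * expR r by rewrite !mulr_gt0 ?expR_gt0.
suff H : (K * expR (1 / 4) * expR r)^-1 * integral_Rn setT (fun x => \sum_j h j x)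
    <= \prod_(i < n) Num.sqrt (8 * pi * r).
  rewrite ler_pdivrMl// in H; apply: le_trans H _.
  rewrite prodr_const card_ord sqrtrM ?exprMn; last by rewrite mulr_ge0// pi_ge0.
  by rewrite le_eqVlt; apply/orP; left; apply/eqP; ring.
rewrite -integral_RnZ//.
apply: (@integral_Rn_le_prod n _ (fun i x => expR (- (x - r * s 0 i) ^+ 2 / (8 * r)))).
- exact: bcsZ.
- by move=> x; rewrite mulr_ge0 ?invr_ge0 ?(ltW er0)//; apply: sumr_ge0 => j _; exact: g0.
- move=> x; rewrite ler_pdivrMl//.
  set P := \prod_(i < n) _.
  have P0 : 0 <= P by apply: prodr_ge0 => i _; exact: expR_ge0.
  apply: (@le_trans _ _ (\sum_(j < N) expR r * expR (1 / 4) * P *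
    (if 0 <= r - dotrv x s + j%:R then expR (- (r - dotrv x s + j%:R) / 2) else 0))).
    by apply: ler_sum => j _; exact: exp_eball_pointwise.
  rewrite -mulr_sumr.
  have := @sum_expR_shift_le N (r - dotrv x s); rewrite -/K => HK.
  have cP : 0 <= expR r * expR (1 / 4) * P by rewrite !mulr_ge0 ?expR_ge0.
  by apply: le_trans (ler_wpM2l cP HK) _; rewrite le_eqVlt; apply/orP; left; apply/eqP; ring.
- move=> i; apply: (@measurableT_comp _ _ _ _ _ _ (@expR R)) => //.
  apply: measurable_funM => //; apply: measurableT_comp => //.
  by apply: measurable_funX; apply: measurable_funB.
- by move=> i x; exact: expR_ge0.
- by move=> i; exact: integral_gauss.
Qed.

End ExponentialBall.

(** * Damped Riccati inequalities *)

Section DeriveRules.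
Context {R : realType} {V : normedModType R}.
Implicit Types (f g : V -> R) (x v : V).

Lemma is_derive_along (f : V -> R) (x v : V) (l : R) :
  is_derive x v f l <-> is_derive (0 : R) 1 (fun s : R => f (x + s *: v)) l.
Proof.
have e : (fun s : R => s^-1 *: (f (x + (s *: (1 : R^o) + 0 : R) *: v) - f (x + (0 : R) *: v))) =
    (fun s : R => s^-1 *: (f (s *: v + x) - f x)).
  apply/funext => s; congr (_ *: (f _ - f _)); last by rewrite scale0r addr0.
  by rewrite [s *: 1]mulr1 addr0 addrC.
split=> -[df dl]; split.
- by rewrite /derivable e.
- by rewrite /derive e.
- by move: df; rewrite /derivable e.
- by move: dl; rewrite /derive e.
Qed.

Lemma is_derive_compR (h : R -> R) f x v (a b : R) :
  is_derive (f x) 1 h a -> is_derive x v f b -> is_derive x v (fun y => h (f y)) (a * b).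
Proof.
move=> dh /is_derive_along df; apply/is_derive_along.
apply: (is_derive1_comp (f := h) (g := fun s : R => f (x + s *: v))) => //.
by rewrite scale0r addr0.
Qed.

Lemma is_derive_mul f g x v (a b : R) : is_derive x v f a -> is_derive x v g b ->
  is_derive x v (fun y => f y * g y) (a * g x + f x * b).
Proof.
move=> df dg; apply: (is_derive_eq (is_deriveM df dg)).
by rewrite addrC [a * _]mulrC.
Qed.

Lemma is_derive_add f g x v (a b : R) : is_derive x v f a -> is_derive x v g b ->
  is_derive x v (fun y => f y + g y) (a + b).
Proof. by move=> df dg; exact: is_deriveD. Qed.

Lemma is_derive_sub f g x v (a b : R) : is_derive x v f a -> is_derive x v g b ->
  is_derive x v (fun y => f y - g y) (a - b).
Proof. by move=> df dg; exact: is_deriveB. Qed.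

Lemma is_derive_scale (k : R) f x v (a : R) : is_derive x v f a ->
  is_derive x v (fun y => k * f y) (k * a).
Proof. by move=> df; exact: is_deriveZ. Qed.

Lemma is_derive_exp f x v (a : R) : is_derive x v f a ->
  is_derive x v (fun y => expR (f y)) (expR (f x) * a).
Proof. by move=> df; apply: (is_derive_compR (h := expR)). Qed.

Lemma is_derive_sqr f x v (a : R) : is_derive x v f a ->
  is_derive x v (fun y => f y ^+ 2) (2 * f x * a).
Proof.
move=> df; rewrite (_ : (fun y => _) = fun y => f y * f y); last by apply/funext => y; rewrite expr2.
by apply: (is_derive_eq (is_derive_mul df df)); ring.
Qed.

Lemma is_derive_inv f x v (a : R) : f x != 0 -> is_derive x v f a ->
  is_derive x v (fun y => (f y)^-1) (- a / f x ^+ 2).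
Proof.
move=> f0 df; have H : is_derive (f x) 1 (fun y : R => y^-1) (- (f x) ^- 2).
  by apply: (is_derive_eq (is_deriveV f0 (is_derive_id _ _))); rewrite /GRing.scale/= mulr1.
by apply: (is_derive_eq (is_derive_compR H df)); rewrite mulrC mulrN mulNr.
Qed.

Lemma is_derive_ln f x v (a : R) : 0 < f x -> is_derive x v f a ->
  is_derive x v (fun y => ln (f y)) (a / f x).
Proof.
move=> f0 df; rewrite mulrC.
exact: (is_derive_compR (h := @ln R) (is_derive1_ln f0) df).
Qed.

Lemma is_derive_sumR m (f : 'I_m -> V -> R) x v (a : 'I_m -> R) :
  (forall i, is_derive x v (f i) (a i)) ->
  is_derive x v (fun y => \sum_i f i y) (\sum_i a i).
Proof.
move=> df; rewrite (_ : (fun y => _) = \sum_i f i); last by apply/funext => y; rewrite fct_sumE.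
exact: is_derive_sum.
Qed.

End DeriveRules.

(* lra reifies every hypothesis, including the bodies of local definitions. *)
Ltac small_lra := repeat match goal with
  | H : forall _, _ |- _ => clear H
  | H := _ |- _ => clearbody H
  end; lra.

Section RealMonotone.
Context {R : realType}.
Implicit Types (f g : R -> R).

Lemma is_derive_continuous f (t a : R) : is_derive t 1 f a -> {for t, continuous f}.
Proof. by move=> [df _]; exact/differentiable_continuous/derivable1_diffP. Qed.

Lemma derive_ge0_le f (df : R -> R) (a b : R) : a <= b ->
  (forall t, a <= t <= b -> {for t, continuous f}) ->
  (forall t, a < t < b -> is_derive t 1 f (df t)) ->
  (forall t, a < t < b -> 0 <= df t) -> f a <= f b.
Proof.
move=> ab cf dff df0.
have [->//|nab] := eqVneq a b.
have ltab : a < b by rewrite lt_neqAle nab.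
have cw : {within `[a, b], continuous f}.
  apply: continuous_in_subspaceT => t; rewrite inE/= in_itv/= => tab; exact: cf.
have dff' c : c \in `]a, b[ -> is_derive c 1 f (df c) by rewrite in_itv/=; exact: dff.
have [c cab e] := MVT ltab dff' cw.
rewrite -subr_ge0 e mulr_ge0 ?subr_ge0//; apply: df0.
by move: cab; rewrite in_itv.
Qed.

Lemma continuous_primitive f : continuous f -> exists F : R -> R,
  F 0 = 0 /\ forall t : R, 0 <= t -> is_derive t 1 F (f t).
Proof.
(* Starting the integral at [-1] makes [0] an interior point, so that the derivative at [0] is
   two-sided. *)
move=> cf; pose G x : R := \int[@lebesgue_measure R]_(t in [set` `[-1, x]]) f t.
have dG (t : R) : 0 <= t -> is_derive t 1 G (f t).
  move=> t0; have tt : t < t + 1 by rewrite ltrDl.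
  have mt : -1 < t by lra.
  have It : (@lebesgue_measure R).-integrable `[-1, t + 1] (EFin \o f).
    apply: continuous_compact_integrable; first exact: segment_compact.
    by apply: continuous_subspaceT => x; exact: cf.
  have [dG eG] := continuous_FTC1_closed tt It mt (cf t).
  by split; [exact: dG|rewrite -derive1E; exact: eG].
exists (fun x => G x - G 0); split; first by rewrite subrr.
move=> t t0; have dGt := dG t t0.
by apply: (is_derive_eq (is_derive_sub dGt (is_derive_cst (G 0) t 1))); rewrite subr0.
Qed.

(** Continuous induction: at the infimum of the times where [f <= 0] the step gives [f > 0], and
    continuity extends positivity past it, a contradiction. *)
Lemma positive_of_step f (T : R) : 0 <= T -> (forall t, 0 <= t <= T -> {for t, continuous f}) ->
  0 < f 0 ->
  (forall t, 0 <= t <= T -> (forall s, 0 <= s < t -> 0 < f s) -> 0 < f t) ->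
  forall t, 0 <= t <= T -> 0 < f t.
Proof.
move=> T0 cf f0 step t tT; rewrite ltNge; apply/negP => ft.
pose S : set R := [set t | 0 <= t <= T /\ f t <= 0].
have hS : has_inf S by split; [exists t|exists 0 => s [/andP[]]].
pose u := inf S.
have ut : u <= t by apply: ge_inf; [exact: hS.2|].
have u0 : 0 <= u by apply: lb_le_inf; [exact: hS.1|move=> s [/andP[]]].
have uT : 0 <= u <= T by rewrite u0 (le_trans ut)//; case/andP: tT.
have fu : 0 < f u.
  apply: step => // s /andP[s0 su]; rewrite ltNge; apply/negP => fs.
  have : u <= s.
    apply: ge_inf; [exact: hS.2|split => //].
    by rewrite s0 ltW// (lt_le_trans su)//; case/andP: uT.
  by rewrite leNgt su.
have /(cf _ uT)/nbhs_ballP[e /= e0 He] : nbhs (f u) `]0, +oo[%classic.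
  by apply: open_nbhs_nbhs; split; [exact: interval_open|rewrite /= in_itv/= andbT].
have [s [sT fs] su] := inf_adherent e0 hS.
have us : u <= s by apply: ge_inf; [exact: hS.2|].
have : ball u e s by rewrite /ball/= ltr_distl; move: su; rewrite -/u => su; apply/andP; split; lra.
by move=> /He; rewrite /= in_itv/= andbT ltNge fs.
Qed.

Lemma is_derive_1D (t : R) : is_derive t 1 (fun s : R => 1 + s) (1 : R).
Proof.
by apply: (is_derive_eq (is_derive_add (is_derive_cst (1 : R) t 1) (is_derive_id t 1))); rewrite add0r.
Qed.

(* Lyapunov function: H = - 1 / F + (1 / A) ln (F / U) with U = C (1 + t)^n.  Then
   H <= 0 and H' >= (d - n / (1 + t)) / A, and n / (1 + t) <= d / 2 after t = 2 n / d. *)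
Lemma riccati_bound (n : nat) (d C f0 T : R) (A dA S F dF : R -> R) :
  0 < d -> 0 < C -> 0 < f0 -> n%:R * 2 / d <= T ->
  (forall t : R, 0 <= t -> is_derive t 1 A (dA t)) -> (forall t : R, 0 <= t -> 0 <= dA t) ->
  (forall t : R, 0 <= t -> 1 <= A t) ->
  (forall t : R, 0 <= t -> is_derive t 1 S (A t)^-1) ->
  (forall t : R, 0 <= t <= T -> {for t, continuous F}) ->
  (forall t : R, 0 < t < T -> is_derive t 1 F (dF t)) ->
  (forall t : R, 0 < t < T -> d * F t ^+ 2 / (A t + F t) <= dF t) ->
  (forall t : R, 0 <= t <= T -> f0 <= F t) ->
  (forall t : R, 0 <= t <= T -> F t <= C * (1 + t) ^+ n) ->
  d / 2 * (S T - S (n%:R * 2 / d)) <= (1 + C * (1 + n%:R * 2 / d) ^+ n) / f0.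
Proof.
move=> d0 C0 f00 t0T dA_ dA0 A1 dS cF dF_ Fge Fl Fu.
set t0 := n%:R * 2 / d in t0T *.
have t00 : 0 <= t0 by rewrite /t0 divr_ge0 ?mulr_ge0 ?(ltW d0).
have T0 : 0 <= T by exact: le_trans t0T.
pose L (t : R) := ln (F t) - (ln C + n%:R * ln (1 + t)).
pose H (t : R) := - (F t)^-1 + (A t)^-1 * L t - d / 2 * S t.
pose dH (t : R) := dF t / F t ^+ 2 + (- dA t / A t ^+ 2 * L t + (A t)^-1 * (dF t / F t - n%:R / (1 + t)))
   - d / 2 * (A t)^-1.
have Fp t : 0 <= t <= T -> 0 < F t by move=> h; exact: lt_le_trans f00 (Fl _ h).
have Ap t : 0 <= t -> 0 < A t by move=> h; exact: lt_le_trans ltr01 (A1 _ h).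
have Lle t : 0 <= t <= T -> L t <= 0.
  move=> h; have t1 : 0 < 1 + t by case/andP: h => h _; lra.
  rewrite /L subr_le0 mulr_natl -lnXn// -lnM ?posrE ?exprn_gt0//.
  by rewrite ler_ln ?posrE ?Fp ?mulr_gt0 ?exprn_gt0 ?Fu.
have daff (t : R) := is_derive_1D t.
have dlog (t : R) : 0 <= t -> is_derive t 1 (fun s : R => ln C + n%:R * ln (1 + s)) (n%:R / (1 + t)).
  move=> h; have t1 : 0 < 1 + t by lra.
  apply: (is_derive_eq (is_derive_add (is_derive_cst (ln C) t 1) (is_derive_scale n%:R (is_derive_ln t1 (daff t))))).
  by rewrite add0r mul1r.
have dH_ (t : R) : t0 < t < T -> is_derive t 1 H (dH t).
  move=> /andP[t0t tT]; have t_ge0 : 0 <= t by lra.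
  have h : 0 <= t <= T by rewrite t_ge0 ltW.
  have dFt : is_derive t 1 F (dF t) by apply: dF_; rewrite tT andbT; lra.
  have dVF := is_derive_inv (lt0r_neq0 (Fp _ h)) dFt.
  have dVA := is_derive_inv (lt0r_neq0 (Ap _ t_ge0)) (dA_ _ t_ge0).
  have dL := is_derive_sub (is_derive_ln (Fp _ h) dFt) (dlog _ t_ge0).
  have d1 := is_derive_add (is_deriveN dVF) (is_derive_mul dVA dL).
  have d2 := is_derive_sub d1 (is_derive_scale (d / 2) (dS _ t_ge0)).
  by apply: (is_derive_eq d2); rewrite /dH /L mulNr opprK.
have cH (t : R) : t0 <= t <= T -> {for t, continuous H}.
  move=> /andP[t0t tT]; have t_ge0 : 0 <= t by lra.
  have h : 0 <= t <= T by rewrite t_ge0.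
  have cFt := cF _ h.
  have cA := is_derive_continuous (dA_ _ t_ge0).
  have cS := is_derive_continuous (dS _ t_ge0).
  have clog := is_derive_continuous (dlog _ t_ge0).
  apply: cvgB; last by apply: cvgM; [exact: cvg_cst|exact: cS].
  apply: cvgD.
    by apply: cvgN; apply: cvgV; [rewrite gt_eqF ?Fp|exact: cFt].
  apply: cvgM; first by apply: cvgV; [rewrite gt_eqF ?Ap|exact: cA].
  apply: cvgB; last exact: clog.
  exact: (cvg_comp F (@ln R) cFt (continuous_ln (Fp _ h))).
have dHge t : t0 < t < T -> 0 <= dH t.
  move=> /andP[t0t tT]; have t_ge0 : 0 <= t by lra.
  have h : 0 <= t <= T by rewrite t_ge0 ltW.
  have FP := Fp _ h; have AP := Ap _ t_ge0.
  have dFge : d * F t ^+ 2 / (A t + F t) <= dF t by apply: Fge; rewrite tT andbT; lra.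
  have q1 : 0 <= - dA t / A t ^+ 2 * L t.
    by rewrite mulNr mulNr -mulrN mulr_ge0// ?oppr_ge0 ?Lle// divr_ge0 ?exprn_ge0 ?dA0 ?(ltW AP).
  have AF0 : 0 < A t + F t by rewrite addr_gt0.
  (* Here [1 / F^2 + 1 / (A F) = (A + F) / (A F^2)] cancels the right-hand side of the Riccati
     inequality exactly; this dictates the two terms of [H]. *)
  have q2 : d * (A t)^-1 <= dF t / F t ^+ 2 + (A t)^-1 * (dF t / F t).
    have -> : dF t / F t ^+ 2 + (A t)^-1 * (dF t / F t) = dF t * ((A t + F t) / (A t * F t ^+ 2)).
      by field; rewrite !gt_eqF.
    apply: le_trans (ler_wpM2r _ dFge); last by rewrite divr_ge0 ?mulr_ge0 ?exprn_ge0 ?(ltW AP) ?(ltW FP) ?(ltW AF0).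
    by rewrite le_eqVlt; apply/orP; left; apply/eqP; field; rewrite !gt_eqF.
  have q3 : n%:R / (1 + t) <= d / 2.
    rewrite ler_pdivrMr; last lra.
    have : n%:R * 2 = d * t0 by rewrite /t0; field; rewrite gt_eqF.
    have : d * t0 <= d * t by rewrite ler_pM2l// ltW.
    by nra.
  have q4 : (A t)^-1 * (n%:R / (1 + t)) <= (A t)^-1 * (d / 2) by rewrite ler_wpM2l// invr_ge0 ltW.
  have q5 : d * (A t)^-1 = (A t)^-1 * (d / 2) + (A t)^-1 * (d / 2) by field; rewrite gt_eqF.
  have -> : dH t = (dF t / F t ^+ 2 + (A t)^-1 * (dF t / F t)) + (- dA t / A t ^+ 2 * L t)
     - (A t)^-1 * (n%:R / (1 + t)) - (A t)^-1 * (d / 2) by rewrite /dH; ring.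
  have aux (x1 x2 x3 x4 : R) : 0 <= x3 -> x4 + x4 <= x1 -> x2 <= x4 -> 0 <= x1 + x3 - x2 - x4.
    by clear; lra.
  by apply: aux => //; rewrite -q5.
have Hle := derive_ge0_le t0T cH dH_ dHge.
have TT : 0 <= T <= T by rewrite T0 lexx.
have tt : 0 <= t0 <= T by rewrite t00.
have HT : H T <= - (d / 2 * S T).
  rewrite /H -[leRHS]add0r lerD2r.
  have : (A T)^-1 * L T <= 0 by rewrite mulr_ge0_le0 ?invr_ge0 ?(ltW (Ap _ T0)) ?Lle.
  have : 0 <= (F T)^-1 by rewrite invr_ge0 ltW ?Fp.
  by lra.
have Ht0 : - ((1 + C * (1 + t0) ^+ n) / f0) - d / 2 * S t0 <= H t0.
  rewrite /H lerD2r.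
  have f1 : (F t0)^-1 <= f0^-1 by rewrite lef_pV2 ?posrE ?Fp ?Fl.
  set U := C * (1 + t0) ^+ n.
  have U0 : 0 < U by rewrite mulr_gt0// exprn_gt0//; lra.
  have LE : L t0 = - ln (U / F t0).
    rewrite ln_div ?posrE ?Fp// opprB /L /U lnM ?posrE ?exprn_gt0//; last lra.
    by rewrite lnXn ?mulr_natl//; lra.
  (* The bound [ln y <= y] turns the initial value of [H] into a constant divided by [f0]. *)
  have l1 : ln (U / F t0) <= U / f0.
    have p0 : 0 < U / F t0 by rewrite divr_gt0 ?Fp.
    have : ln (1 + (U / F t0 - 1)) <= U / F t0 - 1 by apply: le_ln1Dx; lra.
    rewrite addrCA subrr addr0.
    have : U / F t0 <= U / f0 by rewrite ler_pM2l.
    by lra.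
  have l0 : 0 <= ln (U / F t0) by have := Lle _ tt; rewrite LE; lra.
  have a1 : (A t0)^-1 <= 1 by rewrite invf_le1 ?A1 ?Ap.
  have l2 : (A t0)^-1 * ln (U / F t0) <= ln (U / F t0) by rewrite ler_piMl.
  by rewrite LE mulrN mulrDl mul1r; lra.
by rewrite mulrBr; lra.
Qed.

Lemma is_derive_expM (a t : R) : is_derive t 1 (fun s : R => expR (a * s)) (a * expR (a * t)).
Proof.
have := is_derive_exp (is_derive_scale a (is_derive_id t 1)).
by rewrite mulr1 mulrC.
Qed.

Lemma sqr_div_shift_le (z y p q : R) : 0 < z -> 0 <= y -> y <= z -> 0 < p -> p <= q ->
  y ^+ 2 / (y + q) <= z ^+ 2 / (z + p).
Proof.
move=> z0 y0 yz p0 pq; have q0 : 0 < q by exact: lt_le_trans pq.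
rewrite ler_pdivrMr ?ltr_wpDl// mulrAC ler_pdivlMr ?addr_gt0//.
have s1 : y * y * p <= z * z * q by rewrite !ler_pM// ?mulr_ge0 ?(ltW p0).
have s2 : y * z * y <= y * z * z by rewrite ler_wpM2l ?mulr_ge0 ?(ltW z0).
by rewrite !expr2; lra.
Qed.

(** From [f <= 5 c y] one gets [f^2 y <= 5 c y^2 f] and [f^2 L a <= 25 c^2 L y^2 a]; the denominator
    [5 c + 25 c^2 L] dominates both coefficients. *)
Lemma riccati_rescale (c L k f y a : R) : 0 < c -> 0 < L -> 0 < k -> 0 < f -> 0 < y -> 0 < a ->
  f <= 5 * c * y ->
  k / (5 * c + 25 * c ^+ 2 * L) * (f ^+ 2 / (a + f)) <= k * y ^+ 2 / (y + L * a).
Proof.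
move=> c0 L0 k0 f0 y0 a0 fy.
have D0 : 0 < 5 * c + 25 * c ^+ 2 * L by rewrite addr_gt0 ?mulr_gt0 ?exprn_gt0.
have af : 0 < a + f by rewrite addr_gt0.
have yl : 0 < y + L * a by rewrite addr_gt0 ?mulr_gt0.
have -> : k / (5 * c + 25 * c ^+ 2 * L) * (f ^+ 2 / (a + f)) =
  k * f ^+ 2 / ((5 * c + 25 * c ^+ 2 * L) * (a + f)) by field; rewrite !gt_eqF.
rewrite ler_pdivrMr ?mulr_gt0// mulrAC ler_pdivlMr// -!mulrA ler_pM2l//.
have s1 : f * f <= 25 * c ^+ 2 * (y * y).
  by have := ler_pM (ltW f0) (ltW f0) fy fy; rewrite expr2; lra.
have s2 : f * f * y <= 5 * c * (y * y) * f.
  have : f * (f * y) <= f * (5 * c * y * y) by rewrite ler_pM2l// ler_pM2r.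
  by lra.
have s3 : f * f * (L * a) <= 25 * c ^+ 2 * (y * y) * (L * a) by rewrite ler_wpM2r// mulr_ge0 ?ltW.
have s4 : 0 <= 5 * c * (y * y) * a by rewrite !mulr_ge0 ?ltW.
have s5 : 0 <= 25 * c ^+ 2 * L * (y * y) * f by rewrite !mulr_ge0 ?exprn_ge0 ?ltW.
by rewrite !expr2 in s3 s5 *; lra.
Qed.

(** While [X > 0], the derivative of [m Y] is [m (Y' + b Y) >= m (c^2 X + N) >= 0]. So [Y] stays
    positive and [X] increases, which closes the continuous induction. *)
Lemma positive_moment (c T : R) (b m X Y dY N : R -> R) :
  0 <= T ->
  (forall t : R, 0 <= t -> is_derive t 1 m (b t * m t)) ->
  (forall t : R, 0 <= t -> 0 < m t) -> continuous X -> continuous Y ->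
  (forall t : R, 0 < t < T -> is_derive t 1 X (Y t)) ->
  (forall t : R, 0 < t < T -> is_derive t 1 Y (dY t)) ->
  (forall t : R, 0 < t < T -> c ^+ 2 * X t + N t - b t * Y t <= dY t) ->
  (forall t : R, 0 < t < T -> 0 < X t -> 0 <= N t) ->
  0 < X 0 -> 0 < Y 0 -> forall t : R, 0 <= t <= T -> 0 < X t.
Proof.
move=> T0 dm mp cX cY dX dY_ dYge Nge0 X0 Y0 t.
apply: (@positive_of_step X T) => //.
  by move=> s _; exact: cX.
move=> s /andP[s0 sT] below.
have YP (r : R) : 0 < r < s -> 0 < Y r.
  move=> /andP[r0 rs].
  have rT : r < T by small_lra.
  have := @derive_ge0_le (fun t => m t * Y t) (fun t => b t * m t * Y t + m t * dY t) 0 r (ltW r0).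
  move=> H; have {}H : m 0 * Y 0 <= m r * Y r.
    apply: H => q /andP[ht tr].
    - by apply: cvgM; [exact: is_derive_continuous (dm _ ht)|exact: cY].
    - by apply: is_derive_mul; [exact: (dm _ (ltW ht))|apply: dY_; rewrite ht /=; small_lra].
    - have tT : 0 < q < T by rewrite ht /=; small_lra.
      have Xt : 0 < X q by apply: below; rewrite (ltW ht) /=; small_lra.
      have := dYge _ tT; have := Nge0 _ tT Xt.
      have -> : b q * m q * Y q + m q * dY q = m q * (b q * Y q + dY q) by ring.
      have cc : 0 <= c ^+ 2 * X q by rewrite mulr_ge0 ?sqr_ge0 ?ltW.
      by move=> h1 h2; rewrite mulr_ge0 ?(ltW (mp _ (ltW ht)))//; small_lra.
  have m00 : 0 < m 0 * Y 0 by rewrite mulr_gt0 ?mp.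
  by rewrite -(pmulr_rgt0 _ (mp _ (ltW r0))); exact: lt_le_trans H.
have := @derive_ge0_le X Y 0 s s0; move=> H.
apply: (lt_le_trans X0); apply: H => q.
- by move=> _; exact: cX.
- by move=> /andP[t_0 ts]; apply: dX; rewrite t_0 /=; small_lra.
- by move=> ts; apply/ltW/YP.
Qed.

(* The witness is w t = exp (- 2 c t) * int_0^t exp (2 c s) W s ds. *)
Lemma exponential_average (c T : R) (b W dW Z : R -> R) : 0 < c -> 0 <= T ->
  (forall t : R, 0 <= t -> {for t, continuous W}) ->
  (forall t : R, 0 <= t -> {for t, continuous Z}) ->
  (forall t : R, 0 < t < T -> is_derive t 1 W (dW t)) ->
  (forall t : R, 0 < t < T -> is_derive t 1 Z (W t - 2 * c * Z t + b t * Z t)) ->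
  (forall t : R, 0 < t < T -> 0 <= dW t) -> (forall t : R, 0 <= t -> 0 <= b t) ->
  (forall t : R, 0 <= t <= T -> 0 < Z t) -> (forall t : R, 0 <= t <= T -> 0 < W t) ->
  (forall s t : R, 0 <= s -> s <= t -> t <= T -> W s <= W t) ->
  exists w : R -> R, [/\ forall t : R, 0 <= t -> is_derive t 1 w (W t - 2 * c * w t),
    forall t : R, 0 <= t <= T -> 0 <= w t,
    forall t : R, 0 <= t <= T -> w t * (2 * c) <= W t,
    forall t : R, 0 <= t <= T -> w t <= Z t &
    forall t : R, 0 <= t <= T - 1 -> W t * ((1 - expR (- (2 * c))) / (2 * c)) <= w (t + 1)].
Proof.
move=> c_gt0 T0 cW cZ dW_ dZ_ dW0 b0 Zpos Wpos Wmon.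
(* The integral of [exp (- 2 c s)] over [[0, 1]]: what one unit of time with [W] at least its
   initial value adds to [w]. *)
pose kap := (1 - expR (- (2 * c))) / (2 * c).
pose E2 (t : R) := expR (2 * c * t).
have E20 t : 0 < E2 t by exact: expR_gt0.
have dE2 (t : R) : is_derive t 1 E2 (2 * c * E2 t) by exact: is_derive_expM.
have E2E (t : R) : E2 t = E2 (t + 1) * expR (- (2 * c)).
  by rewrite /E2 -expRD; congr expR; ring.
clearbody E2.
have W00 : 0 < W 0 by apply: Wpos; rewrite lexx.
(* Positive part of the time: it extends [W] by [W 0] to negative times, so that the integrand is
   continuous on the whole line. *)
pose ps (s : R) := (s + `|s|) / 2.
have psE (s : R) : 0 <= s -> ps s = s by move=> h; rewrite /ps ger0_norm//; small_lra.
have ps0 (s : R) : 0 <= ps s by rewrite /ps; have := ler_norm (- s); rewrite normrN; small_lra.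
have cps : continuous ps.
  by move=> s; apply: cvgM; [apply: cvgD; [exact: cvg_id|exact: norm_continuous]|exact: cvg_cst].
have cf : continuous (fun s => E2 s * W (ps s)).
  move=> s; apply: cvgM; first exact: is_derive_continuous (dE2 s).
  by apply: (cvg_comp ps W (cps s)); exact: cW.
have [P [P0 dP]] := continuous_primitive cf.
have dP' (t : R) : 0 <= t -> is_derive t 1 P (E2 t * W t).
  by move=> h; have := dP t h; rewrite psE.
have cP (t : R) : 0 <= t -> {for t, continuous P} by move=> h; exact: is_derive_continuous (dP' _ h).
have cE2 (t : R) : {for t, continuous E2} by exact: is_derive_continuous (dE2 t).
have Pge0 (t : R) : 0 <= t <= T -> 0 <= P t.
  move=> /andP[t_0 tT]; rewrite -P0; apply: (@derive_ge0_le P (fun s => E2 s * W s) 0 t t_0) => r /andP[r1 r2].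
  - exact: cP.
  - by apply: dP'; exact: ltW.
  - by rewrite mulr_ge0 ?(ltW (E20 _))// ltW// Wpos// (ltW r1) /=; small_lra.
have PW (t : R) : 0 <= t <= T -> P t <= E2 t * W t / (2 * c).
  move=> /andP[t_0 tT].
  suff : E2 0 * W 0 * (2 * c)^-1 - P 0 <= E2 t * W t * (2 * c)^-1 - P t.
    have : 0 < E2 0 * W 0 * (2 * c)^-1 by rewrite divr_gt0 ?mulr_gt0.
    by rewrite P0 subr0; small_lra.
  apply: (@derive_ge0_le (fun s => E2 s * W s * (2 * c)^-1 - P s) (fun s => E2 s * dW s / (2 * c)) 0 t t_0) => r /andP[r1 r2].
  - apply: cvgB; last exact: cP.
    by apply: cvgM; [apply: cvgM; [exact: cE2|exact: cW]|exact: cvg_cst].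
  - have rT : 0 < r < T by rewrite r1 /=; small_lra.
    have := is_derive_sub (is_derive_mul (is_derive_mul (dE2 r) (dW_ _ rT)) (is_derive_cst (2 * c)^-1 r 1)) (dP' _ (ltW r1)).
    by move=> H; apply: (is_derive_eq H); rewrite /= mulr0 addr0; field; rewrite gt_eqF.
  - by rewrite divr_ge0 ?mulr_ge0 ?(ltW (E20 _)) ?(ltW c_gt0)// dW0// r1 /=; small_lra.
(* The damping has the right sign: the derivative of [E2 Z - P] is [E2 b Z]. *)
have PZ (t : R) : 0 <= t <= T -> P t <= E2 t * Z t.
  move=> /andP[t_0 tT].
  suff : E2 0 * Z 0 - P 0 <= E2 t * Z t - P t.
    have : 0 <= E2 0 * Z 0 by apply: mulr_ge0; [exact: ltW|apply/ltW/Zpos; rewrite lexx].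
    by rewrite P0 subr0; small_lra.
  apply: (@derive_ge0_le (fun s => E2 s * Z s - P s) (fun s => E2 s * (b s * Z s)) 0 t t_0) => r /andP[r1 r2].
  - by apply: cvgB; [apply: cvgM; [exact: cE2|exact: cZ]|exact: cP].
  - have rT : 0 < r < T by rewrite r1 /=; small_lra.
    have := is_derive_sub (is_derive_mul (dE2 r) (dZ_ _ rT)) (dP' _ (ltW r1)).
    by move=> H; apply: (is_derive_eq H); ring.
  - have rT : 0 <= r <= T by rewrite (ltW r1) /=; small_lra.
    by apply: mulr_ge0; [exact: ltW|apply: mulr_ge0; [exact/b0/ltW|exact/ltW/Zpos]].
(* Since [W] is nondecreasing, [W t] is controlled by the average one unit of time later. This is
   how a bound on [X] alone yields a bound on [W], which contains [X']. *)
have PS (t : R) : 0 <= t <= T - 1 -> W t * kap <= P (t + 1) / E2 (t + 1).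
  move=> /andP[t_0 tT]; have tt1 : t <= t + 1 by small_lra.
  have H : P t - W t / (2 * c) * E2 t <= P (t + 1) - W t / (2 * c) * E2 (t + 1).
    apply: (@derive_ge0_le (fun s => P s - W t / (2 * c) * E2 s) (fun s => E2 s * (W s - W t)) t (t + 1) tt1) => r /andP[r1 r2].
    - by apply: cvgB; [apply: cP; small_lra|apply: cvgM; [exact: cvg_cst|exact: cE2]].
    - have r0 : 0 <= r by small_lra.
      have := is_derive_sub (dP' _ r0) (is_derive_scale (W t / (2 * c)) (dE2 r)).
      by move=> H; apply: (is_derive_eq H); field; rewrite gt_eqF.
    - by rewrite mulr_ge0 ?(ltW (E20 _))// subr_ge0 Wmon//; small_lra.
  have Pt : 0 <= P t by apply: Pge0; rewrite t_0 /=; small_lra.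
  rewrite ler_pdivlMr//.
  have -> : W t * kap * E2 (t + 1) = W t / (2 * c) * E2 (t + 1) - W t / (2 * c) * (E2 (t + 1) * expR (- (2 * c))).
    by rewrite /kap; field; rewrite gt_eqF.
  by rewrite -E2E; small_lra.
pose w (t : R) := P t / E2 t.
have dw (t : R) : 0 <= t -> is_derive t 1 w (W t - 2 * c * w t).
  move=> h; have := is_derive_mul (dP' _ h) (is_derive_inv (lt0r_neq0 (E20 t)) (dE2 t)).
  by move=> H; apply: (is_derive_eq H); rewrite /w; field; rewrite gt_eqF.
have w0 (t : R) : 0 <= t <= T -> 0 <= w t by move=> h; rewrite divr_ge0 ?Pge0 ?(ltW (E20 _)).
have wW (t : R) : 0 <= t <= T -> w t * (2 * c) <= W t.
  move=> h; rewrite -ler_pdivlMr ?mulr_gt0// /w ler_pdivrMr//.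
  by apply: le_trans (PW _ h) _; rewrite le_eqVlt; apply/orP; left; apply/eqP; ring.
have wZ (t : R) : 0 <= t <= T -> w t <= Z t.
  by move=> h; rewrite /w ler_pdivrMr// mulrC; exact: PZ.
exists w; split => // t tT; exact: PS.
Qed.

(** Two regimes. If [4 c w <= W], then [F <= 5 W / 4] and [c (W - 2 c w) >= c W / 2 >= 2 c F / 5], a
    linear rate that beats [d F^2 / (a + F) <= d F]. Otherwise [F < 5 c w], and the quadratic growth
    of [W] in [Z >= w] suffices after [riccati_rescale]. *)
Lemma riccati_step (c k L d a W w Z dW : R) : 0 < c -> 0 < k -> 0 < L -> 0 < a ->
  d <= 2 * c / 5 -> d <= k / (5 * c + 25 * c ^+ 2 * L) ->
  0 < W -> 0 <= w -> w <= Z -> 0 < Z -> 0 <= dW -> w * (2 * c) <= W ->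
  k * Z ^+ 2 / (Z + L * a) <= dW ->
  d * (W + c * w) ^+ 2 / (a + (W + c * w)) <= dW + c * (W - 2 * c * w).
Proof.
move=> c0 k0 L0 a0 d1 d2 W0 w0 wZ Z0 dW0 wW Zd.
have F0 : 0 < W + c * w by rewrite ltr_wpDr// mulr_ge0 ?(ltW c0).
set F := W + c * w in F0 *.
have AF : 0 < a + F by rewrite addr_gt0.
have [big|small] := leP (4 * c * w) W.
  have F1 : d * F ^+ 2 / (a + F) <= 2 * c / 5 * F.
    rewrite ler_pdivrMr//.
    have s1 : d * F ^+ 2 <= 2 * c / 5 * F ^+ 2 by rewrite ler_wpM2r ?exprn_ge0 ?(ltW F0).
    have s2 : 0 <= 2 * c / 5 * (F * a) by rewrite !mulr_ge0 ?(ltW F0) ?(ltW a0) ?(ltW c0).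
    by apply: le_trans s1 _; rewrite -subr_ge0; apply: le_trans s2 _; rewrite le_eqVlt; apply/orP; left; apply/eqP; ring.
  apply: le_trans F1 _.
  have s3 : c * (4 * c * w) <= c * W by rewrite ler_pM2l.
  by rewrite /F; clear -s3 dW0; lra.
have F5 : F <= 5 * c * w by rewrite /F; clear -small; lra.
have wpos : 0 < w.
  by rewrite lt_def w0 andbT; apply/eqP => wz; move: small; rewrite wz mulr0 ltNge (ltW W0).
have LA : 0 < L * a by rewrite mulr_gt0.
apply: (@le_trans _ _ (k / (5 * c + 25 * c ^+ 2 * L) * (F ^+ 2 / (a + F)))).
  by rewrite -mulrA ler_wpM2r// divr_ge0 ?exprn_ge0 ?(ltW F0) ?(ltW AF).
apply: le_trans (riccati_rescale c0 L0 k0 F0 wpos a0 F5) _.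
apply: (@le_trans _ _ dW); last by rewrite lerDl mulr_ge0 ?(ltW c0)// subr_ge0; clear -wW; lra.
apply: le_trans Zd; have := sqr_div_shift_le Z0 w0 wZ LA (lexx (L * a)).
by rewrite -(ler_pM2l k0) !mulrA.
Qed.

(** [D] is fixed before the amplitude [e], which enters the Riccati estimate as the lower bound
    [c0 e] on [F]. The estimate stops at [T - 1] because bounding [W] looks one unit of time
    ahead. *)
Lemma damped_blowup (n : nat) (c k Cm C1 minf c0 : R) (A dA S b m : R -> R) :
  0 < c -> 0 < k -> 0 < Cm -> 0 < C1 -> 1 <= minf -> 0 < c0 ->
  (forall t : R, 0 <= t -> is_derive t 1 A (dA t)) -> (forall t : R, 0 <= t -> 0 <= dA t) ->
  (forall t : R, 0 <= t -> 1 <= A t) ->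
  (forall t : R, 0 <= t -> is_derive t 1 S (A t)^-1) ->
  (forall t : R, 0 <= t -> is_derive t 1 m (b t * m t)) -> (forall t : R, 0 <= t -> 0 <= b t) ->
  (forall t : R, 0 <= t -> 1 <= m t <= minf) ->
  exists2 D, 0 < D & forall (e T : R) (X Y dY N M : R -> R), 0 < e <= 1 -> 1 <= T ->
    continuous X -> continuous Y ->
    (forall t : R, 0 < t < T -> is_derive t 1 X (Y t)) ->
    (forall t : R, 0 < t < T -> is_derive t 1 Y (dY t)) ->
    (forall t : R, 0 < t < T -> c ^+ 2 * X t + N t - b t * Y t <= dY t) ->
    (forall t : R, 0 < t < T -> 0 < X t -> k * X t ^+ 2 / (X t + M t) <= N t) ->
    (forall t : R, 0 < t < T -> 0 < M t <= Cm * A t * expR (c * t)) ->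
    (forall t : R, 0 <= t <= T -> X t <= C1 * (1 + t) ^+ n * expR (c * t)) ->
    0 < X 0 -> 0 < Y 0 -> c0 * e <= Y 0 + c * X 0 -> S (T - 1) <= D / e.
Proof.
move=> c_gt0 k_gt0 Cm_gt0 C1_gt0 minf1 c0_gt0 dA_ dA0 A1 dS dm b0 m1.
have mi0 : 0 < minf by small_lra.
have e2c : expR (- (2 * c)) < 1 by rewrite expR_lt1 oppr_lt0 mulr_gt0.
pose kap := (1 - expR (- (2 * c))) / (2 * c).
have kap0 : 0 < kap by rewrite divr_gt0 ?mulr_gt0// subr_gt0.
pose L := minf * Cm.
have L0 : 0 < L by rewrite mulr_gt0.
(* The smaller of the rates of the two regimes of [riccati_step]. *)
pose d := Num.min (2 * c / 5) (k / (5 * c + 25 * c ^+ 2 * L)).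
have den0 : 0 < 5 * c + 25 * c ^+ 2 * L by rewrite addr_gt0 ?mulr_gt0 ?exprn_gt0.
have d0 : 0 < d by rewrite lt_min !divr_gt0 ?mulr_gt0.
(* [W t] is at most [Z (t + 1) / kap], where [2 + t <= 2 (1 + t)] produces the factor [2^n]; the
   summand [c] accounts for [c w]. *)
pose C2 := minf * C1 * (2 ^+ n / kap + c).
have C20 : 0 < C2 by rewrite !mulr_gt0// addr_gt0// divr_gt0// exprn_gt0.
pose t0 := n%:R * 2 / d.
have t00 : 0 <= t0 by rewrite /t0 divr_ge0 ?mulr_ge0 ?(ltW d0).
have U0 : 0 < 1 + C2 * (1 + t0) ^+ n by rewrite addr_gt0// mulr_gt0// exprn_gt0//; small_lra.
(* The first term covers the initial stretch up to [t0]; it may be divided by [e] because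
   [e <= 1]. *)
exists (`|S t0| + 2 / d * ((1 + C2 * (1 + t0) ^+ n) / c0)).
  by rewrite ltr_wpDl// mulr_gt0// divr_gt0.
move=> e T X Y dY N M /andP[e0 e1] T1 cX cY dX dY_ dYge Nge Mb Xb X0 Y0 XY0.
have T0 : 0 <= T by small_lra.
have cm (t : R) : 0 <= t -> {for t, continuous m} by move=> h; exact: is_derive_continuous (dm _ h).
have mp (t : R) : 0 <= t -> 0 < m t by move=> /m1 /andP[? _]; small_lra.
have Nge0 (t : R) : 0 < t < T -> 0 < X t -> 0 <= N t.
  move=> tT Xt; apply: le_trans (Nge _ tT Xt); have /andP[M0 _] := Mb _ tT.
  by rewrite divr_ge0 ?mulr_ge0 ?exprn_ge0 ?addr_ge0 ?(ltW k_gt0) ?(ltW Xt) ?(ltW M0).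
have Xpos (t : R) : 0 <= t <= T -> 0 < X t.
  exact: (positive_moment T0 dm mp cX cY dX dY_ dYge Nge0 X0 Y0).
pose Ec (t : R) := expR (- c * t).
have Ec0 t : 0 < Ec t by exact: expR_gt0.
have dEc (t : R) : is_derive t 1 Ec (- c * Ec t) by exact: is_derive_expM.
pose W (t : R) := m t * Ec t * (Y t + c * X t).
pose dW (t : R) := m t * Ec t * (dY t + b t * Y t + b t * c * X t - c ^+ 2 * X t).
pose Z (t : R) := m t * Ec t * X t.
have Zpos (t : R) : 0 <= t <= T -> 0 < Z t.
  by move=> h; rewrite !mulr_gt0 ?Xpos ?mp//; case/andP: h.
have dW_ (t : R) : 0 < t < T -> is_derive t 1 W (dW t).
  move=> h; have t_0 : 0 <= t by case/andP: h => /ltW.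
  have := is_derive_mul (is_derive_mul (dm _ t_0) (dEc t)) (is_derive_add (dY_ _ h) (is_derive_scale c (dX _ h))).
  by move=> H; apply: (is_derive_eq H); rewrite /dW; ring.
have dZ_ (t : R) : 0 < t < T -> is_derive t 1 Z (W t - 2 * c * Z t + b t * Z t).
  move=> h; have t_0 : 0 <= t by case/andP: h => /ltW.
  have := is_derive_mul (is_derive_mul (dm _ t_0) (dEc t)) (dX _ h).
  by move=> H; apply: (is_derive_eq H); rewrite /W /Z; ring.
have cW (t : R) : 0 <= t -> {for t, continuous W}.
  move=> h; apply: cvgM.
    by apply: cvgM; [exact: cm|exact: is_derive_continuous (dEc t)].
  by apply: cvgD; [exact: cY|apply: cvgM; [exact: cvg_cst|exact: cX]].
have cZ (t : R) : 0 <= t -> {for t, continuous Z}.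
  move=> h; apply: cvgM; last exact: cX.
  by apply: cvgM; [exact: cm|exact: is_derive_continuous (dEc t)].
have dWge (t : R) : 0 < t < T -> m t * Ec t * N t <= dW t.
  move=> h; have t_0 : 0 <= t by case/andP: h => /ltW.
  have hT : 0 <= t <= T by case/andP: h => /ltW -> /ltW ->.
  rewrite /dW ler_pM2l ?mulr_gt0 ?mp//.
  have := dYge _ h; have : 0 <= b t * c * X t by rewrite !mulr_ge0 ?b0 ?(ltW c_gt0) ?(ltW (Xpos _ hT)).
  by small_lra.
have dW0 (t : R) : 0 < t < T -> 0 <= dW t.
  move=> h; have t_0 : 0 <= t by case/andP: h => /ltW.
  have hT : 0 <= t <= T by case/andP: h => /ltW -> /ltW ->.
  apply: le_trans (dWge _ h); rewrite !mulr_ge0 ?(ltW (mp _ t_0)) ?(ltW (Ec0 _))//.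
  by apply: Nge0 => //; exact: Xpos.
have Wmon (s t : R) : 0 <= s -> s <= t -> t <= T -> W s <= W t.
  move=> s0 st tT; apply: (@derive_ge0_le W dW s t st) => r /andP[r1 r2].
  - by apply: cW; small_lra.
  - by apply: dW_; apply/andP; split; small_lra.
  - by apply: dW0; apply/andP; split; small_lra.
have W0 : c0 * e <= W 0.
  rewrite /W /Ec mulr0 expR0 mulr1; apply: le_trans XY0 _.
  by rewrite ler_peMl ?addr_ge0 ?mulr_ge0 ?(ltW Y0) ?(ltW c_gt0) ?(ltW X0)//; have /andP[] := m1 0 (lexx _).
have W00 : 0 < W 0 by apply: lt_le_trans W0; rewrite mulr_gt0.
have Wpos (t : R) : 0 <= t <= T -> 0 < W t.
  by move=> /andP[t_0 tT]; apply: lt_le_trans W00 _; exact: Wmon.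
clearbody W dW.
have [w [dw w0 wW wZ PS]] := exponential_average c_gt0 T0 cW cZ dW_ dZ_ dW0 b0 Zpos Wpos Wmon.
have Zb (t : R) : 0 <= t <= T -> Z t <= minf * C1 * (1 + t) ^+ n.
  move=> h; have t_0 : 0 <= t by case/andP: h.
  have /andP[_ mt] := m1 _ t_0.
  have EX : Ec t * X t <= C1 * (1 + t) ^+ n.
    have := ler_wpM2l (ltW (Ec0 t)) (Xb _ h).
    have -> : Ec t * (C1 * (1 + t) ^+ n * expR (c * t)) = C1 * (1 + t) ^+ n * (Ec t * expR (c * t)) by ring.
    by rewrite /Ec -expRD mulNr addNr expR0 mulr1.
  have E0 : 0 <= Ec t * X t by rewrite mulr_ge0 ?(ltW (Ec0 _)) ?(ltW (Xpos _ h)).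
  rewrite /Z -!mulrA; apply: ler_pM => //; exact: ltW (mp _ t_0).
pose F (t : R) := W t + c * w t.
pose dF (t : R) := dW t + c * (W t - 2 * c * w t).
have Fmain : forall t : R, 0 < t < T - 1 -> d * F t ^+ 2 / (A t + F t) <= dF t.
  move=> t /andP[t_0 tT1].
  have h : 0 < t < T by rewrite t_0 /=; small_lra.
  have hT : 0 <= t <= T by rewrite (ltW t_0) /=; small_lra.
  have Ap := lt_le_trans ltr01 (A1 _ (ltW t_0)).
  have d1 : d <= 2 * c / 5 by rewrite ge_min lexx.
  have d2 : d <= k / (5 * c + 25 * c ^+ 2 * L) by rewrite ge_min lexx orbT.
  apply: (riccati_step c_gt0 k_gt0 L0 Ap d1 d2 (Wpos _ hT) (w0 _ hT) (wZ _ hT) (Zpos _ hT) (dW0 _ h) (wW _ hT)).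
  apply: le_trans (dWge _ h).
  have /andP[M0 Mu] := Mb _ h.
  have Xp := Xpos _ hT.
  have mpt := mp _ (ltW t_0).
  have /andP[_ mit] := m1 _ (ltW t_0).
  have mE : 0 < m t * Ec t by rewrite mulr_gt0.
  apply: (@le_trans _ _ (m t * Ec t * (k * X t ^+ 2 / (X t + M t)))); last first.
    by rewrite ler_pM2l//; exact: Nge.
  have XM : 0 < X t + M t by rewrite addr_gt0.
  have -> : m t * Ec t * (k * X t ^+ 2 / (X t + M t)) = k * (Z t ^+ 2 / (Z t + m t * Ec t * M t)).
    by rewrite /Z; field; rewrite !gt_eqF// -mulrDr mulr_gt0.
  have ML : m t * Ec t * M t <= L * A t.
    have s1 : Ec t * M t <= Cm * A t.
      have := ler_wpM2l (ltW (Ec0 t)) Mu.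
      have -> : Ec t * (Cm * A t * expR (c * t)) = Cm * A t * (Ec t * expR (c * t)) by ring.
      by rewrite /Ec -expRD mulNr addNr expR0 mulr1.
    rewrite /L -!mulrA; apply: ler_pM => //; first exact: ltW.
    by rewrite mulr_ge0 ?(ltW (Ec0 _)) ?(ltW M0).
  have mM0 : 0 < m t * Ec t * M t by rewrite mulr_gt0.
  have Zp := Zpos _ hT.
  rewrite -mulrA ler_pM2l//; exact: (sqr_div_shift_le Zp (ltW Zp) (lexx (Z t)) mM0 ML).
have Fb (t : R) : 0 <= t <= T - 1 -> F t <= C2 * (1 + t) ^+ n.
  move=> /andP[t_0 tT]; have hT : 0 <= t <= T by rewrite t_0 /=; small_lra.
  have hT1 : 0 <= t + 1 <= T by apply/andP; split; small_lra.
  have tt : 0 <= t <= T - 1 by rewrite t_0.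
  have Wb : W t <= minf * C1 * (2 ^+ n * (1 + t) ^+ n) / kap.
    rewrite ler_pdivlMr//; apply: le_trans (PS _ tt) _.
    apply: le_trans (wZ _ hT1) _; apply: le_trans (Zb _ hT1) _.
    rewrite ler_pM2l ?mulr_gt0// -exprMn lerXn2r ?nnegrE//; small_lra.
  have wb : c * w t <= c * (minf * C1 * (1 + t) ^+ n).
    by rewrite ler_pM2l//; apply: le_trans (wZ _ hT) (Zb _ hT).
  apply: le_trans (lerD Wb wb) _; rewrite /C2 le_eqVlt; apply/orP; left; apply/eqP; field.
  by rewrite gt_eqF.
have Fl (t : R) : 0 <= t <= T - 1 -> c0 * e <= F t.
  move=> /andP[t_0 tT]; have hT : 0 <= t <= T by rewrite t_0 /=; small_lra.
  apply: le_trans W0 _; apply: (@le_trans _ _ (W t)); first by apply: Wmon => //; case/andP: hT.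
  by rewrite lerDl mulr_ge0 ?(ltW c_gt0) ?w0.
have De (x : R) : 0 <= x -> x <= x / e by move=> x0; rewrite ler_pdivlMr// ler_piMr.
have S0 : S t0 <= `|S t0| / e by apply: le_trans (De _ (normr_ge0 _)); exact: ler_norm.
have rest0 : 0 <= 2 / d * ((1 + C2 * (1 + t0) ^+ n) / c0).
  by rewrite !mulr_ge0 ?invr_ge0 ?ltW.
(* If [T - 1] comes before [t0], the monotonicity of [S] is enough. *)
have [t0T|Tt0] := leP t0 (T - 1); last first.
  have S1 : S (T - 1) <= S t0.
    apply: (@derive_ge0_le S (fun t => (A t)^-1) (T - 1) t0 (ltW Tt0)) => r /andP[r1 r2].
    - by apply: is_derive_continuous (dS _ _); small_lra.
    - by apply: dS; small_lra.
    - by rewrite invr_ge0; have := A1 r; small_lra.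
  by rewrite mulrDl; have := De _ rest0; small_lra.
have ce0 : 0 < c0 * e by rewrite mulr_gt0.
have := @riccati_bound n d C2 (c0 * e) (T - 1) A dA S F dF d0 C20 ce0 t0T dA_ dA0 A1 dS.
move=> H; have {}H : d / 2 * (S (T - 1) - S t0) <= (1 + C2 * (1 + t0) ^+ n) / (c0 * e).
  apply: H => //.
  - move=> t /andP[t_0 _]; apply: cvgD; first exact: cW.
    by apply: cvgM; [exact: cvg_cst|exact: is_derive_continuous (dw _ t_0)].
  - move=> t /andP[t_0 tT]; apply: is_derive_add; first by apply: dW_; rewrite t_0 /=; small_lra.
    by apply: is_derive_scale; apply: dw; exact: ltW.
have H2 : S (T - 1) - S t0 <= 2 / d * ((1 + C2 * (1 + t0) ^+ n) / c0) / e.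
  rewrite -(ler_pM2l (_ : 0 < d / 2)) ?divr_gt0//; apply: le_trans H _.
  by rewrite le_eqVlt; apply/orP; left; apply/eqP; field; rewrite !gt_eqF.
by rewrite mulrDl; small_lra.
Qed.

End RealMonotone.

(** * Averages of plane waves over the sphere *)

Section TwoDirections.

(** A planar theorem of the alternative: if the cone generated by the vectors [(a s, b s)] missed
    the open positive quadrant, some nonzero [(p, q) >= 0] would satisfy [p a + q b <= 0] on [S]. In
    the plane two generators suffice. *)
Lemma two_directions (R : realType) (U : Type) (S : set U) (a b : U -> R) :
  (forall p q : R, 0 <= p -> 0 <= q -> 0 < p + q -> exists2 s, S s & 0 < p * a s + q * b s) ->
  exists s1 s2 (p1 p2 : R), [/\ S s1, S s2, 0 <= p1, 0 <= p2 &
    0 < p1 * a s1 + p2 * a s2 /\ 0 < p1 * b s1 + p2 * b s2].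
Proof.
move=> H; apply: contrapT => noPair.
have np s1 s2 p1 p2 : S s1 -> S s2 -> 0 <= p1 -> 0 <= p2 ->
    0 < p1 * a s1 + p2 * a s2 -> 0 < p1 * b s1 + p2 * b s2 -> False.
  by move=> S1 S2 p10 p20 A B; apply: noPair; exists s1, s2, p1, p2.
have [s0 Ss0 a0] : exists2 s, S s & 0 < a s.
  by have [|||s Ss] := H 1 0; rewrite ?ler01 ?addr0 ?ltr01//; exists s => //; lra.
have [t0 St0 b0] : exists2 s, S s & 0 < b s.
  by have [|||s Ss] := H 0 1; rewrite ?ler01 ?add0r ?ltr01//; exists s => //; lra.
(* No pair being admissible, vectors with [a > 0] lie clockwise from the opposites of vectors with
   [b > 0]; this is the sign of a determinant. *)
have ab s t : S s -> S t -> 0 < a s -> 0 < b t -> a s * b t <= a t * b s.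
  move=> Ss St as_ bt; rewrite leNgt; apply/negP => lt_ab.
  have [bs|bs] := leP (b s) 0; last by apply: (np s t 1 0); rewrite ?ler01//; lra.
  have [at_|at_] := leP (a t) 0; last by apply: (np s t 0 1); rewrite ?ler01//; lra.
  pose d := a s * b t - a t * b s.
  have d0 : 0 < d by rewrite /d subr_gt0.
  pose e := d / (2 * (b t)).
  have e0 : 0 < e by rewrite divr_gt0// mulr_gt0.
  have eE : e * b t * 2 = d by rewrite /e; field; rewrite gt_eqF.
  have bs0 : 0 <= - b s by lra.
  have [bsz|bsn] := eqVneq (b s) 0.
    pose p := 1 + (- a t) / a s.
    have p0 : 0 <= p by rewrite addr_ge0 ?divr_ge0 ?(ltW as_)//; lra.
    apply: (np s t p 1) => //; rewrite ?ler01 ?bsz//; last lra.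
    by rewrite /p mulrDl divfK ?gt_eqF//; lra.
  have bsp : 0 < - b s by rewrite lt_def bs0 andbT oppr_eq0.
  pose q := (- b s * a s + e * a s) / a s.
  (* The weights [b t] and [- b s] give the vector [(d, 0)]. The additional weight on [t] makes the
     second coordinate positive and costs less than [d / 2] in the first. *)
  apply: (np s t (b t) (- b s + d / (2 * (1 - a t)))) => //; first exact: ltW.
  - by rewrite addr_ge0// divr_ge0 ?(ltW d0)//; lra.
  - have -> : b t * a s + (- b s + d / (2 * (1 - a t))) * a t =
       d * (2 - a t) / (2 * (1 - a t)) by rewrite /d; field; rewrite gt_eqF//; lra.
    by rewrite divr_gt0 ?mulr_gt0//; lra.
  - have -> : b t * b s + (- b s + d / (2 * (1 - a t))) * b t = d / (2 * (1 - a t)) * b t by ring.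
    by rewrite mulr_gt0// divr_gt0// mulr_gt0//; lra.
have bneg s : S s -> 0 < a s -> b s < 0.
  move=> Ss as_; have := ab _ _ Ss St0 as_ b0; have : 0 < a s * b t0 by rewrite mulr_gt0.
  have at0 : a t0 <= 0.
    rewrite leNgt; apply/negP => at0.
    by apply: (np t0 t0 1 0); rewrite ?ler01//; lra.
  move=> h1 h2; rewrite ltNge; apply/negP => bs.
  have : a t0 * b s <= 0 by rewrite mulr_le0_ge0.
  by lra.
(* The admissible slopes [q / p] of a separating line are at least every element of [Q] and, by
   [ab], those elements are at most [- a t / b t] whenever [b t > 0]. *)
pose Q : set R := [set a s / (- b s) | s in [set s | S s /\ 0 < a s]].
have Q0 : Q !=set0 by exists (a s0 / - b s0); exists s0.
have ubQ t : S t -> 0 < b t -> ubound Q (- a t / b t).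
  move=> St bt _ [s [Ss as_] <-].
  have bs := bneg _ Ss as_.
  rewrite ler_pdivrMr; last lra.
  rewrite mulrAC ler_pdivlMr//.
  by have := ab _ _ Ss St as_ bt; nra.
have hQ : has_sup Q by split => //; exists (- a t0 / b t0); exact: ubQ.
pose k := sup Q.
have k0 : 0 < k.
  apply: (@lt_le_trans _ _ (a s0 / - b s0)); first by rewrite divr_gt0// oppr_gt0 bneg.
  by apply: ub_le_sup; [exact: hQ.2|exists s0].
(* The supremum [k] of [Q] separates: [a s + k b s <= 0] on all of [S], contradicting the hypothesis
   at [(1, k)]. *)
have [||| s Ss] := H 1 k; [exact: ler01|exact: ltW|by rewrite addr_gt0|].
apply/negP; rewrite -leNgt mul1r.
have [as_|as_] := ltP 0 (a s).
  have bs := bneg _ Ss as_.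
  have : a s / (- b s) <= k by apply: ub_le_sup; [exact: hQ.2|exists s].
  by rewrite ler_pdivrMr ?oppr_gt0//; lra.
have [bs|bs] := ltP 0 (b s); last by have := mulr_ge0_le0 (ltW k0) bs; lra.
have : k <= - a s / b s by apply: ge_sup => //; exact: ubQ.
by rewrite ler_pdivlMr//; lra.
Qed.

End TwoDirections.

Section SphereKernel.
Context {R : realType} {n : nat}.
Notation mu := (@lebesgue_measure R).
Notation tm := (tuple_measure (@lebesgue_measure R)).
Notation E := 'rV[R]_n.
Notation T := (n.-tuple (measurableTypeR R)).

(** Radial projection to the unit sphere; the origin goes to 0 since the inverse of 0 is 0, so the
    norm is at most 1 everywhere. *)
Definition hat (t : T) : E := (enorm (tuple_rV t))^-1 *: tuple_rV t.
Definition punctured_ball : set T := [set t | 0 < enorm (tuple_rV t) < 1].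
Let B := punctured_ball.

Lemma measurable_enorm : measurable_fun setT (lift_tuple (@enorm R n)).
Proof. exact: measurable_continuous_tuple (@continuous_enorm R n). Qed.

Lemma measurable_punctured_ball : measurable B.
Proof.
have -> : B = lift_tuple (@enorm R n) @^-1` `]0, 1[%classic.
  by apply/seteqP; split => t; rewrite /B /punctured_ball /= in_itv.
by rewrite -[X in measurable X]setTI; apply: measurable_enorm => //; exact: measurable_itv.
Qed.

Lemma enorm_hat t : B t -> enorm (hat t) = 1.
Proof.
move=> /andP[t0 _]; rewrite /hat enormZ ger0_norm ?invr_ge0 ?enorm_ge0//.
by rewrite mulVf// gt_eqF.
Qed.

Lemma enorm_hat_le t : enorm (hat t) <= 1.
Proof.
have [t0|t0] := eqVneq (enorm (tuple_rV t)) 0.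
  rewrite /hat t0 invr0 scale0r /enorm /dotrv big1 ?sqrtr0// => i _.
  by rewrite mxE mul0r.
by rewrite /hat enormZ ger0_norm ?invr_ge0 ?enorm_ge0// mulVf.
Qed.

Lemma measurable_hat i : measurable_fun setT (fun t => hat t 0 i).
Proof.
rewrite (_ : (fun _ => _) = fun t => (lift_tuple (@enorm R n) t) `^ (- 1) * tnth t i).
  apply: measurable_funM; last exact: measurable_tnth.
  apply: (measurableT_comp (measurable_powR _)); exact: measurable_enorm.
by apply/funext => t; rewrite /hat !mxE powR_inv1// enorm_ge0.
Qed.

Lemma ball_measure_lty : (tm n [set t | enorm (tuple_rV t) < 1]%R < +oo)%E.
Proof.
have mB1 : measurable [set t : T | enorm (tuple_rV t) < 1].
  have -> : [set t : T | enorm (tuple_rV t) < 1] = lift_tuple (@enorm R n) @^-1` `]-oo, 1[%classic.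
    by apply/seteqP; split => t; rewrite /= in_itv.
  by rewrite -[X in measurable X]setTI; apply: measurable_enorm => //; exact: measurable_itv.
have b1 : bcs (fun x : E => 1 * \1_[set x : E | enorm x <= 1] x).
  by apply: bcs_eball => x; exact: cst_continuous.
have /integrableP[_ ltB] := bcs_integrable b1.
apply: le_lt_trans ltB.
rewrite -(setIT [set _ | _]) -integral_indic//.
apply: ge0_le_integral => //.
- by apply/measurable_EFinP; exact: measurable_indic.
- by apply: measurableT_comp => //; apply/measurable_EFinP; exact: b1.1.
- move=> t _; rewrite /= lee_fin /lift_tuple mul1r !indicE ger0_norm//.
  have [/=|//] := boolP (t \in _); rewrite inE/= => t1.
  by rewrite mem_set//= ltW.
Qed.

(** For [n > 0] the origin is a null set, being contained in a degenerate cube; away from it [hat]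
    is a unit vector. *)
Lemma Rintegral_punctured_ball (f : T -> R) :
  (0 < n)%N ->
  measurable_fun setT f -> (exists M, forall t, `|f t| <= M) ->
  \int[tm n]_(t in [set t | enorm (tuple_rV t) < 1]) f t = \int[tm n]_(t in B) f t.
Proof.
move=> n0 mf [M HM].
have mB1 : measurable [set t : T | enorm (tuple_rV t) < 1].
  have -> : [set t : T | enorm (tuple_rV t) < 1] = lift_tuple (@enorm R n) @^-1` `]-oo, 1[%classic.
    by apply/seteqP; split => t; rewrite /= in_itv.
  by rewrite -[X in measurable X]setTI; apply: measurable_enorm => //; exact: measurable_itv.
pose N := [set t : T | enorm (tuple_rV t) <= 0].
have mN : measurable N.
  have -> : N = lift_tuple (@enorm R n) @^-1` `]-oo, 0]%classic.
    by apply/seteqP; split => t; rewrite /= in_itv.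
  by rewrite -[X in measurable X]setTI; apply: measurable_enorm => //; exact: measurable_itv.
have N0 : tm n N = 0%E.
  apply/eqP; rewrite eq_le measure_ge0 andbT.
  have <- : (\prod_(i < n) (0 : R))%:E = 0%E by rewrite prodr_const card_ord expr0n gtn_eqF.
  rewrite -(@ge0_integral_tuple_prod R n (fun _ => \1_(`[0%R, 0%R]%classic : set R))); last 3 first.
  - by move=> i; apply: measurable_indic; exact: measurable_itv.
  - by move=> i x; rewrite indicE.
  - move=> i; rewrite integral_indic//= setIT lebesgue_measure_itv/= lte_fin ltxx//.
  rewrite -(setIT N) -integral_indic//.
  apply: ge0_le_integral => //.
  - by apply/measurable_EFinP; exact: measurable_indic.
  - apply/measurable_EFinP; apply: measurable_prod => i _.
    apply: (@measurableT_comp _ _ _ _ _ _ (\1_(`[0%R, 0%R]%classic : set (measurableTypeR R)) : _ -> R)).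
      by apply: measurable_indic; exact: measurable_itv.
    exact: measurable_tnth.
  - move=> t _; rewrite lee_fin indicE; have [|_] := boolP (t \in N); last first.
      by apply: prodr_ge0 => i _; rewrite indicE.
    rewrite inE => tN; rewrite big1// => i _; rewrite indicE mem_set//= in_itv/=.
    have := le_trans (ler_coord_enorm (tuple_rV t) i) tN.
    by rewrite normr_le0 mxE => /eqP ->; rewrite lexx.
have BE : B = [set t | enorm (tuple_rV t) < 1] `\` N.
  apply/seteqP; split => t /=.
    by move=> /andP[t0 t1]; split => //; apply/negP; rewrite -ltNge.
  by move=> [t1 /negP]; rewrite -ltNge /B /punctured_ball/= => ->.
rewrite /Rintegral BE; congr fine; apply: negligible_integral => //.
apply: measurable_bounded_integrable => //.
- exact: ball_measure_lty.
- exact: measurable_funTS.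
- exists M; split; first exact: num_real.
  by move=> y My t _; exact: le_trans (HM t) (ltW My).
Qed.

Lemma punctured_ball_lty : (tm n B < +oo)%E.
Proof.
apply: le_lt_trans ball_measure_lty; apply: le_measure; rewrite ?inE.
- exact: measurable_punctured_ball.
- have -> : [set t : T | enorm (tuple_rV t) < 1] = lift_tuple (@enorm R n) @^-1` `]-oo, 1[%classic.
    by apply/seteqP; split => t; rewrite /= in_itv.
  by rewrite -[X in measurable X]setTI; apply: measurable_enorm => //; exact: measurable_itv.
- by move=> t /andP[].
Qed.

(** Fubini over space and the punctured ball, with [H] times an indicator as majorant, passes the
    sign from each direction to the average. The integrability of the average lets several kernels
    be combined linearly. *)
Lemma sphere_kernel (h : E -> E -> R) (H : E -> R) : bcs H ->
  measurable_fun setT (fun z : T * T => h (tuple_rV z.1) (hat z.2)) ->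
  (forall x s, enorm s <= 1 -> `|h x s| <= H x) ->
  (tm n).-integrable setT (EFin \o lift_tuple (fun x => \int[tm n]_(t in B) h x (hat t))) /\
  ((forall s, enorm s = 1 -> integral_Rn setT (fun x => h x s) <= 0) ->
   integral_Rn setT (fun x => \int[tm n]_(t in B) h x (hat t)) <= 0).
Proof.
move=> bH mh hH.
pose G (z : T * T) : R := h (tuple_rV z.1) (hat z.2) * \1_B z.2.
have mB := measurable_punctured_ball.
have mG : measurable_fun setT G.
  apply: measurable_funM => //; apply: (@measurableT_comp _ _ _ _ _ _ (\1_B : T -> R)) => //.
have H0 x : 0 <= H x.
  apply: le_trans (hH x 0 _) => //.
  by rewrite /enorm /dotrv big1 ?sqrtr0 ?ler01// => i _; rewrite mxE mul0r.
have GH x t : `|G (x, t)| <= lift_tuple H x * \1_B t.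
  rewrite /G /= normrM [`|\1_B t|]ger0_norm ?indicE//.
  by apply: ler_wpM2r => //; apply: hH; exact: enorm_hat_le.
have intG : (tm n \x tm n)%E.-integrable setT (EFin \o G).
  apply/integrable12ltyP; first exact/measurable_EFinP.
  apply: (@le_lt_trans _ _ (\int[tm n]_x ((lift_tuple H x)%:E * tm n B))%E).
    apply: ge0_le_integral => //.
    - by move=> x _; apply: integral_ge0.
    - apply: (@measurable_fun_fubini_tonelli_F _ _ _ _ _ (tm n) (fun z => `|(G z)%:E|%E)) => //.
      by apply: measurableT_comp => //; exact/measurable_EFinP.
    - by apply: emeasurable_funM => //; apply/measurable_EFinP; exact: bH.1.
    - move=> x _; apply: (@le_trans _ _ (\int[tm n]_t ((lift_tuple H x)%:E * (\1_B t)%:E))%E).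
        apply: ge0_le_integral => //.
        + apply: measurableT_comp => //; apply/measurable_EFinP.
          apply: (measurableT_comp mG); exact: measurable_pair1.
        + by apply/measurable_EFinP; apply: measurable_funM => //; exact: measurable_indic.
        + by move=> t _; rewrite /= lee_fin; exact: GH.
      rewrite ge0_integralZl//.
      * by rewrite integral_indic// setIT.
      * by apply/measurable_EFinP; exact: measurable_indic.
      * by rewrite lee_fin; exact: H0.
  rewrite ge0_integralZr//; last 2 first.
  - by apply/measurable_EFinP; exact: bH.1.
  - by move=> x _; rewrite lee_fin; exact: H0.
  rewrite lte_mul_pinfty//.
  - by apply: integral_ge0 => x _; rewrite lee_fin; exact: H0.
  - by apply: integrable_fin_num => //; exact: bcs_integrable bH.
  - exact: punctured_ball_lty.
have GE x : (\int[tm n]_t (G (x, t))%:E)%E = (\int[tm n]_(t in B) h (tuple_rV x) (hat t))%:E.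
  rewrite Rintegral_mkcond /Rintegral fineK.
    by apply: eq_integral => t _; rewrite patch_indic.
  have mhx : measurable_fun setT (fun t => h (tuple_rV x) (hat t)).
    exact: (measurableT_comp mh (measurable_pair1 x)).
  apply: integrable_fin_num => //.
  apply: (@le_integrable _ _ _ _ _ measurableT _ (fun t => (H (tuple_rV x) * \1_B t)%:E)).
  - apply/measurable_EFinP; rewrite patch_indic; apply: measurable_funM => //.
  - move=> t _; rewrite patch_indic /= lee_fin [leRHS]ger0_norm ?mulr_ge0//; exact: (GH x t).
  - under [X in _.-integrable _ X]eq_fun do rewrite EFinM.
    apply: integrableZl => //; apply/integrableP; split; first exact/measurable_EFinP.
    under eq_integral do rewrite /= ger0_norm//.
    by rewrite integral_indic// setIT; exact: punctured_ball_lty.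
split.
  have := integrable_fubini_F intG; congr (_.-integrable _ _).
  by apply/funext => x; rewrite /fubini_F /= GE.
move=> hs; rewrite integral_RnE /Rintegral.
have -> : (\int[tm n]_x (lift_tuple (fun x => \int[tm n]_(t in B) h x (hat t)) x)%:E)%E =
          (\int[tm n]_x \int[tm n]_t (EFin \o G) (x, t))%E.
  by apply: eq_integral => x _; rewrite /= GE.
rewrite (Fubini intG).
have npos t : (\int[tm n]_x (EFin \o G) (x, t) <= 0)%E.
  have [Bt|nBt] := pselect (B t); last first.
    rewrite (_ : (\int[_]_x _)%E = 0%E)//; apply: integral0_eq => x _.
    by rewrite /= /G /= indicE memNset// mulr0.
  have := hs _ (enorm_hat Bt); rewrite integral_RnE /Rintegral.
  have -> : (\int[tm n]_x (lift_tuple (h^~ (hat t)) x)%:E)%E = (\int[tm n]_x (EFin \o G) (x, t))%E.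
    by apply: eq_integral => x _; rewrite /= /G /= indicE mem_set// mulr1.
  have : (\int[tm n]_x (EFin \o G) (x, t))%E \is a fin_num.
    apply: integrable_fin_num => //.
    apply: (@le_integrable _ _ _ _ _ measurableT _ (EFin \o lift_tuple H)).
    - by apply/measurable_EFinP; apply: (measurableT_comp mG); exact: measurable_pair2.
    - move=> x _; rewrite /= lee_fin [leRHS]ger0_norm; last exact: H0.
      by apply: le_trans (GH x t) _; rewrite indicE mem_set// mulr1.
    - exact: bcs_integrable.
  by move=> /fineK <-; rewrite lee_fin.
(* The sign is reversed so that the outer integral is that of a nonnegative function. *)
have -> : (\int[tm n]_t \int[tm n]_x (EFin \o G) (x, t) =
   - \int[tm n]_t (- \int[tm n]_x (EFin \o G) (x, t)))%E.
  rewrite -integral_ge0N; first by apply: eq_integral => t _; rewrite oppeK.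
  by move=> t _; rewrite oppe_ge0.
rewrite fineN oppr_le0; apply: fine_ge0; apply: integral_ge0 => t _.
by rewrite oppe_ge0.
Qed.

End SphereKernel.

Lemma is_derive_expR_affine {R : realType} (a b h : R) :
  is_derive h 1 (fun s : R => expR (a + s * b)) (expR (a + h * b) * b).
Proof.
have H : is_derive h 1 (fun s : R => a + s * b) b.
  by apply: is_derive_eq; rewrite /GRing.scale/=; ring.
exact: (is_derive1_comp (f := expR)).
Qed.

Lemma dotrv_delta {R : realType} n (x s : 'rV[R]_n) (h : R) i :
  dotrv (x + h *: delta_mx 0 i) s = dotrv x s + h * s 0 i.
Proof.
rewrite dotrvDl dotrvZl; congr (_ + _ * _).
rewrite /dotrv (bigD1 i)//= big1 ?addr0; first by rewrite mxE !eqxx mul1r.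
by move=> j ji; rewrite mxE eqxx (negbTE ji) mul0r.
Qed.

Lemma is_derive_plane_wave {R : realType} n (x v s : 'rV[R]_n) :
  is_derive x v (fun y => expR (dotrv y s)) (expR (dotrv x s) * dotrv v s).
Proof.
apply: is_derive_of_line.
rewrite (_ : (fun h => _) = fun h : R => expR (dotrv x s + h * dotrv v s)); last first.
  by apply/funext => h; rewrite dotrvDl dotrvZl.
have := is_derive_expR_affine (dotrv x s) (dotrv v s) 0.
by rewrite mul0r addr0.
Qed.

Section PhiPlaneWaves.
Context {R : realType} {m : nat}.
Notation n := m.+2.
Notation mu := (@lebesgue_measure R).
Notation tm := (tuple_measure (@lebesgue_measure R)).
Notation E := 'rV[R]_n.
Notation T := (n.-tuple (measurableTypeR R)).
Notation B := (@punctured_ball R n).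

(** The normalisation of [phi] times the factor relating surface and volume integrals; as [c0 >= 0],
    it preserves the sign of an average. *)
Let c0 : R := (n%:R * unit_ball_volume n)^-1 * n%:R.

Let c0_ge0 : 0 <= c0.
Proof.
rewrite mulr_ge0// invr_ge0 mulr_ge0// divr_ge0 ?powR_ge0//.
by apply: Rintegral_ge0 => t _; rewrite mulr_ge0 ?powR_ge0 ?expR_ge0.
Qed.

Let measurable_dot (x : E) : measurable_fun setT (fun t : T => dotrv x (hat t)).
Proof. by apply: measurable_sum => i; apply: measurable_funM => //; exact: measurable_hat. Qed.

Let dot_hat_le (x : E) (t : T) : dotrv x (hat t) <= enorm x.
Proof.
apply: le_trans (dotrv_le _ _) _; rewrite ler_piMr ?enorm_ge0//.
exact: enorm_hat_le.
Qed.

Lemma phi_sphereE (x : E) : phi x = c0 * \int[tm n]_(t in B) expR (dotrv x (hat t)).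
Proof.
rewrite -Rintegral_punctured_ball//.
- by rewrite /phi /sphere_integral /integral_Rn mulrA.
- by apply: measurableT_comp => //; exact: measurable_dot.
- by exists (expR (enorm x)) => t; rewrite ger0_norm ?expR_ge0// ler_expR dot_hat_le.
Qed.

(** Differentiation under the integral; for [|h| < 1] the derivatives are dominated by
    [exp (|x| + 1)]. *)
Lemma partial_phiE (x : E) i :
  partial i (@phi R n) x = c0 * \int[tm n]_(t in B) (hat t 0 i * expR (dotrv x (hat t))).
Proof.
pose f (h : R) (t : T) := expR (dotrv x (hat t) + h * hat t 0 i).
have fE h : \int[tm n]_(t in B) f h t = \int[tm n]_(t in B) expR (dotrv (x + h *: delta_mx 0 i) (hat t)).
  by apply: eq_Rintegral => t _; rewrite dotrv_delta.
have d1 h t : partial1of2 f h t = expR (dotrv x (hat t) + h * hat t 0 i) * hat t 0 i.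
  rewrite /partial1of2 derive1E.
  by have [_ ->] := is_derive_expR_affine (dotrv x (hat t)) (hat t 0 i) h.
have hat1 (t : T) : `|hat t 0 i| <= 1 := le_trans (ler_coord_enorm _ _) (enorm_hat_le t).
have mf h : measurable_fun setT (f h).
  apply: measurableT_comp => //; apply: measurable_funD; first exact: measurable_dot.
  by apply: measurable_funM => //; exact: measurable_hat.
have intB (M : R) (g : T -> R) : measurable_fun setT g -> (forall t, `|g t| <= M) ->
    (tm n).-integrable B (EFin \o g).
  move=> mg gM; apply: measurable_bounded_integrable => //.
  - exact: measurable_punctured_ball.
  - exact: punctured_ball_lty.
  - exact: measurable_funTS.
  - exists M; split; first exact: num_real.
    by move=> y My t _; exact: le_trans (gM t) (ltW My).
have fle h t : `]-1, 1[%classic h -> `|f h t| <= expR (enorm x + 1).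
  rewrite /= in_itv/= => /andP[h1 h2].
  rewrite ger0_norm ?expR_ge0// ler_expR lerD// ?dot_hat_le//.
  apply: le_trans (ler_norm _) _; rewrite normrM -[leRHS]mulr1 ler_pM//.
  by rewrite ler_norml; apply/andP; split; lra.
have I0 : `]-1, 1[%classic (0 : R) by rewrite /= in_itv/= ltrN10 ltr01.
have := @cvg_differentiation_under_integral R _ _ (tm n) f B
  (@measurable_punctured_ball _ _) 0 (-1) 1 I0 _ _ (fun=> expR (enorm x + 1)).
move=> H.
have {}H : h^-1 *: (\int[tm n]_(t in B) f (h + 0) t - \int[tm n]_(t in B) f 0 t) @[h --> 0^'] -->
    \int[tm n]_(t in B) partial1of2 f 0 t.
  apply: H.
  - by move=> h Ih; apply: intB (mf h) _ => t; exact: fle.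
  - by move=> h t Ih _; have [] := is_derive_expR_affine (dotrv x (hat t)) (hat t 0 i) h.
  - by move=> t; exact: expR_ge0.
  - apply: (intB (expR (enorm x + 1))) => // t.
    by rewrite ger0_norm ?expR_ge0.
  - move=> h t Ih _; rewrite d1 normrM -[leRHS]mulr1 ler_pM//; exact: fle.
rewrite /partial /derive; apply/cvg_lim => //.
have -> : (fun h : R => h^-1 *: (phi (h *: delta_mx 0 i + x) - phi x)) =
  (fun h => c0 * (h^-1 *: (\int[tm n]_(t in B) f (h + 0) t - \int[tm n]_(t in B) f 0 t))).
  apply/funext => h; rewrite addr0.
  have -> : phi (h *: delta_mx 0 i + x) = c0 * \int[tm n]_(t in B) f h t.
    by rewrite addrC fE; exact: phi_sphereE.
  have -> : phi x = c0 * \int[tm n]_(t in B) f 0 t.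
    by rewrite fE scale0r addr0; exact: phi_sphereE.
  by rewrite -mulrBr /GRing.scale/= mulrCA.
rewrite (_ : \int[tm n]_(t in B) (hat t 0 i * expR (dotrv x (hat t))) =
  \int[tm n]_(t in B) partial1of2 f 0 t); last first.
  by apply: eq_Rintegral => t _; rewrite d1 mul0r addr0 mulrC.
apply: cvgM => //; exact: cvg_cst.
Qed.

(** Were the combination nonpositive in every direction, its average over the sphere, which by
    Fubini is the combination for [phi] up to a nonnegative factor, would be nonpositive too. *)
Lemma plane_wave_average_ge2 (f : E -> R) (v : E -> E) (K p q : R) :
  continuous f -> (forall x, K < `|x| -> f x = 0) ->
  (forall i, continuous (fun x => v x 0 i)) -> (forall x, K < `|x| -> v x = 0) ->
  0 < p * integral_Rn setT (fun x => f x * phi x) +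
      q * integral_Rn setT (fun x => dotrv (v x) (gradient (@phi R n) x)) ->
  exists2 s : E, enorm s = 1 &
    0 < p * integral_Rn setT (fun x => f x * expR (dotrv x s)) +
        q * integral_Rn setT (fun x => dotrv (v x) s * expR (dotrv x s)).
Proof.
move=> cf f0 cv v0 pos; apply: contrapT => nos.
pose h1 (x s : E) : R := f x * expR (dotrv x s).
pose h2 (x s : E) : R := dotrv (v x) s * expR (dotrv x s).
pose h (x s : E) : R := p * h1 x s + q * h2 x s.
have mfst (g : E -> R) : continuous g -> measurable_fun setT (fun z : T * T => g (tuple_rV z.1)).
  by move=> cg; apply: (measurableT_comp (measurable_continuous_tuple cg)); exact: measurable_fst.
have mhat i : measurable_fun setT (fun z : T * T => hat z.2 0 i).
  by apply: (measurableT_comp (measurable_hat i)); exact: measurable_snd.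
have mdot (w : E -> E) : (forall i, continuous (fun x => w x 0 i)) ->
    measurable_fun setT (fun z : T * T => dotrv (w (tuple_rV z.1)) (hat z.2)).
  by move=> cw; apply: measurable_sum => i; apply: measurable_funM => //; exact: (mfst (fun x => w x 0 i)).
have mexp : measurable_fun setT (fun z : T * T => expR (dotrv (tuple_rV z.1) (hat z.2))).
  by apply: measurableT_comp => //; apply: (mdot id) => i x; exact: coord_continuous.
have m1 : measurable_fun setT (fun z : T * T => h1 (tuple_rV z.1) (hat z.2)).
  by apply: measurable_funM => //; exact: mfst.
have m2 : measurable_fun setT (fun z : T * T => h2 (tuple_rV z.1) (hat z.2)).
  by apply: measurable_funM => //; exact: mdot.
have mh : measurable_fun setT (fun z : T * T => h (tuple_rV z.1) (hat z.2)).
  by apply: measurable_funD; apply: measurable_funM => //; exact: measurable_cst.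
have cexp : continuous (fun x : E => expR (enorm x)).
  by apply: (continuous_comp_real (@continuous_expR R)); exact: continuous_enorm.
have bH1 : bcs (fun x : E => `|f x| * expR (enorm x)).
  apply: (bcs_continuous (K := K)); last by move=> x Kx; rewrite f0// normr0 mul0r.
  apply: continuousM2 => //; apply: (continuous_comp_real (h := fun y : R => `|y|)) => //.
  exact: norm_continuous.
have bH2 : bcs (fun x : E => enorm (v x) * expR (enorm x)).
  apply: (bcs_continuous (K := K)); last first.
    by move=> x Kx; rewrite v0// /enorm /dotrv big1 ?sqrtr0 ?mul0r// => i _; rewrite mxE mul0r.
  apply: continuousM2 => //; apply: (continuous_comp_real (@sqrt_continuous R)).
  by apply: continuous_sum => i; exact: continuousM2.
have ele (x s : E) : enorm s <= 1 -> expR (dotrv x s) <= expR (enorm x).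
  by move=> s1; rewrite ler_expR; apply: le_trans (dotrv_le _ _) _; rewrite ler_piMr ?enorm_ge0.
have le1 x s : enorm s <= 1 -> `|h1 x s| <= `|f x| * expR (enorm x).
  by move=> s1; rewrite normrM (ger0_norm (expR_ge0 _)) ler_wpM2l// ele.
have le2 x s : enorm s <= 1 -> `|h2 x s| <= enorm (v x) * expR (enorm x).
  move=> s1; rewrite normrM (ger0_norm (expR_ge0 _)) ler_pM// ?expR_ge0 ?ele//.
  have le3 (w : E) : dotrv w s <= enorm w.
    by apply: le_trans (dotrv_le _ _) _; rewrite ler_piMr ?enorm_ge0.
  by rewrite ler_norml lerNl -dotrvNl -[enorm (v x)]enormN le3 enormN le3.
have bH : bcs (fun x => `|p| * (`|f x| * expR (enorm x)) + `|q| * (enorm (v x) * expR (enorm x))).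
  by apply: bcsD; exact: bcsZ.
have leh x s : enorm s <= 1 ->
    `|h x s| <= `|p| * (`|f x| * expR (enorm x)) + `|q| * (enorm (v x) * expR (enorm x)).
  move=> s1; apply: le_trans (ler_normD _ _) _; rewrite !normrM.
  by apply: lerD; rewrite ler_wpM2l//; [rewrite -normrM; exact: le1|rewrite -normrM; exact: le2].
have [i1 _] := sphere_kernel bH1 m1 le1.
have [i2 _] := sphere_kernel bH2 m2 le2.
have [ih] := sphere_kernel bH mh leh.
have bcs1 s : bcs (h1^~ s).
  apply: (bcs_continuous (K := K)); last by move=> x Kx; rewrite /h1 f0// mul0r.
  apply: continuousM2 => //; apply: (continuous_comp_real (@continuous_expR R)).
  exact: continuous_dotrvl.
have bcs2 s : bcs (h2^~ s).
  apply: (bcs_continuous (K := K)); last first.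
    by move=> x Kx; rewrite /h2 v0// /dotrv big1 ?mul0r// => i _; rewrite mxE mul0r.
  apply: continuousM2; last first.
    by apply: (continuous_comp_real (@continuous_expR R)); exact: continuous_dotrvl.
  by apply: continuous_sum => i; apply: continuousM2 => // x; exact: cst_continuous.
have hs s : enorm s = 1 -> integral_Rn setT (h^~ s) <= 0.
  move=> s1; rewrite leNgt; apply/negP => Hs; apply: nos; exists s => //.
  by rewrite -(integral_RnZ p (bcs1 s)) -(integral_RnZ q (bcs2 s)) -integral_RnD//; exact: bcsZ.
move=> /(_ hs) nonpos.
pose J (g : E -> E -> R) x := \int[tm n]_(t in B) g x (hat t).
have inth (g : E -> E -> R) (M : E -> R) x : measurable_fun setT (fun z : T * T => g (tuple_rV z.1) (hat z.2)) ->
    (forall x s, enorm s <= 1 -> `|g x s| <= M x) -> (tm n).-integrable B (EFin \o (fun t => g x (hat t))).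
  move=> mg gM; apply: measurable_bounded_integrable => //.
  - exact: measurable_punctured_ball.
  - exact: punctured_ball_lty.
  - apply: measurable_funTS; pose tx : T := [tuple x 0 i | i < n].
    have xE : x = tuple_rV tx by apply/rowP => i; rewrite mxE tnth_mktuple.
    by rewrite xE; apply: (measurableT_comp mg (pair1_measurable tx)).
  - exists (M x); split; first exact: num_real.
    by move=> y My t _; apply: le_trans (ltW My); apply: gM; exact: enorm_hat_le.
have mB : measurable B by exact: measurable_punctured_ball.
have JD x : J h x = p * J h1 x + q * J h2 x.
  have j1 := inth h1 _ x m1 le1; have j2 := inth h2 _ x m2 le2.
  rewrite /J -(RintegralZl p mB j1) -(RintegralZl q mB j2).
  by rewrite -(RintegralD mB (integrableZl mB p j1) (integrableZl mB q j2)).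
have e1 x : f x * phi x = c0 * J h1 x.
  rewrite phi_sphereE mulrCA /J; congr (_ * _); rewrite -(RintegralZl _ mB)//.
  apply: (inth (fun x s => expR (dotrv x s)) (fun x => expR (enorm x))) => // y s s1.
  by rewrite ger0_norm ?expR_ge0// ele.
have e2 x : dotrv (v x) (gradient (@phi R n) x) = c0 * J h2 x.
  have int2 i : (tm n).-integrable B (EFin \o (fun t => hat t 0 i * expR (dotrv x (hat t)))).
    apply: (inth (fun x s => s 0 i * expR (dotrv x s)) (fun x => expR (enorm x))).
      exact: measurable_funM.
    move=> y s s1; rewrite normrM (ger0_norm (expR_ge0 _)) -[leRHS]mul1r ler_pM ?expR_ge0 ?ele//.
    exact: le_trans (ler_coord_enorm _ _) s1.
  have sumE (k : seq 'I_n) : \sum_(i <- k) v x 0 i * \int[tm n]_(t in B) (hat t 0 i * expR (dotrv x (hat t))) =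
      \int[tm n]_(t in B) \sum_(i <- k) v x 0 i * (hat t 0 i * expR (dotrv x (hat t))) /\
      (tm n).-integrable B (EFin \o (fun t => \sum_(i <- k) v x 0 i * (hat t 0 i * expR (dotrv x (hat t))))).
    elim: k => [|i k [IH1 IH2]].
      rewrite big_nil (_ : (fun t => _) = fun=> 0); last by apply/funext => t; rewrite big_nil.
      rewrite (_ : EFin \o _ = cst 0%E)//; split; last exact: integrable0.
      by rewrite /Rintegral integral0.
    have z1 : (tm n).-integrable B (EFin \o (fun t => v x 0 i * (hat t 0 i * expR (dotrv x (hat t))))).
      exact: (integrableZl mB _ (int2 i)).
    rewrite big_cons IH1 (_ : (fun t => _) = fun t => v x 0 i * (hat t 0 i * expR (dotrv x (hat t))) +
      \sum_(i <- k) v x 0 i * (hat t 0 i * expR (dotrv x (hat t)))); last first.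
      by apply/funext => t; rewrite big_cons.
    split; last exact: (integrableD mB z1 IH2).
    by rewrite (RintegralD mB z1 IH2) (RintegralZl _ mB (int2 i)).
  rewrite {1}/dotrv (eq_bigr (fun i => c0 * (v x 0 i * \int[tm n]_(t in B) (hat t 0 i * expR (dotrv x (hat t)))))); last first.
    by move=> i _; rewrite mxE partial_phiE mulrCA.
  rewrite -mulr_sumr (sumE _).1 /J; congr (_ * _); apply: eq_Rintegral => t _.
  by rewrite /h2 /dotrv mulr_suml; apply: eq_bigr => i _; rewrite mulrA.
move: pos; rewrite (_ : (fun x => f x * phi x) = fun x => c0 * J h1 x); last exact/funext.
rewrite (_ : (fun x => dotrv _ _) = fun x => c0 * J h2 x); last exact/funext.
have -> : p * integral_Rn setT (fun x => c0 * J h1 x) + q * integral_Rn setT (fun x => c0 * J h2 x) =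
    c0 * integral_Rn setT (J h).
  have JE : J h = fun x => p * J h1 x + q * J h2 x by apply/funext.
  have iJ (g : E -> R) : (tm n).-integrable setT (EFin \o lift_tuple g) ->
      integral_Rn setT (fun x => c0 * g x) = c0 * integral_Rn setT g.
    by move=> ig; exact: (RintegralZl c0 measurableT ig).
  rewrite (iJ _ i1) (iJ _ i2) !integral_RnE JE.
  have z1 := integrableZl measurableT p i1; have z2 := integrableZl measurableT q i2.
  rewrite [X in _ = c0 * X](_ : _ = \int[tm n]_t (p * lift_tuple (J h1) t + q * lift_tuple (J h2) t))//.
  rewrite (RintegralD measurableT z1 z2) (RintegralZl p measurableT i1) (RintegralZl q measurableT i2).
  by rewrite mulrDr [p * (c0 * _)]mulrCA [q * (c0 * _)]mulrCA.
by apply/negP; rewrite -leNgt mulr_ge0_le0.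
Qed.

End PhiPlaneWaves.

Section PhiPlaneWaves1.
Context {R : realType}.
Notation E := 'rV[R]_1.

(** The sphere consists of the directions [1] and [-1], and [phi] is half the sum of their waves, so
    one of the two must be positive. *)
Lemma plane_wave_average_1 (f : E -> R) (v : E -> E) (K p q : R) :
  continuous f -> (forall x, K < `|x| -> f x = 0) ->
  (forall i, continuous (fun x => v x 0 i)) -> (forall x, K < `|x| -> v x = 0) ->
  0 < p * integral_Rn setT (fun x => f x * phi x) +
      q * integral_Rn setT (fun x => dotrv (v x) (gradient (@phi R 1) x)) ->
  exists2 s : E, enorm s = 1 &
    0 < p * integral_Rn setT (fun x => f x * expR (dotrv x s)) +
        q * integral_Rn setT (fun x => dotrv (v x) s * expR (dotrv x s)).
Proof.
move=> cf f0 cv v0 pos; apply: contrapT => nos.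
have dE (x s : E) : dotrv x s = x 0 0 * s 0 0 by rewrite /dotrv big_ord1.
have phiE (x : E) : phi x = (1 / 2) * expR (dotrv x (const_mx 1)) + (1 / 2) * expR (dotrv x (const_mx (-1))).
  by rewrite !dE !mxE mulr1 mulrN1 /phi; field.
have gE (x : E) : gradient (@phi R 1) x 0 0 =
   (1 / 2) * expR (dotrv x (const_mx 1)) + - (1 / 2) * expR (dotrv x (const_mx (-1))).
  rewrite mxE /partial.
  have H s := is_derive_plane_wave x (delta_mx 0 0) (const_mx s).
  have -> : @phi R 1 = fun y => (1 / 2) * expR (dotrv y (const_mx 1)) + (1 / 2) * expR (dotrv y (const_mx (-1))).
    exact/funext.
  have [_ ->] := is_derive_add (is_derive_scale (1 / 2) (H 1)) (is_derive_scale (1 / 2) (H (-1))).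
  by rewrite !dE !mxE !eqxx mulr1n; ring.
have es (s : R) : s ^+ 2 = 1 -> enorm (const_mx s : E) = 1.
  by move=> s2; rewrite /enorm dE mxE -expr2 s2 sqrtr1.
pose h1 (s : R) (x : E) := f x * expR (dotrv x (const_mx s)).
pose h2 (s : R) (x : E) := dotrv (v x) (const_mx s) * expR (dotrv x (const_mx s)).
have cexp s : continuous (fun x : E => expR (dotrv x s)).
  by apply: (continuous_comp_real (@continuous_expR R)); exact: continuous_dotrvl.
have b1 s : bcs (h1 s).
  apply: (bcs_continuous (K := K)); first exact: continuousM2.
  by move=> x Kx; rewrite /h1 f0// mul0r.
have b2 s : bcs (h2 s).
  apply: (bcs_continuous (K := K)).
    apply: continuousM2 => //; apply: continuous_sum => i.
    by apply: continuousM2 => // x; exact: cst_continuous.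
  by move=> x Kx; rewrite /h2 v0// dE mxE !mul0r.
have H (s : R) : s ^+ 2 = 1 -> p * integral_Rn setT (h1 s) + q * integral_Rn setT (h2 s) <= 0.
  by move=> s2; rewrite leNgt; apply/negP => Hs; apply: nos; exists (const_mx s) => //; exact: es.
have H1 := H 1 (expr1n _ _); have H2 := H (-1) (etrans (sqrrN 1) (expr1n _ _)).
move: pos; apply/negP; rewrite -leNgt.
rewrite (_ : (fun x => f x * phi x) = fun x => (1 / 2) * h1 1 x + (1 / 2) * h1 (-1) x); last first.
  by apply/funext => x; rewrite /h1 phiE; ring.
rewrite (_ : (fun x => dotrv _ _) = fun x => (1 / 2) * h2 1 x + (1 / 2) * h2 (-1) x); last first.
  by apply/funext => x; rewrite /h2 !(dE (v x)) gE !mxE; ring.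
rewrite (integral_RnD (bcsZ _ (b1 1)) (bcsZ _ (b1 (-1)))) (integral_RnD (bcsZ _ (b2 1)) (bcsZ _ (b2 (-1)))).
rewrite (integral_RnZ _ (b1 1)) (integral_RnZ _ (b1 (-1))) (integral_RnZ _ (b2 1)) (integral_RnZ _ (b2 (-1))).
move: H1 H2; move: (integral_Rn setT (h1 1)) (integral_Rn setT (h1 (-1))) (integral_Rn setT (h2 1)) (integral_Rn setT (h2 (-1))).
by clear => a1 a2 a3 a4; lra.
Qed.

End PhiPlaneWaves1.

(** * The pressure law *)

Section PositivePower.
Context {R : realType}.
Implicit Types (a r : R).

(* Extends r `^ a by 0 to negative r, where powR takes junk values, so that the
   pressure is C^1 on the whole line, vacuum included. *)
Definition ppow a r := (Num.max r 0) `^ a.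

Lemma ppow_ge0E a r : 0 <= r -> ppow a r = r `^ a.
Proof. by move=> r0; rewrite /ppow max_l. Qed.

Lemma ppow_le0 a r : a != 0 -> r <= 0 -> ppow a r = 0.
Proof. by move=> a0 r0; rewrite /ppow max_r// powR0. Qed.

Lemma ppow_ge0 a r : 0 <= ppow a r.
Proof. exact: powR_ge0. Qed.

Lemma ppowS a r : 0 <= r -> 0 < a -> r * ppow a r = ppow (a + 1) r.
Proof.
move=> r0 a0; rewrite !ppow_ge0E//.
have [->|rn] := eqVneq r 0; first by rewrite mul0r powR0// gt_eqF// addr_gt0.
by rewrite powRD ?powRr1 1?mulrC// rn implybT.
Qed.

Lemma ler_ppow a : 0 <= a -> {homo ppow a : x y / x <= y}.
Proof.
move=> a0 x y xy; apply: ge0_ler_powR => //; rewrite ?nnegrE ?le_max ?lexx ?orbT//.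
by rewrite !ge_max xy lexx andbT /=; case: (leP 0 y) => //= y0; rewrite (le_trans xy) ?(ltW y0).
Qed.

Lemma continuous_ppow a : 0 < a -> continuous (ppow a).
Proof.
move=> a0 r; have [r0|r0|->] := ltgtP r 0.
- apply: (@near_cst_continuous _ _ 0) => //.
  near=> y; apply: ppow_le0; first by rewrite gt_eqF.
  apply/ltW; near: y; exact: lt_nbhsl.
- have H : {for r, continuous (fun y => y `^ a)}.
    by apply: is_derive_continuous (is_derive1_powR a r0).
  rewrite /continuous_at ppow_ge0E ?ltW//.
  apply: cvg_trans H; apply: near_eq_cvg; near=> y.
  rewrite ppow_ge0E//; apply/ltW; near: y; exact: lt_nbhsr.
- apply/cvgrPdist_lt => e e0; rewrite ppow_ge0E// powR0 ?gt_eqF//.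
  have d0 : 0 < e `^ a^-1 by rewrite powR_gt0.
  near=> y; rewrite sub0r normrN ger0_norm ?ppow_ge0//.
  have [y0|y0] := leP y 0; first by rewrite ppow_le0// gt_eqF.
  rewrite ppow_ge0E ?ltW//.
  have -> : e = (e `^ a^-1) `^ a by rewrite -powRrM mulVf ?gt_eqF// powRr1// ltW.
  apply: gt0_ltr_powR; rewrite ?nnegrE ?powR_ge0 ?(ltW y0)//.
  near: y; exact: lt_nbhsl.
Unshelve. all: by end_near. Qed.

(** At vacuum the difference quotient of [ppow (a + 1)] is [ppow a], which is continuous and
    vanishes there. *)
Lemma is_derive_ppow a r : 0 < a -> is_derive r 1 (ppow (a + 1)) ((a + 1) * ppow a r).
Proof.
move=> a0; have a1 : 0 < a + 1 by rewrite addr_gt0.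
have [r0|r0|->] := ltgtP r 0.
- rewrite ppow_le0 ?mulr0 ?gt_eqF ?ltW//.
  apply: (near_eq_is_derive (f := cst 0)) => //.
  near=> y; rewrite ppow_le0 ?gt_eqF//; apply/ltW; near: y; exact: lt_nbhsl.
- rewrite ppow_ge0E ?ltW//.
  apply: (near_eq_is_derive (f := fun y => y `^ (a + 1))) => //.
    near=> y; rewrite ppow_ge0E//; apply/ltW; near: y; exact: lt_nbhsr.
  by apply: (is_derive_eq (is_derive1_powR (a + 1) r0)); rewrite addrK.
- rewrite ppow_le0 ?mulr0 ?gt_eqF//.
  have H : h^-1 *: (ppow (a + 1) (h *: (1 : R^o) + 0) - ppow (a + 1) 0) @[h --> 0^'] --> (0 : R).
    have e (h : R) : h != 0 -> h^-1 *: (ppow (a + 1) (h *: (1 : R^o) + 0) - ppow (a + 1) 0) = ppow a h.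
      move=> h0; rewrite [ppow _ 0]ppow_le0 ?gt_eqF// subr0 [h *: _]mulr1 addr0 /GRing.scale/=.
      have [hn|hp] := leP h 0; first by rewrite !ppow_le0 ?mulr0 ?gt_eqF.
      by rewrite -ppowS ?ltW// mulKf.
    have c0 : {for (0 : R), continuous (ppow a)} by exact: continuous_ppow.
    have p0 : ppow a 0 = 0 by rewrite ppow_le0// gt_eqF.
    move: c0; rewrite /prop_for /continuous_at p0 => c0.
    apply: cvg_trans (cvg_trans _ c0); last first.
      by apply: (@cvg_app _ _ _ _ (ppow a)); exact: nbhs_dnbhs.
    apply: near_eq_cvg; near=> h; rewrite e//; near: h; exact: nbhs_dnbhs_neq.
  split; first by apply/cvg_ex; exists 0.
  exact/cvg_lim.
Unshelve. all: by end_near. Qed.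


(** The derivative has the sign of [t - r0], so [r0] is a minimum. All inequalities below that are
    sharp at the reference density are proved this way. *)
Lemma sign_derive_ge0 (f df : R -> R) (r0 r : R) : f r0 = 0 ->
  (forall t, Num.min r0 r <= t <= Num.max r0 r -> {for t, continuous f}) ->
  (forall t, Num.min r0 r < t < Num.max r0 r -> is_derive t 1 f (df t)) ->
  (forall t, Num.min r0 r < t < Num.max r0 r -> 0 <= (t - r0) * df t) -> 0 <= f r.
Proof.
move=> f0; have [rr|rr] := leP r0 r => cf dff df0.
- rewrite -f0; apply: (derive_ge0_le (df := df)) => // t tr.
  have := df0 t tr; rewrite pmulr_rge0// subr_gt0; by case/andP: tr.
- rewrite -lerN2 oppr0 -[leRHS]oppr0 -f0.
  apply: (derive_ge0_le (f := fun t => - f t) (df := fun t => - df t) (ltW rr)) => t tr.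
  + exact/continuousN/cf.
  + by apply: is_deriveN; exact: dff.
  + have := df0 t tr; rewrite -mulrNN pmulr_rge0// oppr_gt0 subr_lt0; by case/andP: tr.
Qed.

End PositivePower.

Section PressureGap.
Context {R : realType}.
Variables (A a rb : R).
Hypotheses (A0 : 0 < A) (a0 : 0 < a) (rb0 : 0 < rb).
Implicit Types (r t : R).

(* The gap is the relative internal energy times a = gamma - 1; kappa is the enthalpy
   relative to that of the reference density. *)
Definition gap r := A * (ppow (a + 1) r - ppow (a + 1) rb - (a + 1) * ppow a rb * (r - rb)).

Definition kappa r := A * (a + 1) / a * (ppow a r - ppow a rb).

Lemma gap_rb : gap rb = 0.
Proof. by rewrite /gap !subrr mulr0 subr0 mulr0. Qed.

Lemma is_derive_gap r : is_derive r 1 gap (a * kappa r).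
Proof.
have H := is_derive_sub (is_derive_sub (is_derive_ppow r a0) (is_derive_cst (ppow (a + 1) rb) r 1))
  (is_derive_scale ((a + 1) * ppow a rb) (is_derive_sub (is_derive_id r 1) (is_derive_cst rb r 1))).
apply: (is_derive_eq (is_derive_scale A H)); rewrite /kappa; field.
by rewrite gt_eqF.
Qed.

Lemma continuous_gap : continuous gap.
Proof. by move=> r; exact: is_derive_continuous (is_derive_gap r). Qed.

Lemma continuous_kappa : continuous kappa.
Proof.
move=> r; apply: (@continuousM _ _ (cst _) (fun r => ppow a r - ppow a rb)); first exact: cst_continuous.
apply: continuousB; [exact: continuous_ppow|exact: cst_continuous].
Qed.

Lemma is_derive_kappa r : 0 < r -> is_derive r 1 kappa (A * (a + 1) * ppow a r / r).
Proof.
move=> r0; have H : is_derive r 1 (ppow a) (a * ppow a r / r).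
  apply: (near_eq_is_derive (f := fun y => y `^ a)).
    by near=> y; rewrite ppow_ge0E//; apply/ltW; near: y; exact: lt_nbhsr.
  apply: (is_derive_eq (is_derive1_powR a r0)).
  rewrite ppow_ge0E ?(ltW r0)// -mulrA; congr (_ * _).
  by rewrite powRB ?powRr1 ?(ltW r0)// ?(gt_eqF r0)// implybT.
apply: (is_derive_eq (is_derive_scale (A * (a + 1) / a) (is_derive_sub H (is_derive_cst (ppow a rb) r 1)))).
by field; rewrite !gt_eqF.
Unshelve. all: by end_near. Qed.

(** Write [r^a = rb^a exp (a ln (r / rb))] and use [exp y >= 1 + y] with
    [ln (r / rb) >= 1 - rb / r]. *)
Lemma ppow_gap_ge r : rb <= r -> ppow a rb * a * (r - rb) / r <= ppow a r - ppow a rb.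
Proof.
move=> rr; have r0 : 0 < r by exact: lt_le_trans rr.
have pw : ppow a r = ppow a rb * expR (a * ln (r / rb)).
  rewrite !ppow_ge0E ?(ltW r0) ?(ltW rb0)// {1}(_ : r = rb * (r / rb)); last first.
    by rewrite mulrC divfK// gt_eqF.
  by rewrite powRM ?(ltW rb0) ?divr_ge0 ?(ltW r0) ?(ltW rb0)// /powR (gt_eqF (divr_gt0 r0 rb0)).
have l1 : 1 - rb / r <= ln (r / rb).
  have := @le_ln1Dx R (rb / r - 1).
  rewrite subrKC => H; rewrite -(invrK (r / rb)) lnV ?posrE ?invr_gt0 ?divr_gt0// invf_div.
  rewrite -[leLHS]opprK lerN2 opprB; apply: H.
  by rewrite ltrBDr addrC subrr divr_gt0.
have l2 := expR_ge1Dx (a * ln (r / rb)).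
have -> : ppow a r - ppow a rb = ppow a rb * (expR (a * ln (r / rb)) - 1) by rewrite pw mulrBr mulr1.
rewrite -!mulrA ler_wpM2l ?ppow_ge0//.
rewrite lerBrDl; apply: le_trans l2; rewrite lerD2l ler_wpM2l ?(ltW a0)//.
by rewrite mulrBl divff ?gt_eqF.
Qed.

(** With [v = (rb - r) / rb] in [[0, 1]], one has [(1 - v)^a <= exp (- a v) <= 1 / (1 + a v) <= 1 -
    a v / (1 + a)]. Vacuum is treated apart, where the logarithm is meaningless. *)
Lemma ppow_gap_le r : 0 <= r <= rb ->
  ppow a rb * (a / (1 + a)) * (rb - r) / rb <= ppow a rb - ppow a r.
Proof.
move=> /andP[r0 rr]; have a1 : 0 < 1 + a by rewrite addr_gt0.
have v1 : a / (1 + a) * ((rb - r) / rb) <= 1.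
  rewrite mulr_ile1 ?divr_ge0 ?subr_ge0 ?(ltW a0) ?(ltW rb0) ?(ltW a1)//.
    by rewrite ler_pdivrMr// mul1r lerDr.
  by rewrite ler_pdivrMr// mul1r lerBlDr lerDl.
have [->|rn] := eqVneq r 0.
  rewrite [ppow a 0]ppow_le0 ?gt_eqF// !subr0 -mulrA divff ?gt_eqF// mulr1.
  by rewrite ler_piMr ?ppow_ge0// ler_pdivrMr// mul1r lerDr.
have rp : 0 < r by rewrite lt_neqAle eq_sym rn.
have pw : ppow a r = ppow a rb * expR (- (a * ln (rb / r))).
  rewrite !ppow_ge0E ?(ltW rp) ?(ltW rb0)// {1}(_ : r = rb * (r / rb)); last first.
    by rewrite mulrC divfK// gt_eqF.
  rewrite powRM ?(ltW rb0) ?divr_ge0 ?(ltW rp) ?(ltW rb0)// /powR (gt_eqF (divr_gt0 rp rb0)).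
  by rewrite -[r / rb]invf_div lnV ?posrE ?divr_gt0// mulrN.
pose v := (rb - r) / rb.
have v0 : 0 <= v by apply: divr_ge0; [rewrite subr_ge0|exact: ltW].
have l1 : v <= ln (rb / r).
  have := @le_ln1Dx R (r / rb - 1).
  rewrite subrKC => H; rewrite -(invrK (rb / r)) lnV ?posrE ?invr_gt0 ?divr_gt0// invf_div.
  rewrite -[leLHS]opprK lerN2 /v mulrBl divff ?gt_eqF// opprB; apply: H.
  by rewrite ltrBDr addrC subrr divr_gt0.
have l2 : expR (- (a * ln (rb / r))) <= (1 + a * v)^-1.
  rewrite expRN lef_pV2 ?posrE ?expR_gt0 ?ltr_wpDr ?(mulr_ge0 (ltW a0) v0)//.
  by apply: le_trans (expR_ge1Dx _); rewrite lerD2l ler_wpM2l ?(ltW a0).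
have -> : ppow a rb - ppow a r = ppow a rb * (1 - expR (- (a * ln (rb / r)))) by rewrite pw mulrBr mulr1.
rewrite -!mulrA ler_wpM2l ?ppow_ge0//.
rewrite -/v lerBrDl -lerBrDr; apply: le_trans l2 _.
have av : 0 < 1 + a * v by rewrite ltr_wpDr ?(mulr_ge0 (ltW a0) v0).
rewrite -div1r ler_pdivrMr//.
have vle : v <= 1 by rewrite ler_pdivrMr// mul1r lerBlDr lerDl.
have -> : (1 - a * ((1 + a)^-1 * v)) * (1 + a * v) = 1 + a * v * (a * (1 - v)) / (1 + a).
  by field; rewrite gt_eqF.
rewrite lerDl; apply: divr_ge0 (ltW a1); apply: mulr_ge0; apply: mulr_ge0 => //; rewrite ?subr_ge0 ?(ltW a0)//.
Qed.

(** The lower bound is quadratic near [rb] and linear at infinity, a growth available for every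
    exponent [a + 1 > 1]. Both sides vanish at [rb], and their derivatives are compared on each side
    of it. *)
Lemma gap_lower_bound : exists2 k : R, 0 < k &
  forall r, 0 <= r -> k * (r - rb) ^+ 2 / (r + rb) <= gap r.
Proof.
have a1 : 0 < 1 + a by rewrite addr_gt0.
pose B := A * (a + 1) * ppow a rb.
have P0 : 0 < ppow a rb by rewrite ppow_ge0E ?(ltW rb0)// powR_gt0.
have B0 : 0 < B by rewrite !mulr_gt0// addr_gt0.
(* The derivative of [(t - rb)^2 / (t + rb)] is [(t - rb) (t + 3 rb) / (t + rb)^2]; its last factor
   is at most [3 / rb] below [rb], whence the 3, and at most [2 / t] above. *)
pose k := B * (a / (1 + a)) / 3.
have k0 : 0 < k by apply: divr_gt0 => //; apply: mulr_gt0 => //; exact: divr_gt0.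
exists k => // r r0; rewrite -subr_ge0.
have pos t : Num.min rb r <= t -> 0 <= t.
  by apply: le_trans; rewrite le_min r0 (ltW rb0).
have D t : 0 <= t -> is_derive t 1 (fun r => gap r - k * (r - rb) ^+ 2 / (r + rb))
    (a * kappa t - k * (t - rb) * (t + 3 * rb) / (t + rb) ^+ 2).
  move=> t0; have tr : t + rb != 0 by rewrite gt_eqF// ltr_wpDl.
  have Hs := is_derive_scale k (is_derive_sqr (is_derive_sub (is_derive_id t 1) (is_derive_cst rb t 1))).
  have Hi := is_derive_inv (f := fun t => t + rb) tr (is_derive_add (f := id) (g := cst rb) (is_derive_id t 1) (is_derive_cst rb t 1)).
  apply: (is_derive_eq (is_derive_sub (is_derive_gap t) (is_derive_mul Hs Hi))).
  by rewrite /cst; field.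
apply: (sign_derive_ge0 (f := fun r => gap r - k * (r - rb) ^+ 2 / (r + rb)) (r0 := rb)
  (df := fun t => a * kappa t - k * (t - rb) * (t + 3 * rb) / (t + rb) ^+ 2)).
- by rewrite gap_rb subrr expr0n/= mulr0 mul0r subr0.
- by move=> t /andP[t1 _]; apply: is_derive_continuous (D t _); exact: pos.
- by move=> t /andP[t1 _]; apply/D/pos/ltW.
move=> t /andP[t1 _]; have {t1}t0 := pos _ (ltW t1).
have tr : 0 < t + rb by rewrite ltr_wpDl.
have -> : (t - rb) * (a * kappa t - k * (t - rb) * (t + 3 * rb) / (t + rb) ^+ 2) =
    A * (a + 1) * ((t - rb) * (ppow a t - ppow a rb)) - k * (t - rb) ^+ 2 * ((t + 3 * rb) / (t + rb) ^+ 2).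
  by rewrite /kappa; field; rewrite !gt_eqF.
have [tb|tb] := leP rb t.
- have tp : 0 < t by exact: lt_le_trans tb.
  have H1 : (t + 3 * rb) / (t + rb) ^+ 2 <= 2 / t.
    rewrite ler_pdivrMr ?exprn_gt0// mulrAC ler_pdivlMr//.
    have : 0 <= t * rb by rewrite mulr_ge0 ?(ltW rb0).
    have := sqr_ge0 t; have := sqr_ge0 rb; rewrite !expr2; nra.
  have H2 := ppow_gap_ge tb.
  rewrite subr_ge0; apply: (@le_trans _ _ (k * (t - rb) ^+ 2 * (2 / t))).
    by rewrite ler_wpM2l// mulr_ge0 ?sqr_ge0 ?(ltW k0).
  apply: (@le_trans _ _ (A * (a + 1) * ((t - rb) * (ppow a rb * a * (t - rb) / t)))); last first.
    by rewrite ler_wpM2l ?(ltW (mulr_gt0 _ _)) ?addr_gt0// ler_wpM2l ?subr_ge0.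
  have -> : A * (a + 1) * ((t - rb) * (ppow a rb * a * (t - rb) / t)) = B * a / 2 * (t - rb) ^+ 2 * (2 / t).
    by rewrite /B; field; rewrite gt_eqF.
  rewrite ler_wpM2r ?divr_ge0// ler_wpM2r ?sqr_ge0//.
  rewrite (_ : k = B * a * ((1 + a) * 3)^-1); last by rewrite /k invfM !mulrA.
  rewrite ler_wpM2l ?(ltW (mulr_gt0 B0 a0))// lef_pV2 ?posrE ?(mulr_gt0 a1)//; move: (a0); lra.
- have H1 : (t + 3 * rb) / (t + rb) ^+ 2 <= 3 / rb.
    rewrite ler_pdivrMr ?exprn_gt0// mulrAC ler_pdivlMr//.
    have : 0 <= t * rb by rewrite mulr_ge0 ?(ltW rb0).
    have := sqr_ge0 t; have := sqr_ge0 rb; rewrite !expr2; nra.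
  have H2 : ppow a rb * (a / (1 + a)) * (rb - t) / rb <= ppow a rb - ppow a t.
    by apply: ppow_gap_le; rewrite t0 ltW.
  rewrite subr_ge0; apply: (@le_trans _ _ (k * (t - rb) ^+ 2 * (3 / rb))).
    by rewrite ler_wpM2l// mulr_ge0 ?sqr_ge0 ?(ltW k0).
  have -> : k * (t - rb) ^+ 2 * (3 / rb) =
      A * (a + 1) * ((rb - t) * (ppow a rb * (a / (1 + a)) * (rb - t) / rb)).
    by rewrite /k /B; field; rewrite !gt_eqF.
  have -> : (t - rb) * (ppow a t - ppow a rb) = (rb - t) * (ppow a rb - ppow a t) by ring.
  by rewrite ler_wpM2l ?(ltW (mulr_gt0 _ _)) ?addr_gt0// ler_wpM2l ?subr_ge0 ?(ltW tb).
Qed.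

Lemma kappa_sign r : 0 <= r -> 0 <= (r - rb) * kappa r.
Proof.
move=> r0; have h : 0 <= A * (a + 1) / a by rewrite divr_ge0 ?mulr_ge0 ?addr_ge0 ?(ltW A0) ?(ltW a0).
rewrite /kappa mulrCA; apply: mulr_ge0 => //.
have [rr|rr] := leP rb r.
  by apply: mulr_ge0; rewrite subr_ge0// ler_ppow// ltW.
have h1 : ppow a r - ppow a rb <= 0 by rewrite subr_le0 ler_ppow ?ltW.
by rewrite mulr_le0// subr_le0 ltW.
Qed.

Lemma gap_ge0 r : 0 <= r -> 0 <= gap r.
Proof.
move=> r0; have [k k0 H] := gap_lower_bound.
apply: le_trans (H r r0); apply: divr_ge0; last by rewrite addr_ge0 ?(ltW rb0).
exact: (mulr_ge0 (ltW k0) (sqr_ge0 _)).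
Qed.

Lemma gap_eq0 r : 0 <= r -> gap r = 0 -> r = rb.
Proof.
move=> r0 g0; have [k k0 H] := gap_lower_bound; have := H r r0.
rewrite g0 => {}H; apply/eqP; rewrite -subr_eq0 -sqrf_eq0 eq_le sqr_ge0 andbT.
move: H; rewrite ler_pdivrMr ?ltr_wpDl// mul0r pmulr_rle0//.
Qed.

(* The characteristic speed at (rb, 0) is c, so the entropy flux of a nearly constant
   state travels at a speed close to c. *)
Lemma entropy_flux_le (c : R) : 0 < c -> A * (a + 1) * ppow a rb < c ^+ 2 ->
  exists2 d, 0 < d & forall r U, 0 <= r -> `|r - rb| <= d -> 0 <= U <= d ->
    (r * U ^+ 2 / 2 + r * `|kappa r|) * U <= c * (r * U ^+ 2 / 2 + gap r / a).
Proof.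
move=> c0 cc; pose c2 := A * (a + 1) * ppow a rb.
have c20 : 0 <= c2 by rewrite !mulr_ge0 ?ppow_ge0 ?addr_ge0 ?(ltW a0) ?(ltW A0).
have sc : Num.sqrt c2 < c by rewrite -(ltr_pXn2r (n := 2)) ?nnegrE ?sqrtr_ge0 ?(ltW c0)// sqr_sqrtr.
(* A speed strictly between the sound speed [sqrt c2] and [c]: the pressure work is absorbed with
   [e], and [c - e] remains for the transport of kinetic energy. *)
pose e := (Num.sqrt c2 + c) / 2.
have e0 : 0 < e by rewrite divr_gt0// ltr_wpDl ?sqrtr_ge0.
have ec : e < c by rewrite /e; move: sc; lra.
have e2 : c2 < e ^+ 2.
  rewrite -[ltLHS](sqr_sqrtr c20) ltr_pXn2r ?nnegrE ?sqrtr_ge0 ?(ltW e0)//.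
  by rewrite /e; move: sc; lra.
have [d1 d10 Hd1] : exists2 d, 0 < d & forall r, `|r - rb| <= d -> 0 <= 2 * e ^+ 2 - 2 * c2 - (1 + 2 * a) * kappa r.
  have cg : {for rb, continuous (fun r => 2 * e ^+ 2 - 2 * c2 - (1 + 2 * a) * kappa r)}.
    apply: continuousB; first exact: cst_continuous.
    by apply: continuousM; [exact: cst_continuous|exact: continuous_kappa].
  have k0 : kappa rb = 0 by rewrite /kappa subrr mulr0.
  have g0 : 0 < 2 * e ^+ 2 - 2 * c2 - (1 + 2 * a) * kappa rb.
    by rewrite k0 mulr0 subr0 subr_gt0 ltr_pM2l.
  have /nbhs_ballP[d /= d0 Hd] : \forall r \near rb, 0 < 2 * e ^+ 2 - 2 * c2 - (1 + 2 * a) * kappa r.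
    by apply: (cg [set y | 0 < y]); exact: lt_nbhsr.
  exists (d / 2); first by rewrite divr_gt0.
  move=> r rd; apply/ltW/Hd; rewrite /ball/= distrC; apply: le_lt_trans rd _.
  by rewrite ltr_pdivrMr// ltr_pMr// ltr1n.
(* [d1] keeps the derivative in [key] of one sign, [c - e] bounds the velocity, and [rb / 2] stays
   away from vacuum, where [kappa] may fail to be differentiable. *)
pose d := Num.min (Num.min d1 (c - e)) (rb / 2).
have d0 : 0 < d by rewrite !lt_min d10 subr_gt0 ec divr_gt0.
(* Locally [r kappa^2] is at most twice [e^2] times the relative internal energy. The difference has
   derivative [kappa] times a factor tending to [2 (e^2 - c2) > 0] at [rb]. *)
have key r : `|r - rb| <= d -> r * kappa r ^+ 2 <= 2 * e ^+ 2 * (gap r / a).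
  rewrite !le_min -andbA => /and3P[rd1 _ rd2]; rewrite -subr_ge0.
  have loc t : Num.min rb r <= t <= Num.max rb r -> 0 < t /\ `|t - rb| <= d1.
    move: rd1 rd2; rewrite !ler_distl => rd1 rd2.
    move=> tt; have t2 : rb / 2 <= t.
      case/andP: tt => + _; apply: le_trans.
      rewrite le_min; move: rd2 rb0; move=> *; apply/andP; split; lra.
    split; first by rewrite (lt_le_trans _ t2)// divr_gt0.
    case/andP: tt => ta tb; apply/andP; split.
      apply: le_trans ta; rewrite le_min; move: rd1 d10; move=> *; apply/andP; split; lra.
    apply: (le_trans tb); rewrite ge_max; move: rd1 d10; move=> *; apply/andP; split; lra.
  have D t : 0 < t -> is_derive t 1 (fun r => 2 * e ^+ 2 * (gap r / a) - r * kappa r ^+ 2)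
      (kappa t * (2 * e ^+ 2 - 2 * c2 - (1 + 2 * a) * kappa t)).
    move=> t0; have Hg := is_derive_scale (2 * e ^+ 2) (is_derive_mul (is_derive_gap t) (is_derive_cst a^-1 t 1)).
    have Hk := is_derive_mul (is_derive_id t 1) (is_derive_sqr (is_derive_kappa t0)).
    apply: (is_derive_eq (is_derive_sub Hg Hk)); rewrite /c2 /kappa /cst; field.
    by rewrite !gt_eqF.
  apply: (sign_derive_ge0 (f := fun r => 2 * e ^+ 2 * (gap r / a) - r * kappa r ^+ 2) (r0 := rb)
    (df := fun t => kappa t * (2 * e ^+ 2 - 2 * c2 - (1 + 2 * a) * kappa t))).
  - by rewrite gap_rb mul0r mulr0 /kappa subrr mulr0 expr0n/= mulr0 subrr.
  - by move=> t /loc[t0 _]; exact: is_derive_continuous (D t t0).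
  - by move=> t /andP[t1 t2]; apply: D; apply: (proj1 (loc t _)); rewrite !ltW.
  - move=> t /andP[t1 t2]; have [t0 td] : 0 < t /\ `|t - rb| <= d1 by apply: loc; rewrite !ltW.
    by rewrite mulrA mulr_ge0 ?Hd1// kappa_sign// ltW.
exists d => // r U r0 rd /andP[U0 Ud].
have kr := key r rd; have ge := gap_ge0 r0.
have Uc : U <= c - e by apply: le_trans Ud _; rewrite !ge_min lexx orbT.
have ga : 0 <= gap r / a by rewrite divr_ge0 ?(ltW a0).
pose g := gap r / a; pose K := `|kappa r|; rewrite -/g -/K in ga *.
have K0 : 0 <= K by exact: normr_ge0.
have {}kr : r * K ^+ 2 <= 2 * e ^+ 2 * g by rewrite real_normK ?num_real.
(* AM-GM : r K U <= e (r U^2 / 2) + r K^2 / (2 e) *)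
have am : r * K * U <= e * (r * U ^+ 2 / 2) + e * g.
  have h1 : 0 <= r * (e * U - K) ^+ 2 by rewrite mulr_ge0 ?sqr_ge0.
  rewrite -(ler_pM2l e0); move: h1 kr; rewrite !expr2; nra.
have fl : r * U ^+ 2 / 2 * U <= r * U ^+ 2 / 2 * (c - e).
  by rewrite ler_wpM2l// divr_ge0// mulr_ge0 ?sqr_ge0.
have gg : e * g <= c * g by rewrite ler_wpM2r ?(ltW ec).
move: am fl gg; rewrite mulrDl; lra.
Qed.

End PressureGap.

(** * C^1 functions of time and space *)

Section C1Fields.
Context {R : realType} {n : nat}.
Notation E := 'rV[R]_n.
Implicit Types (T t : R) (x : E).

(* C^1 functions on ]0, T[ x R^n with their derivatives; everything is extended
   continuously to all times, the value of fdt being meaningless outside of ]0, T[. *)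
Record c1field T := C1Field {
  fval :> R -> E -> R;
  fdt : R -> E -> R;
  fdx : 'I_n -> R -> E -> R;
  continuous_fval : continuous (fun z : R * E => fval z.1 z.2);
  continuous_fdt : continuous (fun z : R * E => fdt z.1 z.2);
  continuous_fdx : forall i, continuous (fun z : R * E => fdx i z.1 z.2);
  is_derive_fdt : forall t x, 0 < t < T -> is_derive t 1 (fun s => fval s x) (fdt t x);
  is_derive_fdx : forall i t x, is_derive x (delta_mx 0 i) (fval t) (fdx i t x) }.

Lemma continuous_time (h : R -> R) : continuous h -> continuous (fun z : R * E => h z.1).
Proof.
move=> ch z; apply: (@cvg_comp _ _ _ fst h _ (nbhs z.1)); [exact: cvg_fst|exact: ch].
Qed.

Lemma continuous_space (f : E -> R) : continuous f -> continuous (fun z : R * E => f z.2).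
Proof.
move=> cf z; apply: (@cvg_comp _ _ _ snd f _ (nbhs z.2)); [exact: cvg_snd|exact: cf].
Qed.

Section Algebra.
Variable T : R.
Implicit Types F G : c1field T.

(** These constructions are transparent: the values and derivatives of a composite field then unfold
    by computation to those given by the rules of calculus. *)
Definition c1add F G : c1field T.
Proof.
refine (@C1Field T (fun t x => F t x + G t x) (fun t x => fdt F t x + fdt G t x)
  (fun i t x => fdx F i t x + fdx G i t x) _ _ _ _ _).
- by apply: continuousD2; exact: continuous_fval.
- by apply: continuousD2; exact: continuous_fdt.
- by move=> i; apply: continuousD2; exact: continuous_fdx.
- by move=> t x tT; apply: is_derive_add; exact: is_derive_fdt.
- by move=> i t x; apply: is_derive_add; exact: is_derive_fdx.
Defined.

Definition c1mul F G : c1field T.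
Proof.
refine (@C1Field T (fun t x => F t x * G t x)
  (fun t x => fdt F t x * G t x + F t x * fdt G t x)
  (fun i t x => fdx F i t x * G t x + F t x * fdx G i t x) _ _ _ _ _).
- by apply: continuousM2; exact: continuous_fval.
- by apply: continuousD2; apply: continuousM2; solve [exact: continuous_fval|exact: continuous_fdt].
- by move=> i; apply: continuousD2; apply: continuousM2; solve [exact: continuous_fval|exact: continuous_fdx].
- by move=> t x tT; apply: is_derive_mul; exact: is_derive_fdt.
- by move=> i t x; apply: is_derive_mul; exact: is_derive_fdx.
Defined.

Definition c1sum m (F : 'I_m -> c1field T) : c1field T.
Proof.
refine (@C1Field T (fun t x => \sum_i F i t x) (fun t x => \sum_i fdt (F i) t x)
  (fun j t x => \sum_i fdx (F i) j t x) _ _ _ _ _).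
- by apply: continuous_sum => i; exact: continuous_fval.
- by apply: continuous_sum => i; exact: continuous_fdt.
- by move=> j; apply: continuous_sum => i; exact: continuous_fdx.
- by move=> t x tT; apply: is_derive_sumR => i; exact: is_derive_fdt.
- by move=> j t x; apply: is_derive_sumR => i; exact: is_derive_fdx.
Defined.

(** [h] has to be C^1 on the whole line, since the value of a field is unrestricted; [ppow] supplies
    such an extension of the pressure. *)
Definition c1comp (h dh : R -> R) (dhP : forall r : R, is_derive r 1 h (dh r))
  (cdh : continuous dh) F : c1field T.
Proof.
refine (@C1Field T (fun t x => h (F t x)) (fun t x => dh (F t x) * fdt F t x)
  (fun i t x => dh (F t x) * fdx F i t x) _ _ _ _ _).
- apply: continuous_comp_real; last exact: continuous_fval.
  by move=> r; exact: is_derive_continuous (dhP r).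
- apply: continuousM2; last exact: continuous_fdt.
  by apply: continuous_comp_real => //; exact: continuous_fval.
- move=> i; apply: continuousM2; last exact: continuous_fdx.
  by apply: continuous_comp_real => //; exact: continuous_fval.
- by move=> t x tT; apply: is_derive_compR => //; exact: is_derive_fdt.
- by move=> i t x; apply: is_derive_compR => //; exact: is_derive_fdx.
Defined.

Definition c1time (h dh : R -> R) (dhP : forall r : R, is_derive r 1 h (dh r))
  (cdh : continuous dh) : c1field T.
Proof.
refine (@C1Field T (fun t _ => h t) (fun t _ => dh t) (fun _ _ _ => 0) _ _ _ _ _).
- by apply: continuous_time => r; exact: is_derive_continuous (dhP r).
- exact: continuous_time.
- by move=> _ z; exact: cst_continuous.
Defined.

Definition c1space (f : E -> R) (df : 'I_n -> E -> R) (cf : continuous f)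
  (dfP : forall i x, is_derive x (delta_mx 0 i) f (df i x))
  (cdf : forall i, continuous (df i)) : c1field T.
Proof.
refine (@C1Field T (fun _ x => f x) (fun _ _ => 0) (fun i _ x => df i x) _ _ _ _ _).
- exact: continuous_space.
- by move=> z; exact: cst_continuous.
- by move=> i; exact: continuous_space.
- by move=> t x _; exact: is_derive_cst.
Defined.

Definition c1cst (k : R) : c1field T.
Proof.
refine (@C1Field T (fun _ _ => k) (fun _ _ => 0) (fun _ _ _ => 0) _ _ _ _ _).
- by move=> z; exact: cst_continuous.
- by move=> z; exact: cst_continuous.
- by move=> i z; exact: cst_continuous.
- by move=> t x _; exact: is_derive_cst.
Defined.

End Algebra.

Definition clamp T t : R := Num.max 0 (Num.min t T).

Lemma is_derive_unique (V : normedModType R) (f : V -> R) (y v : V) (a b : R) :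
  is_derive y v f a -> is_derive y v f b -> a = b.
Proof. by move=> [_ <-] [_ <-]. Qed.

Lemma clampE T t : 0 <= t <= T -> clamp T t = t.
Proof. by move=> /andP[t0 tT]; rewrite /clamp min_l// max_r. Qed.

Lemma clamp_itv T t : 0 <= T -> 0 <= clamp T t <= T.
Proof. by move=> T0; rewrite /clamp le_max lexx ge_max T0 ge_min lexx orbT. Qed.

Lemma continuous_clamp T : continuous (clamp T).
Proof.
move=> t; apply: (@continuous_max _ _ (fun=> 0) (fun t => Num.min t T)); first exact: cst_continuous.
by apply: (@continuous_min _ _ id (fun=> T)); [exact: cvg_id|exact: cst_continuous].
Qed.

Lemma clamp_near T t : 0 < t < T -> \forall s \near t, clamp T s = s.
Proof.
move=> /andP[t0 tT]; near=> s; rewrite clampE//; apply/andP; split; apply/ltW.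
  by near: s; exact: lt_nbhsr.
by near: s; exact: lt_nbhsl.
Unshelve. all: by end_near. Qed.

Lemma continuous_clamped T (F : R -> E -> R) : continuous (fun z : R * E => F z.1 z.2) ->
  continuous (fun z : R * E => F (clamp T z.1) z.2).
Proof.
move=> cF z; apply: (@cvg_comp _ _ _ (fun z : R * E => (clamp T z.1, z.2)) (fun z => F z.1 z.2)
  _ (nbhs (clamp T z.1, z.2))); last exact: (cF (clamp T z.1, z.2)).
apply: (@cvg_pair _ _ _ (nbhs z) (nbhs (clamp T z.1)) (nbhs z.2) _ _ _ (fun z : R * E => clamp T z.1) snd).
  exact: (@continuous_time (clamp T) (@continuous_clamp T)).
exact: cvg_snd.
Qed.

(* C1_slab only gives continuity within the slab; composition with clamp makes it global. *)
Lemma continuous_slab_clamped T (T' : \bar R) (F : R -> E -> R) : 0 <= T -> (T%:E < T')%E ->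
  {within slab T', continuous (fun z => F z.1 z.2)} ->
  continuous (fun z : R * E => F (clamp T z.1) z.2).
Proof.
move=> T0 TT' /subspace_continuousP cF z.
have sl (y : R * E) : slab T' (clamp T y.1, y.2).
  have /andP[c0 cT] := @clamp_itv T y.1 T0; split => //=.
  by apply: le_lt_trans TT'; rewrite lee_fin.
have := cF (clamp T z.1, z.2) (sl z).
apply: (@cvg_comp _ _ _ (fun z : R * E => (clamp T z.1, z.2)) (fun z => F z.1 z.2)
  _ (within (slab T') (nbhs (clamp T z.1, z.2)))).
have H : (clamp T y.1, y.2) @[y --> z] --> nbhs (clamp T z.1, z.2).
  apply: (@cvg_pair _ _ _ (nbhs z) (nbhs (clamp T z.1)) (nbhs z.2) _ _ _ (fun z : R * E => clamp T z.1) snd).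
    exact: (@continuous_time (clamp T) (@continuous_clamp T)).
  exact: cvg_snd.
move=> S /= HS; have := H _ HS; rewrite /= /nbhs/=.
by apply: filterS => y; apply; exact: sl.
Qed.

Lemma C1_slab_c1field T (T' : \bar R) (f : R -> E -> R) : 0 < T -> (T%:E < T')%E ->
  C1_slab T' f -> exists F : c1field T, forall t x, 0 <= t <= T -> F t x = f t x.
Proof.
move=> T0 TT' [ft [fx [dft dfx cf cft cfx]]]; have T0' := ltW T0.
have sl t x : slab T' (clamp T t, x).
  have /andP[c0 cT] := @clamp_itv T t T0'; split => //=.
  by apply: le_lt_trans TT'; rewrite lee_fin.
have dt t x : 0 < t < T -> is_derive t 1 (fun s => f (clamp T s) x) (ft (clamp T t) x).
  move=> tT; have /andP[t0 t1] := tT; have ct : clamp T t = t by rewrite clampE// !ltW.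
  apply: (near_eq_is_derive (f := fun s => f s x)).
    by apply: filterS (clamp_near tT) => s ->.
  have := dft t x; rewrite -{1}ct => /(_ (sl t x)) H; rewrite ct.
  (* For [t > 0] the restriction [0 <= t + h] holds for all small [h], so the quotient taken within
     the half-line is the ordinary one. *)
  have {}H : h^-1 *: (f (h *: (1 : R^o) + t) x - f t x) @[h --> 0^'] --> ft t x.
    move=> S /H HS; have {}HS : \forall h \near (0 : R)^', 0 <= t + h -> S (h^-1 * (f (t + h) x - f t x)) := HS.
    have n0 : \forall h \near (0 : R)^', 0 <= t + h.
      apply: nbhs_dnbhs; near=> h; rewrite -lerBlDl sub0r; apply/ltW; near: h.
      by apply: lt_nbhsr; rewrite oppr_lt0.
    have : \forall h \near (0 : R)^', S (h^-1 *: (f (h *: (1 : R^o) + t) x - f t x)).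
      apply: filterS2 HS n0 => h Sh h0.
      by rewrite [h *: 1]mulr1 [h + t]addrC; exact: Sh.
    exact.
  by split; [apply/cvg_ex; exists (ft t x)|exact/cvg_lim].
exists (@C1Field T (fun t x => f (clamp T t) x) (fun t x => ft (clamp T t) x)
  (fun i t x => fx i (clamp T t) x)
  (continuous_slab_clamped T0' TT' cf) (continuous_slab_clamped T0' TT' cft)
  (fun i => continuous_slab_clamped T0' TT' (cfx i)) dt (fun i t x => dfx i _ x (sl t x))).
by move=> t x tT /=; rewrite clampE.
Unshelve. all: by end_near. Qed.

Local Notation I := (integral_Rn setT).

Lemma c1_integral_dt T (F : c1field T) (K : R) : 0 < T ->
  (forall t x, 0 <= t <= T -> K < `|x| -> F t x = 0) ->
  continuous (fun t => I (F (clamp T t))) /\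
  forall t, 0 < t < T -> is_derive t 1 (fun s => I (F (clamp T s))) (I (fdt F t)).
Proof.
move=> T0 F0; split.
  apply: (@integral_Rn_continuous _ _ _ K).
    exact/continuous_clamped/continuous_fval.
  by move=> t x Kx; apply: F0 => //; exact/clamp_itv/ltW.
move=> t tT; apply: (near_eq_is_derive (f := fun s => I (F s))).
  by apply: filterS (clamp_near tT) => s ->.
apply: (@integral_Rn_derive _ _ _ _ 0 T K) => //.
- move=> s sT; apply: (bcs_continuous (K := K)).
    exact/continuous_slice/continuous_fval.
  by move=> x; apply: F0; case/andP: sT => ? ?; rewrite !ltW.
- by move=> s x sT; exact: is_derive_fdt.
- exact: continuous_fdt.
- move=> s x sT Kx; have D := is_derive_fdt F x sT.
  have D0 : is_derive s 1 (fun s => F s x) 0.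
    apply: (near_eq_is_derive (f := cst (0 : R))).
    near=> u; rewrite /= F0//; apply/andP; split; apply/ltW; near: u.
      by apply: lt_nbhsr; case/andP: sT.
    by apply: lt_nbhsl; case/andP: sT.
  exact: is_derive_unique D D0.
Unshelve. all: by end_near. Qed.

Lemma c1_dx0 T (F : c1field T) (K : R) t i : (forall x, K < `|x| -> F t x = 0) ->
  forall x, K < `|x| -> fdx F i t x = 0.
Proof.
move=> F0 x Kx; have D := is_derive_fdx F i t x.
have D0 : is_derive x (delta_mx 0 i) (F t) 0.
  apply: (near_eq_is_derive (f := cst (0 : R))).
  have /(_ (`|x|)) H := @lt_nbhsr R K; near=> u; rewrite /= F0//; near: u.
  exact: (@norm_continuous _ E x _ (H Kx)).
exact: is_derive_unique D D0.
Unshelve. all: by end_near. Qed.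

Lemma c1_integral_dx T (F : c1field T) (K : R) t i : (forall x, K < `|x| -> F t x = 0) ->
  I (fdx F i t) = 0.
Proof.
move=> F0; apply: (@integral_Rn_partial _ _ (F t) _ (delta_mx 0 i) K) => //.
- by move=> x; exact: is_derive_fdx.
- exact/continuous_slice/continuous_fval.
- exact/continuous_slice/continuous_fdx.
- exact: c1_dx0.
Qed.

End C1Fields.

(** * Relative entropy and finite speed of propagation *)

Section EntropyAlgebra.
Context {R : realType}.

(* p stands for r `^ a, ux j i for the derivative of u_j along the i-th axis. *)
Lemma entropy_algebra n (A a b r rt p p0 : R) (u ut rx : 'I_n -> R) (ux : 'I_n -> 'I_n -> R) :
  a != 0 ->
  let N := \sum_j u j * u j in
  let H := A * (a + 1) / a * (r * p - p0 * r) in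
  let dH := A * (a + 1) / a * ((a + 1) * p - p0) in
  rt + \sum_i (rx i * u i + r * ux i i) = 0 ->
  (forall j, rt * u j + r * ut j + \sum_i ((rx i * u i + r * ux i i) * u j + r * u i * ux j i) +
     A * ((a + 1) * p) * rx j + b * (r * u j) = 0) ->
  (rt * N + r * \sum_j (ut j * u j + u j * ut j)) / 2 + A * (a + 1) / a * (p - p0) * rt +
  \sum_i (((rx i * N + r * \sum_j (ux j i * u j + u j * ux j i)) / 2 + dH * rx i) * u i +
          (r * N / 2 + H) * ux i i) = - b * (r * N).
Proof.
move=> a0 N H dH mass mom.
pose D1 := \sum_i rx i * u i; pose D2 := \sum_i ux i i.
pose S := \sum_j u j * ut j; pose Q i := \sum_j u j * ux j i; pose W := \sum_i u i * Q i.
have eS : \sum_j (ut j * u j + u j * ut j) = 2 * S.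
  by rewrite mulr_sumr; apply: eq_bigr => j _; ring.
have eQ i : \sum_j (ux j i * u j + u j * ux j i) = 2 * Q i.
  by rewrite mulr_sumr; apply: eq_bigr => j _; ring.
have {}mass : rt + (D1 + r * D2) = 0.
  by rewrite -mass big_split/= -mulr_sumr.
have eW : W = \sum_j \sum_i u i * ux j i * u j.
  rewrite exchange_big/=; apply: eq_bigr => i _; rewrite mulr_sumr; apply: eq_bigr => j _; ring.
(* Momentum equation dotted with [u]: the convective terms assemble into the mass equation times
   [N], which vanishes, plus [r W]. *)
have mom' : (rt + (D1 + r * D2)) * N + r * S + r * W + A * ((a + 1) * p) * D1 + b * (r * N) = 0.
  have : \sum_j u j * (rt * u j + r * ut j + \sum_i ((rx i * u i + r * ux i i) * u j + r * u i * ux j i) +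
     A * ((a + 1) * p) * rx j + b * (r * u j)) = 0.
    by apply: big1 => j _; rewrite mom mulr0.
  move=> <-; rewrite /S eW /D1 [_ * N]mulr_sumr ![in LHS]mulr_sumr -!big_split/=; apply: eq_bigr => j _.
  have -> : \sum_i ((rx i * u i + r * ux i i) * u j + r * u i * ux j i) =
      (D1 + r * D2) * u j + r * \sum_i u i * ux j i.
    rewrite big_split/= -mulr_suml big_split/= -mulr_sumr; congr (_ + _).
    by rewrite mulr_sumr; apply: eq_bigr => i _; rewrite mulrA.
  have -> : r * \sum_i u i * ux j i * u j = u j * (r * \sum_i u i * ux j i).
    by rewrite -mulr_suml; ring.
  have -> : \sum_i (rx i * u i + r * ux i i) = D1 + r * D2 by rewrite big_split/= -mulr_sumr.
  by ring.
have eT : \sum_i (((rx i * N + r * \sum_j (ux j i * u j + u j * ux j i)) / 2 + dH * rx i) * u i +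
          (r * N / 2 + H) * ux i i) = (N / 2 + dH) * D1 + r * W + (r * N / 2 + H) * D2.
  rewrite !mulr_sumr -!big_split/=; by apply: eq_bigr => i _; rewrite eQ; field.
rewrite eS eT.
have m0 : rt + (D1 + r * D2) = 0 := mass.
rewrite m0 mul0r add0r in mom'.
have rtE : rt = - (D1 + r * D2) by apply/eqP; rewrite -subr_eq0 opprK m0.
have SE : r * S = - (r * W + A * ((a + 1) * p) * D1 + b * (r * N)).
  by apply/eqP; rewrite -subr_eq0 opprK -mom'; apply/eqP; ring.
have -> : (rt * N + r * (2 * S)) / 2 = rt * N / 2 + r * S by field.
rewrite SE rtE /H /dH; field; exact: a0.
Qed.

End EntropyAlgebra.

Lemma lipschitz_of_derive {R : realType} (f df : R -> R) (a b L : R) : a <= b ->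
  (forall t, a <= t <= b -> {for t, continuous f}) ->
  (forall t, a < t < b -> is_derive t 1 f (df t)) ->
  (forall t, a < t < b -> `|df t| <= L) -> `|f b - f a| <= L * (b - a).
Proof.
move=> ab cf dff dfL.
have side (k : R) : k = 1 \/ k = -1 -> k * (f b - f a) <= L * (b - a).
  move=> k1; suff : L * a - k * f a <= L * b - k * f b by lra.
  apply: (derive_ge0_le (f := fun t => L * t - k * f t) (df := fun t => L * 1 - k * df t) ab) => t tab.
  - apply: (@cvgB _ _ _ (nbhs t)); apply: (@cvgM _ _ (nbhs t)); rewrite ?[_ @ _]/=; try exact: cvg_cst; first exact: cvg_id.
    exact: cf.
  - have := dff t tab => D; exact: (is_derive_sub (is_derive_scale L (is_derive_id t 1)) (is_derive_scale k D)).
  - have := dfL t tab; rewrite ler_norml; case: k1 => -> /andP[]; lra.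
rewrite ler_norml; apply/andP; split.
  by have := side (-1) (or_intror erefl); lra.
by have := side 1 (or_introl erefl); lra.
Qed.

Lemma integral_Rn0 {R : realType} n : integral_Rn setT (fun _ : 'rV[R]_n => 0) = 0.
Proof.
rewrite -[RHS](mul0r (integral_Rn setT (fun _ : 'rV[R]_n => 0))) -(integral_RnZ _ (@bcs0 R n)).
by congr (integral_Rn _ _); apply/funext => y; rewrite mul0r.
Qed.

Lemma enorm_le_sum {R : realType} n (x : 'rV[R]_n) : enorm x <= \sum_i `|x 0 i|.
Proof.
rewrite enorm_le ?sumr_ge0// expr2 mulr_suml; apply: ler_sum => i _.
apply: le_trans (ler_norm _) _; rewrite normrM ler_wpM2l// (bigD1 i)//= lerDl.
by rewrite sumr_ge0.
Qed.

Section EulerFlow.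
Context {R : realType} {n : nat}.
Notation E := 'rV[R]_n.
Local Notation I := (integral_Rn setT).
Variables (T A a rb : R) (b : R -> R).
Hypotheses (T0 : 0 < T) (A0 : 0 < A) (a0 : 0 < a) (rb0 : 0 < rb).
Hypothesis b0 : forall t, 0 < t < T -> 0 <= b t.
Variables (r : @c1field R n T) (u : 'I_n -> @c1field R n T).
Hypothesis r0 : forall t x, 0 <= t <= T -> 0 <= r t x.

Lemma is_derive_pressure (s : R) : is_derive s 1 (fun s => A * ppow (a + 1) s) (A * ((a + 1) * ppow a s)).
Proof. by apply: is_derive_scale; exact: is_derive_ppow. Qed.

Lemma continuous_dpressure : continuous (fun s : R => A * ((a + 1) * ppow a s)).
Proof.
apply: continuousM2 => [s|]; first exact: cst_continuous.
by apply: continuousM2 => [s|]; [exact: cst_continuous|exact: continuous_ppow].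
Qed.

Definition c1pressure := c1comp is_derive_pressure continuous_dpressure r.

Hypothesis mass : forall t x, 0 < t < T ->
  fdt r t x + \sum_i fdx (c1mul r (u i)) i t x = 0.
Hypothesis momentum : forall j t x, 0 < t < T ->
  fdt (c1mul r (u j)) t x + \sum_i fdx (c1mul (c1mul r (u i)) (u j)) i t x +
  fdx c1pressure j t x + b t * (r t x * u j t x) = 0.

Lemma continuous_dgap : continuous (fun s => a * kappa A a rb s).
Proof. by apply: continuousM2 => [s|]; [exact: cst_continuous|exact: continuous_kappa]. Qed.

Definition c1gap := c1comp (is_derive_gap A rb a0) continuous_dgap r.

(** For [s >= 0] this function is [s kappa s]. In the present form it is C^1 at vacuum as well. *)
Lemma is_derive_enthalpy (s : R) :
  is_derive s 1 (fun s => A * (a + 1) / a * (ppow (a + 1) s - ppow a rb * s))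
    (A * (a + 1) / a * ((a + 1) * ppow a s - ppow a rb)).
Proof.
apply: is_derive_scale; apply: is_derive_sub; first exact: is_derive_ppow.
by apply: (is_derive_eq (is_derive_scale (ppow a rb) (is_derive_id s 1))); rewrite mulr1.
Qed.

Lemma continuous_denthalpy :
  continuous (fun s : R => A * (a + 1) / a * ((a + 1) * ppow a s - ppow a rb)).
Proof.
apply: continuousM2 => [s|]; first exact: cst_continuous.
apply: continuousD2 => [|s]; last exact: cst_continuous.
by apply: continuousM2 => [s|]; [exact: cst_continuous|exact: continuous_ppow].
Qed.

Definition speed2 := c1sum (fun j => c1mul (u j) (u j)).
Definition kinetic := c1mul (c1mul r speed2) (c1cst T (1 / 2)).
(** Energy relative to the rest state [(rb, 0)]: kinetic plus relative internal energy, nonnegative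
    and zero exactly at that state. *)
Definition entropy := c1add kinetic (c1mul (c1cst T a^-1) c1gap).
(** At nonnegative densities, this is the relative energy plus the pressure excess; the latter is
    the work done across a surface moving with the fluid. *)
Definition flux_density := c1add kinetic (c1comp is_derive_enthalpy continuous_denthalpy r).
Definition entropy_flux i := c1mul flux_density (u i).

Lemma entropy_identity t x : 0 < t < T ->
  fdt entropy t x + \sum_i fdx (entropy_flux i) i t x = - b t * (r t x * speed2 t x).
Proof.
move=> tT; have rt0 : 0 <= r t x by apply: r0; case/andP: tT => ? ?; rewrite !ltW.
have := @entropy_algebra R n A a (b t) (r t x) (fdt r t x) (ppow a (r t x)) (ppow a rb)
  (fun i => u i t x) (fun i => fdt (u i) t x) (fun i => fdx r i t x) (fun j i => fdx (u j) i t x) (lt0r_neq0 a0).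
move=> /= H; rewrite /= -H//; last first.
- by move=> j; have := momentum j x tT.
- exact: (mass x tT).
congr (_ + _); first by rewrite /kappa; field; exact: lt0r_neq0.
apply: eq_bigr => i _; rewrite -(ppowS rt0 a0); field; exact: lt0r_neq0.
Qed.

Let urow t x : E := \row_i u i t x.

Lemma speed2E t x : speed2 t x = enorm (urow t x) ^+ 2.
Proof. by rewrite sqr_enorm /=; apply: eq_bigr => i _; rewrite !mxE. Qed.

Lemma entropy_ge0 t x : 0 <= t <= T -> 0 <= entropy t x.
Proof.
move=> tT; rewrite /= addr_ge0//.
  by rewrite mulr_ge0// mulr_ge0 ?r0// sumr_ge0// => i _; rewrite -expr2 sqr_ge0.
by rewrite mulr_ge0 ?invr_ge0 ?(ltW a0)// gap_ge0// r0.
Qed.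

Lemma entropy_eq0 t x : 0 <= t <= T -> entropy t x = 0 -> r t x = rb /\ forall i, u i t x = 0.
Proof.
move=> tT; have rt := r0 x tT.
have k0 : 0 <= kinetic t x.
  by rewrite /= mulr_ge0// mulr_ge0// sumr_ge0// => i _; rewrite -expr2 sqr_ge0.
have g0 : 0 <= a^-1 * gap A a rb (r t x) by rewrite mulr_ge0 ?invr_ge0 ?(ltW a0)// gap_ge0.
move=> /eqP; rewrite [entropy t x]/= -/(kinetic t x) paddr_eq0// => /andP[/eqP kE].
rewrite mulf_eq0 invr_eq0 (gt_eqF a0)/= => /eqP gE.
have rE := gap_eq0 A0 a0 rb0 rt gE; split=> // i.
have {}kE : rb * (\sum_j u j t x * u j t x) * (1 / 2) = 0 by rewrite -{1}rE.
have /eqP : \sum_j u j t x * u j t x = 0.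
  apply: (@mulfI _ (rb * (1 / 2))); first by rewrite gt_eqF// mulr_gt0// divr_gt0.
  by rewrite mulr0 -[RHS]kE mulrAC.
rewrite psumr_eq0; last by move=> j _; rewrite -expr2 sqr_ge0.
by move=> /allP/(_ i (mem_index_enum i))/=; rewrite mulf_eq0 orbb => /eqP.
Qed.


Section Cone.
Variables (c d t2 : R) (x1 : E).
Hypotheses (c0 : 0 < c) (t20 : 0 < t2).
Hypothesis flux_le : forall s U, 0 <= s -> `|s - rb| <= d -> 0 <= U <= d ->
  (s * U ^+ 2 / 2 + s * `|kappa A a rb s|) * U <= c * (s * U ^+ 2 / 2 + gap A a rb s / a).

Lemma is_derive_cone_time (s : R) :
  is_derive s 1 (fun s => c ^+ 2 * (t2 - s) ^+ 2) (- 2 * c ^+ 2 * (t2 - s)).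
Proof.
apply: (is_derive_eq (is_derive_scale (c ^+ 2) (is_derive_sqr (is_derive_sub (is_derive_cst t2 s 1) (is_derive_id s 1))))).
by rewrite /cst; ring.
Qed.

Lemma continuous_affine_time (k : R) : continuous (fun s : R => k * (t2 - s)).
Proof.
apply: continuousM2 => [s|]; first exact: cst_continuous.
move=> s; apply: (@cvgB _ _ _ (nbhs s)); [exact: cvg_cst|exact: cvg_id].
Qed.

Lemma continuous_sqr_dist : continuous (fun y : E => - dotrv (y - x1) (y - x1)).
Proof.
move=> y; apply: (@cvgN _ _ _ (nbhs y)).
apply: (@cvg_comp _ _ _ (fun y => y - x1) (fun z => dotrv z z) _ (nbhs (y - x1))).
  exact: cvg_translate.
exact: continuous_dotrvv.
Qed.

Lemma is_derive_coord (i j : 'I_n) (y : E) :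
  is_derive y (delta_mx 0 i) (fun y : E => y 0 j) (i == j)%:R.
Proof.
apply/is_derive_along; rewrite (_ : (fun s => _) = fun s : R => y 0 j + (i == j)%:R * s); last first.
  by apply/funext => s; rewrite !mxE/= eq_sym mulrC.
apply: (is_derive_eq (is_derive_add (is_derive_cst (y 0 j) (0 : R) 1) (is_derive_scale (i == j)%:R (is_derive_id (0 : R) 1)))).
by rewrite mulr1 add0r.
Qed.

Lemma is_derive_sqr_dist (i : 'I_n) (y : E) :
  is_derive y (delta_mx 0 i) (fun y : E => - dotrv (y - x1) (y - x1)) (- 2 * (y 0 i - x1 0 i)).
Proof.
have e : (fun y : E => - dotrv (y - x1) (y - x1)) = fun y => - 1 * \sum_j (y 0 j - x1 0 j) ^+ 2.
  by apply/funext => z; rewrite mulN1r /dotrv; congr (- _); apply: eq_bigr => j _; rewrite !mxE expr2.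
rewrite e; have D := is_derive_scale (- 1) (is_derive_sumR (fun j => is_derive_sqr
  (is_derive_sub (is_derive_coord i j y) (is_derive_cst (x1 0 j) y (delta_mx 0 i))))).
apply: (is_derive_eq D); rewrite (bigD1 i)//= big1 ?addr0; last first.
  by move=> j ji; rewrite eq_sym (negPf ji) subr0 mulr0.
by rewrite eqxx mulr1n /cst; ring.
Qed.

Lemma continuous_dsqr_dist (i : 'I_n) : continuous (fun y : E => - 2 * (y 0 i - x1 0 i)).
Proof.
apply: continuousM2 => [y|]; first exact: cst_continuous.
move=> y; apply: (@cvgB _ _ _ (nbhs y)); [exact: coord_continuous|exact: cvg_cst].
Qed.

(** Quadratic function [c^2 (t2 - t)^2 - |y - x1|^2], which for [t <= t2] is positive exactly inside
    the backward cone with vertex [(t2, x1)]. *)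
Definition cone : @c1field R n T :=
  c1add (c1time T is_derive_cone_time (@continuous_affine_time (- 2 * c ^+ 2)))
        (c1space T continuous_sqr_dist is_derive_sqr_dist continuous_dsqr_dist).

Lemma continuous_dcut : continuous (fun s : R => (1 + 1) * ppow 1 s).
Proof. by apply: continuousM2 => [s|]; [exact: cst_continuous|exact: continuous_ppow]. Qed.

(** Squared positive part of [cone]: a C^1 weight carried by the cone, replacing an integral over
    the cone with its lateral boundary terms. *)
Definition cutoff := c1comp (fun s => is_derive_ppow s ltr01) continuous_dcut cone.

Lemma coneE t y : cone t y = c ^+ 2 * (t2 - t) ^+ 2 - enorm (y - x1) ^+ 2.
Proof. by rewrite sqr_enorm. Qed.

Lemma cone_gt0 t y : t <= t2 -> (0 < cone t y) = (enorm (y - x1) < c * (t2 - t)).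
Proof.
move=> tt; rewrite coneE subr_gt0 -exprMn ltr_pXn2r// nnegrE ?enorm_ge0//.
by rewrite mulr_ge0 ?(ltW c0)// subr_ge0.
Qed.

Lemma cone_le0 t y : 0 <= t <= T -> enorm x1 + c * (t2 + T) < `|y| -> cone t y <= 0.
Proof.
move=> /andP[t0 tT] Ky; rewrite coneE subr_le0 -exprMn.
have h : `|y| <= enorm (y - x1) + enorm x1.
  by apply: le_trans (ler_norm_enorm y) _; rewrite -{1}(subrK x1 y) ler_enormD.
have h2 : c * (t2 + T) <= enorm (y - x1) by move: h Ky; lra.
have h3 : `|c * (t2 - t)| <= c * (t2 + T).
  rewrite normrM gtr0_norm// ler_pM2l// ler_norml; move: t0 tT t20 T0 => *; apply/andP; split; lra.
rewrite -(real_normK (num_real (c * (t2 - t)))) ler_pXn2r ?nnegrE ?normr_ge0 ?enorm_ge0//.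
exact: le_trans h3 h2.
Qed.

Lemma cutoff_ge0 t y : 0 <= cutoff t y. Proof. exact: ppow_ge0. Qed.

Lemma cutoff_eq0 t y : cone t y <= 0 -> cutoff t y = 0 /\ fdt cutoff t y = 0.
Proof.
move=> h; split; first by apply: ppow_le0 => //; rewrite gt_eqF.
rewrite [LHS](_ : _ = (1 + 1) * ppow 1 (cone t y) * fdt cone t y) // ppow_le0 ?oner_eq0// mulr0 mul0r//.
Qed.

(** The weight decreases in time fast enough to absorb the energy flux: [|flux_density| |u| |y - x1|
    <= c entropy c (t2 - t)] inside the cone. *)
Lemma cutoff_flux_le0 t y : 0 <= t <= T -> t <= t2 ->
  (enorm (y - x1) < c * (t2 - t) -> `|r t y - rb| <= d /\ enorm (urow t y) <= d) ->
  entropy t y * fdt cutoff t y + \sum_i entropy_flux i t y * fdx cutoff i t y <= 0.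
Proof.
move=> tT tt2 near_cst; have rt := r0 y tT.
pose P := ppow 1 (cone t y).
have -> : entropy t y * fdt cutoff t y + \sum_i entropy_flux i t y * fdx cutoff i t y =
    2 * P * (entropy t y * (- 2 * c ^+ 2 * (t2 - t)) +
       flux_density t y * (- 2 * dotrv (urow t y) (y - x1))).
  rewrite [RHS]mulrDr; congr (_ + _); first by rewrite /= /P addr0; ring.
  rewrite /dotrv !mulr_sumr; apply: eq_bigr => i _; rewrite !mxE /= /P add0r; ring.
have P0 : 0 <= P by exact: ppow_ge0.
have [cn|cn] := leP (cone t y) 0; first by rewrite /P ppow_le0 ?oner_eq0// mulr0 mul0r.
have yc : enorm (y - x1) < c * (t2 - t) by rewrite -cone_gt0.
have [rd ud] := near_cst yc.
have := flux_le rt rd (_ : 0 <= enorm (urow t y) <= d); rewrite enorm_ge0 ud => /(_ isT).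
set U := enorm (urow t y); set s := r t y; rewrite -/s in rt rd.
have eE : entropy t y = s * U ^+ 2 / 2 + gap A a rb s / a.
  rewrite /U -speed2E [LHS](_ : _ = s * speed2 t y * (1 / 2) + a^-1 * gap A a rb s)//.
  by rewrite [_ * gap _ _ _ _]mulrC mul1r.
have qE : flux_density t y = s * U ^+ 2 / 2 + s * kappa A a rb s.
  rewrite /U -speed2E [LHS](_ : _ = s * speed2 t y * (1 / 2) + A * (a + 1) / a * (ppow (a + 1) s - ppow a rb * s))//.
  by rewrite mul1r -(ppowS rt a0) /kappa; ring.
rewrite -eE; set e := entropy t y => fl.
have U0 : 0 <= U by exact: enorm_ge0.
have dl : - (U * enorm (y - x1)) <= dotrv (urow t y) (y - x1).
  by rewrite lerNl -dotrvNl; apply: le_trans (dotrv_le _ _) _; rewrite enormN.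
have du : dotrv (urow t y) (y - x1) <= U * enorm (y - x1) by exact: dotrv_le.
set D := dotrv _ _ in dl du *; set Y := enorm (y - x1) in yc dl du *.
have e0 : 0 <= e by exact: entropy_ge0.
have Y0 : 0 <= Y by exact: enorm_ge0.
have {}fl : `|flux_density t y| * U <= c * e.
  apply: le_trans fl; rewrite ler_wpM2r// qE; apply: le_trans (ler_normD _ _) _.
  have h1 : 0 <= s * U ^+ 2 / 2 by rewrite divr_ge0// mulr_ge0// sqr_ge0.
  by rewrite (ger0_norm h1) normrM (ger0_norm rt).
set Q := flux_density t y in fl *.
have QD : - (Q * D) <= `|Q| * U * Y.
  apply: le_trans (ler_norm _) _; rewrite normrN normrM -mulrA ler_wpM2l// ler_norml dl du//.
have h1 : `|Q| * U * Y <= c * e * Y by rewrite ler_wpM2r.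
have h2 : c * e * Y <= c * e * (c * (t2 - t)).
  by rewrite ler_wpM2l ?(ltW yc)// mulr_ge0 ?(ltW c0).
rewrite mulr_ge0_le0 ?mulr_ge0//.
have -> : e * (- 2 * c ^+ 2 * (t2 - t)) + Q * (- 2 * D) = 2 * (- (Q * D) - c * e * (c * (t2 - t))) by ring.
by rewrite mulr_ge0_le0// subr_le0; apply: le_trans QD (le_trans h1 h2).
Qed.

Definition weighted_entropy := c1mul entropy cutoff.

(** Adding the divergence of the weighted flux, of zero integral, leaves the dissipation
    [- b r |u|^2] times the weight and the flux term of [cutoff_flux_le0]. *)
Lemma cone_energy t : 0 < t < T -> t <= t2 ->
  (forall y, enorm (y - x1) < c * (t2 - t) -> `|r t y - rb| <= d /\ enorm (urow t y) <= d) ->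
  I (fdt weighted_entropy t) <= 0.
Proof.
move=> tT tt2 near_cst; have tT' : 0 <= t <= T by case/andP: tT => ? ?; rewrite !ltW.
pose K := enorm x1 + c * (t2 + T).
have F0 y : K < `|y| -> cutoff t y = 0 /\ fdt cutoff t y = 0 by move=> /(cone_le0 tT')/cutoff_eq0.
have b1 : bcs (fdt weighted_entropy t).
  apply: (bcs_continuous (K := K)); first exact/continuous_slice/continuous_fdt.
  by move=> y /F0[w0 w1]; rewrite [LHS](_ : _ = fdt entropy t y * cutoff t y + entropy t y * fdt cutoff t y)// w0 w1 !mulr0 addr0.
have q0 i y : K < `|y| -> c1mul (entropy_flux i) cutoff t y = 0.
  by move=> /F0[w0 _]; rewrite [LHS](_ : _ = entropy_flux i t y * cutoff t y)// w0 mulr0.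
have b2 i : bcs (fdx (c1mul (entropy_flux i) cutoff) i t).
  apply: (bcs_continuous (K := K)); first exact/continuous_slice/continuous_fdx.
  by apply: c1_dx0 => y; exact: q0.
have [b3 s0] := integral_Rn_sum b2.
have -> : I (fdt weighted_entropy t) =
    I (fun y => fdt weighted_entropy t y + \sum_i fdx (c1mul (entropy_flux i) cutoff) i t y).
  rewrite integral_RnD// s0 big1 ?addr0// => i _.
  by apply: (c1_integral_dx (K := K)) => y; exact: q0.
rewrite -[leRHS](@integral_Rn0 R n); apply: le_integral_Rn; [exact: bcsD|exact: bcs0|move=> y].
have -> : fdt weighted_entropy t y + \sum_i fdx (c1mul (entropy_flux i) cutoff) i t y =
    (fdt entropy t y + \sum_i fdx (entropy_flux i) i t y) * cutoff t y +
    (entropy t y * fdt cutoff t y + \sum_i entropy_flux i t y * fdx cutoff i t y).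
  rewrite [LHS](_ : _ = (fdt entropy t y * cutoff t y + entropy t y * fdt cutoff t y) +
    \sum_i (fdx (entropy_flux i) i t y * cutoff t y + entropy_flux i t y * fdx cutoff i t y))//.
  by rewrite big_split/= -mulr_suml; ring.
rewrite entropy_identity//; have := cutoff_flux_le0 tT' tt2 (near_cst y).
suff : - b t * (r t y * speed2 t y) * cutoff t y <= 0 by lra.
rewrite mulNr mulNr oppr_le0 mulr_ge0 ?cutoff_ge0// mulr_ge0 ?b0// mulr_ge0 ?r0//.
by rewrite speed2E sqr_ge0.
Qed.

(* The weighted relative entropy is nonincreasing as long as the state is nearly constant
   on the cone; by continuity in time this holds a little longer than the state is constant. *)
Lemma cone_step (s0 s1 : R) : 0 <= s0 -> s1 <= T -> s1 < t2 ->
  (forall y, enorm (y - x1) < c * (t2 - s0) -> r s0 y = rb /\ forall i, u i s0 y = 0) ->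
  (forall s y, s0 <= s <= s1 -> enorm (y - x1) < c * (t2 - s) ->
     `|r s y - rb| <= d /\ enorm (urow s y) <= d) ->
  forall s y, s0 <= s <= s1 -> enorm (y - x1) < c * (t2 - s) ->
    r s y = rb /\ forall i, u i s y = 0.
Proof.
move=> s00 s1T s1t2 init near_cst s y /andP[s0s ss1] ys.
have sT : 0 <= s <= T by rewrite (le_trans s00 s0s) (le_trans ss1 s1T).
have s0T : 0 <= s0 <= T by rewrite s00 (le_trans s0s)// (le_trans ss1).
pose K := enorm x1 + c * (t2 + T).
have F0 t z : 0 <= t <= T -> K < `|z| -> weighted_entropy t z = 0.
  move=> tT /(cone_le0 tT)/cutoff_eq0[w0 _].
  by rewrite [LHS](_ : _ = entropy t z * cutoff t z)// w0 mulr0.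
have [cE dE] := c1_integral_dt T0 F0.
have pos t z : 0 <= t <= T -> 0 <= weighted_entropy t z.
  by move=> tT; rewrite [leRHS](_ : _ = entropy t z * cutoff t z)// mulr_ge0 ?cutoff_ge0 ?entropy_ge0.
have E0 : I (weighted_entropy s0) = 0.
  have -> : weighted_entropy s0 = fun _ => 0 * 0; last by rewrite integral_RnZ ?mul0r//; exact: bcs0.
  apply/funext => z; rewrite [LHS](_ : _ = entropy s0 z * cutoff s0 z)// mulr0.
  have [cn|cn] := leP (cone s0 z) 0; first by have [-> _] := cutoff_eq0 cn; rewrite mulr0.
  have [rE uE] : r s0 z = rb /\ forall i, u i s0 z = 0.
    by apply: init; rewrite -cone_gt0// ltW// (le_lt_trans s0s)// (le_lt_trans ss1).
  rewrite (_ : entropy s0 z = 0) ?mul0r//.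
  rewrite [LHS](_ : _ = r s0 z * speed2 s0 z * (1 / 2) + a^-1 * gap A a rb (r s0 z))//.
  rewrite rE gap_rb mulr0 addr0 [speed2 s0 z](_ : _ = 0) ?mulr0 ?mul0r//.
  by rewrite [LHS](_ : _ = \sum_i u i s0 z * u i s0 z)// big1// => i _; rewrite uE mul0r.
have Es : I (weighted_entropy s) = 0.
  apply/eqP; rewrite eq_le; apply/andP; split; last by apply: integral_Rn_ge0 => z; exact: pos.
  rewrite -E0 -{1}(clampE sT) -{1}(clampE s0T) -lerN2.
  apply: (derive_ge0_le (f := fun t => - I (weighted_entropy (clamp T t)))
    (df := fun t => - I (fdt weighted_entropy t)) s0s) => [t _|t|t].
  - by apply: continuousN; exact: cE.
  - move=> /andP[t0 t1]; apply: is_deriveN; apply: dE.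
    by rewrite (le_lt_trans s00 t0)/= (lt_le_trans t1)// (le_trans ss1).
  - move=> /andP[t0 t1]; rewrite oppr_ge0; apply: cone_energy.
    + by rewrite (le_lt_trans s00 t0)/= (lt_le_trans t1)// (le_trans ss1).
    + by apply/ltW/(lt_trans t1)/(le_lt_trans ss1).
    + by move=> z; apply: near_cst; rewrite (ltW t0)/= (le_trans (ltW t1)).
have W0 : weighted_entropy s y = 0.
  have cW : continuous (weighted_entropy s) by exact/continuous_slice/continuous_fval.
  exact: (@integral_Rn_eq0 _ _ _ K cW (fun z => F0 s z sT) (fun z => pos s z sT) Es y).
apply: entropy_eq0 sT _; move: W0; rewrite [LHS](_ : _ = entropy s y * cutoff s y)// => /eqP.
rewrite mulf_eq0 => /orP[/eqP//|]; rewrite gt_eqF//.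
have cn : 0 < cone s y by rewrite cone_gt0// ltW// (le_lt_trans ss1).
by rewrite [ltRHS](_ : _ = ppow (1 + 1) (cone s y))// ppow_ge0E ?(ltW cn)// powR_gt0.
Qed.

End Cone.

(** Time is cut into steps short enough that, starting from the constant state, the flow stays close
    to it on the cone; [cone_step] then makes it constant again. The step length is uniform because
    the time derivatives are bounded on the cone. *)
Lemma finite_propagation (Rad c : R) : 0 < c -> A * (a + 1) * ppow a rb <= c ^+ 2 ->
  (forall x, Rad < enorm x -> r 0 x = rb /\ forall i, u i 0 x = 0) ->
  forall t x, 0 <= t <= T -> Rad + c * t < enorm x -> r t x = rb /\ forall i, u i t x = 0.
Proof.
move=> c0 cA init t x /andP[t0 tT] xt.
pose g := enorm x - (Rad + c * t); have g0 : 0 < g by rewrite subr_gt0.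
have t1 : 0 < 4 * (t + 1) by rewrite mulr_gt0// ltr_wpDl.
(* A speed above [c] gives the strict inequality required by the flux estimate. Widening the cone
   and moving its vertex past [t] each cost at most a quarter of the gap [g], so its base misses the
   initial support. *)
pose c' := c + g / (4 * (t + 1)).
have cc' : c < c' by rewrite ltrDl divr_gt0.
have c'0 : 0 < c' by exact: lt_trans cc'.
pose t2 := t + g / (4 * c').
have tt2 : t < t2 by rewrite ltrDl divr_gt0// mulr_gt0.
have t20 : 0 < t2 by exact: le_lt_trans tt2.
have ct2 : c' * t2 <= enorm x - Rad.
  have h1 : c' * t2 = c * t + g * (t / (4 * (t + 1))) + g / 4.
    have -> : c' * t2 = c' * t + g / 4 by rewrite /t2; field; rewrite gt_eqF.
    by congr (_ + _); rewrite /c'; field; rewrite gt_eqF// ltr_wpDl.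
  have h2 : g * (t / (4 * (t + 1))) <= g * (1 / 4).
    rewrite ler_pM2l// ler_pdivrMr//; lra.
  have h3 : enorm x - Rad = c * t + g by rewrite /g; ring.
  rewrite h1 h3; clearbody g; move: h2 g0; lra.
have [d d0 flux] : exists2 d, 0 < d & forall s U, 0 <= s -> `|s - rb| <= d -> 0 <= U <= d ->
    (s * U ^+ 2 / 2 + s * `|kappa A a rb s|) * U <= c' * (s * U ^+ 2 / 2 + gap A a rb s / a).
  apply: entropy_flux_le => //; apply: le_lt_trans cA _.
  by rewrite ltr_pXn2r// nnegrE ltW.
pose K := enorm x + c' * t2.
have [L0 L00 HL0] := continuous_bounded_rectangle 0 T K (@continuous_fdt _ _ _ r).
have /choice[L HL] j : exists L, 0 <= L /\ forall s y, 0 <= s <= T -> `|y| <= K -> `|fdt (u j) s y| <= L.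
  by have [L ? ?] := continuous_bounded_rectangle 0 T K (@continuous_fdt _ _ _ (u j)); exists L.
pose M := L0 + \sum_j L j.
have sL0 : 0 <= \sum_j L j by apply: sumr_ge0 => j _; exact: (HL j).1.
have M0 : 0 <= M by rewrite addr_ge0.
(* With time derivatives bounded by [M], the state moves by at most [d] during a step. *)
pose h := d / (M + 1).
have M1 : 0 < M + 1 by rewrite ltr_wpDl.
have h0 : 0 < h by rewrite divr_gt0.
have Mh : M * h <= d by rewrite /h mulrCA ler_piMr ?(ltW d0)// ler_pdivrMr// mul1r lerDl.
have yK s y : 0 <= s -> enorm (y - x) < c' * (t2 - s) -> `|y| <= K.
  move=> s0 ys; apply: le_trans (ler_norm_enorm y) _; rewrite -(subrK x y).
  apply: le_trans (ler_enormD _ _) _; rewrite addrC lerD2l; apply: le_trans (ltW ys) _.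
  by rewrite ler_pM2l// gerBl.
have mono s s' y : s <= s' -> enorm (y - x) < c' * (t2 - s') -> enorm (y - x) < c' * (t2 - s).
  by move=> ss; move=> /lt_le_trans; apply; rewrite ler_pM2l// lerD2l lerN2.
have key k : forall s y, 0 <= s -> s <= k%:R * h -> s <= t -> enorm (y - x) < c' * (t2 - s) ->
    r s y = rb /\ forall i, u i s y = 0.
  elim: k => [|k IH] s y s0 sk st ys.
    have s00 : s = 0 by apply/eqP; rewrite eq_le s0 andbT; move: sk; rewrite mul0r.
    rewrite s00 subr0 in ys *; apply: init.
    have := ler_enormD y (x - y); rewrite subrKC -[enorm (x - y)]enormN opprB.
    by move: ys ct2; lra.
  have [skh|skh] := leP s (k%:R * h); first exact: IH.
  pose s0' := k%:R * h; have s0'0 : 0 <= s0' by rewrite mulr_ge0// ltW.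
  have s0s := ltW skh.
  refine (@cone_step c' d t2 x c'0 t20 flux s0' s s0'0 _ _ _ _ s y _ ys); last by rewrite s0s lexx.
  - exact: le_trans tT.
  - exact: le_lt_trans tt2.
  - by move=> z; apply: IH => //; exact: le_trans st.
  - move=> s' z /andP[s1 s2] zs.
    have [rE uE] : r s0' z = rb /\ forall i, u i s0' z = 0.
      by apply: IH => //; [exact: le_trans st|exact: mono zs].
    have zK : `|z| <= K by apply: yK zs; exact: le_trans s1.
    have sh : s' - s0' <= h.
      have := le_trans s2 sk; rewrite -natr1 mulrDl mul1r -/s0'; clearbody s0' h; lra.
    have lip (F : @c1field R n T) (l : R) : (forall s y, 0 <= s <= T -> `|y| <= K -> `|fdt F s y| <= l) ->
        0 <= l -> `|F s' z - F s0' z| <= l * h.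
      move=> HF l0; apply: (@le_trans _ _ (l * (s' - s0'))); last by rewrite ler_wpM2l.
      apply: (@lipschitz_of_derive R (fun q => F q z) (fun q => fdt F q z) s0' s' l s1).
      + by move=> q _; exact: (@continuous_slice_time _ _ F z (@continuous_fval _ _ _ F) q).
      + move=> q /andP[q1 q2]; apply: is_derive_fdt.
        by rewrite (le_lt_trans s0'0 q1) (lt_le_trans q2)// (le_trans s2)// (le_trans st).
      + move=> q /andP[q1 q2]; apply: HF => //; rewrite (le_trans s0'0 (ltW q1))/=.
        by rewrite (le_trans (ltW q2))// (le_trans s2)// (le_trans st).
    split.
      rewrite -rE; apply: le_trans (lip r L0 HL0 L00) _.
      by apply: le_trans Mh; rewrite ler_pM2r// lerDl.
    apply: le_trans (enorm_le_sum _) _; apply: le_trans Mh.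
    apply: (@le_trans _ _ ((\sum_j L j) * h)); last by rewrite ler_pM2r// lerDr.
    rewrite mulr_suml; apply: ler_sum => j _; rewrite mxE.
    have := lip (u j) (L j) (HL j).2 (HL j).1; by rewrite uE subr0.
apply: (key (Num.truncn (t / h)).+1) => //.
- by rewrite -ler_pdivrMr// ltW// truncnS_gt// divr_ge0// ltW.
- rewrite subrr /enorm (_ : dotrv _ _ = 0) ?sqrtr0; first by rewrite mulr_gt0// subr_gt0.
  by apply: big1 => i _; rewrite mxE mul0r.
Qed.

End EulerFlow.

(** * Moments against plane waves *)

Section PlaneWaveMoments.
Context {R : realType} {n : nat}.
Notation E := 'rV[R]_n.
Local Notation I := (integral_Rn setT).
Variables (T A a rb : R) (b : R -> R).
Hypotheses (T0 : 0 < T) (A0 : 0 < A) (a0 : 0 < a) (rb0 : 0 < rb).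
Variables (r : @c1field R n T) (u : 'I_n -> @c1field R n T).
Hypothesis r0 : forall t x, 0 <= t <= T -> 0 <= r t x.
Hypothesis mass : forall t x, 0 < t < T ->
  fdt r t x + \sum_i fdx (c1mul r (u i)) i t x = 0.
Hypothesis momentum : forall j t x, 0 < t < T ->
  fdt (c1mul r (u j)) t x + \sum_i fdx (c1mul (c1mul r (u i)) (u j)) i t x +
  fdx (c1pressure A a0 r) j t x + b t * (r t x * u j t x) = 0.
Variables (Rad c : R).
Hypotheses (Rad0 : 0 < Rad) (c0 : 0 < c) (cE : c ^+ 2 = A * (a + 1) * ppow a rb).
Hypothesis support : forall t x, 0 <= t <= T -> Rad + c * t < enorm x ->
  r t x = rb /\ forall i, u i t x = 0.

Let K := Rad + c * T.

Lemma support_norm t x : 0 <= t <= T -> K < `|x| -> r t x = rb /\ forall i, u i t x = 0.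
Proof.
move=> tT Kx; apply: support => //; apply: lt_le_trans (ler_norm_enorm x).
by apply: le_lt_trans Kx; rewrite lerD2l ler_pM2l//; case/andP: tT.
Qed.

Lemma integral_divergence (f g : E -> R) (G : 'I_n -> @c1field R n T) t :
  (forall i x, K < `|x| -> G i t x = 0) -> bcs g ->
  (forall x, f x = g x - \sum_i fdx (G i) i t x) -> I f = I g.
Proof.
move=> G0 bg fE; have bG i : bcs (fdx (G i) i t).
  apply: (bcs_continuous (K := K)); first exact/continuous_slice/continuous_fdx.
  by apply: c1_dx0 => x; exact: G0.
have [bs s0] := integral_Rn_sum bG.
rewrite (_ : f = fun x => g x - \sum_i fdx (G i) i t x); last exact/funext.
rewrite integral_RnB// s0 big1 ?subr0// => i _.
by apply: (c1_integral_dx (K := K)) => x; exact: G0.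
Qed.

Definition excess := c1add r (c1cst T (- rb)).

Lemma excess0 t x : 0 <= t <= T -> K < `|x| -> excess t x = 0.
Proof. by move=> tT Kx; have [rE _] := support_norm tT Kx; rewrite /= rE subrr. Qed.

Lemma mass_conservation t : 0 <= t <= T -> I (excess t) = I (excess 0).
Proof.
move=> tT; have [cI dI] := c1_integral_dt T0 excess0.
have /andP[t0 t1] := tT; have T00 : 0 <= (0 : R) <= T by rewrite lexx (ltW T0).
suff : `|I (excess (clamp T t)) - I (excess (clamp T 0))| <= 0 * (t - 0).
  by rewrite mul0r normr_le0 subr_eq0 !clampE// => /eqP.
apply: (@lipschitz_of_derive R (fun t => I (excess (clamp T t))) (fun t => I (fdt excess t)) 0 t 0 t0).
- by move=> s _; exact: cI.
- by move=> s /andP[s0 s1]; apply: dI; rewrite s0 (lt_le_trans s1).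
- move=> s /andP[s0 s1]; have sT : 0 < s < T by rewrite s0 (lt_le_trans s1).
  have sT' : 0 <= s <= T by case/andP: sT => ? ?; rewrite !ltW.
  rewrite (@integral_divergence _ (fun=> 0) (fun i => c1mul r (u i)) s).
  + by rewrite integral_Rn0 normr0.
  + by move=> i x Kx; have [_ uE] := support_norm sT' Kx; rewrite /= uE mulr0.
  + exact: bcs0.
  + move=> x; rewrite [LHS](_ : _ = fdt r s x + 0)// addr0 sub0r; apply/eqP.
    by rewrite -subr_eq0 opprK (mass x sT).
Qed.

Section Direction.
Variable s : E.
Hypothesis s1 : dotrv s s = 1.

Lemma continuous_plane_wave : continuous (fun x : E => expR (dotrv x s)).
Proof. by apply: (continuous_comp_real (@continuous_expR R)); exact: continuous_dotrvl. Qed.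

Lemma is_derive_plane_wave_coord (i : 'I_n) (x : E) :
  is_derive x (delta_mx 0 i) (fun y : E => expR (dotrv y s)) (s 0 i * expR (dotrv x s)).
Proof.
apply: (is_derive_eq (is_derive_plane_wave x (delta_mx 0 i) s)); rewrite mulrC; congr (_ * _).
rewrite /dotrv (bigD1 i)//= big1 ?addr0; last first.
  by move=> j ji; rewrite !mxE (negPf ji) andbF mul0r.
by rewrite !mxE !eqxx mul1r.
Qed.

Lemma continuous_dplane_wave (i : 'I_n) : continuous (fun x : E => s 0 i * expR (dotrv x s)).
Proof. by apply: continuousM2 => [x|]; [exact: cst_continuous|exact: continuous_plane_wave]. Qed.

Definition wave : @c1field R n T :=
  c1space T continuous_plane_wave is_derive_plane_wave_coord continuous_dplane_wave.

Definition excess_wave := c1mul excess wave.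
Definition flux_wave := c1mul (c1sum (fun j => c1mul (c1cst T (s 0 j)) (c1mul r (u j)))) wave.

Lemma excess_wave0 t x : 0 <= t <= T -> K < `|x| -> excess_wave t x = 0.
Proof. by move=> tT Kx; rewrite [LHS](_ : _ = excess t x * wave t x)// excess0// mul0r. Qed.

Lemma flux_wave0 t x : 0 <= t <= T -> K < `|x| -> flux_wave t x = 0.
Proof.
move=> tT Kx; have [_ uE] := support_norm tT Kx.
by rewrite /= big1 ?mul0r// => j _; rewrite uE !mulr0.
Qed.

Lemma bcs_slice (F : @c1field R n T) t :
  (forall x, K < `|x| -> F t x = 0) -> bcs (F t).
Proof. by move=> F0; apply: (bcs_continuous (K := K)) => //; exact/continuous_slice/continuous_fval. Qed.

(** Mass equation integrated by parts: the gradient of the wave is [s] times the wave. *)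
Lemma integral_dt_excess_wave t : 0 < t < T -> I (fdt excess_wave t) = I (flux_wave t).
Proof.
move=> tT; have tT' : 0 <= t <= T by case/andP: tT => ? ?; rewrite !ltW.
apply: (@integral_divergence _ _ (fun i => c1mul (c1mul r (u i)) wave) t).
- by move=> i x Kx; have [_ uE] := support_norm tT' Kx; rewrite /= uE mulr0 mul0r.
- by apply: bcs_slice => x; exact: flux_wave0.
move=> x; have rtE : fdt r t x = - \sum_i fdx (c1mul r (u i)) i t x.
  by apply/eqP; rewrite -subr_eq0 opprK (mass x tT).
rewrite /= rtE /= addr0 mulr0 addr0 mulNr !mulr_suml -!sumrN -big_split/=.
by apply: eq_bigr => i _; ring.
Qed.

Definition gap_wave t x := gap A a rb (r t x) * expR (dotrv x s).

Lemma gap_wave0 t x : 0 <= t <= T -> K < `|x| -> gap_wave t x = 0.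
Proof. by move=> tT Kx; have [rE _] := support_norm tT Kx; rewrite /gap_wave rE gap_rb mul0r. Qed.

Lemma bcs_gap_wave t : 0 <= t <= T -> bcs (gap_wave t).
Proof.
move=> tT; apply: (bcs_continuous (K := K)); last by move=> x; exact: gap_wave0.
apply: continuousM2; last exact: continuous_plane_wave.
by apply: continuous_comp_real; [exact: continuous_gap|exact/continuous_slice/continuous_fval].
Qed.

(** The momentum equation is dotted with [s] and integrated against the wave. As [|s| = 1], the
    pressure yields its excess over the reference value, equal to [gap + c^2 (r - rb)]; convection
    contributes the integral of [r (u.s)^2], which is dropped. *)
Lemma dt_flux_wave_ge t : 0 < t < T ->
  c ^+ 2 * I (excess_wave t) + I (gap_wave t) - b t * I (flux_wave t) <= I (fdt flux_wave t).
Proof.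
move=> tT; have tT' : 0 <= t <= T by case/andP: tT => ? ?; rewrite !ltW.
(* Subtracting the reference pressure leaves the gradient unchanged and gives the divergence a
   compactly supported potential. *)
pose P := c1add (c1pressure A a0 r) (c1cst T (- (A * ppow (a + 1) rb))).
pose us x := \sum_j s 0 j * u j t x.
pose g x := (r t x * us x ^+ 2 * expR (dotrv x s) + gap_wave t x) +
            (c ^+ 2 * excess_wave t x - b t * flux_wave t x).
have cus : continuous us.
  apply: continuous_sum => j; apply: continuousM2 => [x|]; first exact: cst_continuous.
  exact/continuous_slice/continuous_fval.
have be : bcs (excess_wave t) by apply: bcs_slice => x; exact: excess_wave0.
have bf : bcs (flux_wave t) by apply: bcs_slice => x; exact: flux_wave0.
have bu : bcs (fun x => r t x * us x ^+ 2 * expR (dotrv x s)).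
  apply: (bcs_continuous (K := K)).
    apply: continuousM2; last exact: continuous_plane_wave.
    apply: continuousM2; first exact/continuous_slice/continuous_fval.
    exact: continuousM2.
  move=> x Kx; have [_ uE] := support_norm tT' Kx.
  by rewrite /us big1 ?expr0n ?mulr0 ?mul0r// => j _; rewrite uE mulr0.
have bg := bcs_gap_wave tT'.
have bN : bcs (fun x => - (b t * flux_wave t x)).
  rewrite (_ : (fun x => _) = fun x => (- b t) * flux_wave t x); last by apply/funext => x; rewrite mulNr.
  exact: bcsZ.
have bl : bcs (fun x => c ^+ 2 * excess_wave t x - b t * flux_wave t x) by apply: bcsD => //; exact: bcsZ.
have -> : I (fdt flux_wave t) = I g.
  apply: (@integral_divergence _ _ (fun i => c1mul (c1add
    (c1sum (fun j => c1mul (c1cst T (s 0 j)) (c1mul (c1mul r (u i)) (u j)))) (c1mul (c1cst T (s 0 i)) P)) wave) t).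
  - move=> i x Kx; have [rE uE] := support_norm tT' Kx.
    by rewrite /= rE subrr mulr0 addr0 big1 ?mul0r// => j _; rewrite !uE !mulr0.
  - by rewrite /g; apply: bcsD => //; exact: bcsD.
  move=> x; pose F := expR (dotrv x s).
  have pE : A * ppow (a + 1) (r t x) - A * ppow (a + 1) rb = gap A a rb (r t x) + c ^+ 2 * (r t x - rb).
    by rewrite cE /gap; ring.
  pose D i j := fdx (c1mul (c1mul r (u i)) (u j)) i t x; pose q j := fdx (c1pressure A a0 r) j t x.
  pose M j := fdt (c1mul r (u j)) t x.
  have L1 : fdt flux_wave t x = (\sum_j s 0 j * M j) * F.
    rewrite [LHS](_ : _ = (\sum_j (0 * (r t x * u j t x) + s 0 j * M j)) * F +
      (\sum_j s 0 j * (r t x * u j t x)) * 0)// mulr0 addr0; congr (_ * _).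
    by apply: eq_bigr => j _; rewrite mul0r add0r.
  have L2 : flux_wave t x = r t x * us x * F.
    by rewrite /= mulr_sumr; congr (_ * _); apply: eq_bigr => j _; ring.
  have L3 j : M j = - (\sum_i D i j + q j + b t * (r t x * u j t x)).
    by have h := momentum j x tT; apply/eqP; rewrite -subr_eq0 opprK !addrA; apply/eqP.
  have L4 i : fdx (c1mul (c1add (c1sum (fun j => c1mul (c1cst T (s 0 j)) (c1mul (c1mul r (u i)) (u j))))
      (c1mul (c1cst T (s 0 i)) P)) wave) i t x =
    (\sum_j s 0 j * D i j + s 0 i * q i) * F +
    (r t x * u i t x * us x + s 0 i * (A * ppow (a + 1) (r t x) - A * ppow (a + 1) rb)) * (s 0 i * F).
    rewrite [LHS](_ : _ = (\sum_j (0 * (r t x * u i t x * u j t x) + s 0 j * D i j) +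
        (0 * (A * ppow (a + 1) (r t x) - A * ppow (a + 1) rb) + s 0 i * (q i + 0))) * F +
      (\sum_j s 0 j * (r t x * u i t x * u j t x) + s 0 i * (A * ppow (a + 1) (r t x) - A * ppow (a + 1) rb)) * (s 0 i * F))//.
    congr (_ * _ + _ * _).
      by congr (_ + _); [apply: eq_bigr => j _; rewrite mul0r add0r|rewrite mul0r add0r addr0].
    by congr (_ + _); rewrite /us mulr_sumr; apply: eq_bigr => j _; ring.
  have L5 : \sum_j s 0 j * M j =
      - (\sum_i \sum_j s 0 j * D i j) - \sum_i s 0 i * q i - b t * (r t x * us x).
    rewrite exchange_big/= /us !mulr_sumr -!sumrN -!big_split/=; apply: eq_bigr => j _.
    by rewrite L3 -mulr_sumr; ring.
  have L6 : \sum_i fdx (c1mul (c1add (c1sum (fun j => c1mul (c1cst T (s 0 j)) (c1mul (c1mul r (u i)) (u j))))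
      (c1mul (c1cst T (s 0 i)) P)) wave) i t x =
    (\sum_i \sum_j s 0 j * D i j + \sum_i s 0 i * q i) * F + r t x * us x ^+ 2 * F +
    (A * ppow (a + 1) (r t x) - A * ppow (a + 1) rb) * F.
    rewrite (eq_bigr _ (fun i _ => L4 i)) big_split/= -mulr_suml big_split/= -addrA; congr (_ + _).
    have -> : (A * ppow (a + 1) (r t x) - A * ppow (a + 1) rb) * F =
        (A * ppow (a + 1) (r t x) - A * ppow (a + 1) rb) * F * dotrv s s by rewrite s1 mulr1.
    have -> : r t x * us x ^+ 2 * F = \sum_j (r t x * us x * F) * (s 0 j * u j t x).
      by rewrite -mulr_sumr -/(us x); ring.
    by rewrite /dotrv mulr_sumr -big_split/=; apply: eq_bigr => i _; ring.
  rewrite L6 L1 L5 pE /g L2 /gap_wave -/F [excess_wave t x](_ : _ = (r t x - rb) * F)//; ring.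
have -> : I g = I (fun x => r t x * us x ^+ 2 * expR (dotrv x s)) + I (gap_wave t) +
    (c ^+ 2 * I (excess_wave t) - b t * I (flux_wave t)).
  rewrite /g integral_RnD//; last exact: bcsD.
  by rewrite integral_RnD// integral_RnB ?integral_RnZ//; exact: bcsZ.
have : 0 <= I (fun x => r t x * us x ^+ 2 * expR (dotrv x s)).
  by apply: integral_Rn_ge0 => x; rewrite mulr_ge0 ?expR_ge0// mulr_ge0 ?sqr_ge0 ?r0.
move: (I _) (I _) (I _) (I _) => *; lra.
Qed.

Lemma wave_moments :
  [/\ continuous (fun t => I (excess_wave (clamp T t))),
      continuous (fun t => I (flux_wave (clamp T t))),
      forall t, 0 < t < T -> is_derive t 1 (fun t => I (excess_wave (clamp T t))) (I (flux_wave t)) &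
      forall t, 0 < t < T -> is_derive t 1 (fun t => I (flux_wave (clamp T t))) (I (fdt flux_wave t))].
Proof.
have [c1 d1] := c1_integral_dt T0 excess_wave0.
have [c2 d2] := c1_integral_dt T0 flux_wave0.
by split=> // t tT; rewrite -integral_dt_excess_wave//; exact: d1.
Qed.

Definition ball_wave rad := I (fun x => expR (dotrv x s) * \1_[set x : E | enorm x <= rad] x).

(* For every z, gap >= k (2 z (r - rb) - z^2 (r + rb)): this is linear in r, hence the
   integral of the gap is controlled by the moments alone. *)
Lemma integral_gap_wave_ge (k z t : R) : 0 <= k -> 0 <= t <= T ->
  (forall y, 0 <= y -> k * (y - rb) ^+ 2 / (y + rb) <= gap A a rb y) ->
  k * (2 * z * I (excess_wave t) - z ^+ 2 * (I (excess_wave t) + 2 * rb * ball_wave (Rad + c * t)))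
    <= I (gap_wave t).
Proof.
move=> k0 tT Hk.
have be : bcs (excess_wave t) by apply: bcs_slice => x; exact: excess_wave0.
have bb := bcs_eball (Rad + c * t) continuous_plane_wave.
have bb' : bcs (fun x => 2 * rb * (expR (dotrv x s) * \1_[set x : E | enorm x <= Rad + c * t] x)) by exact: bcsZ.
have -> : k * (2 * z * I (excess_wave t) - z ^+ 2 * (I (excess_wave t) + 2 * rb * ball_wave (Rad + c * t))) =
    I (fun x => k * (2 * z * excess_wave t x - z ^+ 2 * (excess_wave t x +
      2 * rb * (expR (dotrv x s) * \1_[set x : E | enorm x <= Rad + c * t] x)))).
  have b1 : bcs (fun x => excess_wave t x + 2 * rb * (expR (dotrv x s) * \1_[set x : E | enorm x <= Rad + c * t] x)).
    exact: bcsD.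
  have b2 := bcsZ (z ^+ 2) b1; have b3 := bcsZ (2 * z) be.
  have b4 : bcs (fun x => 2 * z * excess_wave t x - z ^+ 2 * (excess_wave t x +
      2 * rb * (expR (dotrv x s) * \1_[set x : E | enorm x <= Rad + c * t] x))).
    apply: bcsD => //; rewrite (_ : (fun x => - _) = fun x => -1 * (z ^+ 2 * (excess_wave t x +
      2 * rb * (expR (dotrv x s) * \1_[set x : E | enorm x <= Rad + c * t] x)))); last first.
      by apply/funext => x; rewrite mulN1r.
    exact: bcsZ.
  rewrite integral_RnZ// integral_RnB// (integral_RnZ (2 * z))// (integral_RnZ (z ^+ 2))//.
  by rewrite integral_RnD// (integral_RnZ (2 * rb)).
apply: le_integral_Rn.
- apply: bcsZ; apply: bcsD; first exact: bcsZ.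
  rewrite (_ : (fun x => - _) = fun x => - z ^+ 2 * (excess_wave t x +
      2 * rb * (expR (dotrv x s) * \1_[set x : E | enorm x <= Rad + c * t] x))); last first.
    by apply/funext => x; rewrite mulNr.
  by apply: bcsZ; exact: bcsD.
- exact: bcs_gap_wave.
move=> x; rewrite [excess_wave t x](_ : _ = (r t x - rb) * expR (dotrv x s))// /gap_wave.
have [xin|xout] := leP (enorm x) (Rad + c * t); last first.
  have [rE _] := support tT xout.
  rewrite rE gap_rb subrr indicE memNset ?mulr0 ?mul0r ?addr0 ?mulr0 ?subrr ?mulr0//=.
  by apply/negP; rewrite -ltNge.
rewrite indicE mem_set//= mulr1.
have rt := r0 x tT; have rr : 0 < r t x + rb by rewrite ltr_wpDl.
apply: (@le_trans _ _ (k * (r t x - rb) ^+ 2 / (r t x + rb) * expR (dotrv x s))); last first.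
  by rewrite ler_wpM2r ?expR_ge0// Hk.
rewrite -subr_ge0.
(* The tangent bound at parameter [z] misses the convex function by a perfect square. *)
have -> : k * (r t x - rb) ^+ 2 / (r t x + rb) * expR (dotrv x s) -
   k * (2 * z * ((r t x - rb) * expR (dotrv x s)) - z ^+ 2 * ((r t x - rb) * expR (dotrv x s) + 2 * rb * expR (dotrv x s))) =
   k * expR (dotrv x s) * ((r t x - rb - z * (r t x + rb)) ^+ 2 / (r t x + rb)).
  by field; rewrite gt_eqF.
by rewrite mulr_ge0 ?(mulr_ge0 k0) ?expR_ge0// divr_ge0 ?sqr_ge0// ltW.
Qed.

(** On the ball the wave is at most [e^rho], and the mass there is the conserved excess plus [rb]
    times the volume, which is bounded by that of a cube. *)
Lemma excess_wave_le t : 0 <= t <= T ->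
  I (excess_wave t) <= expR (Rad + c * t) * (I (excess 0) + rb * ((Rad + c * t) + (Rad + c * t)) ^+ n).
Proof.
move=> tT; have rho0 : 0 <= Rad + c * t.
  by rewrite addr_ge0 ?(ltW Rad0)// mulr_ge0 ?(ltW c0)//; case/andP: tT.
set rho := Rad + c * t in rho0 *.
pose B x := (1 : R) * \1_[set x : E | enorm x <= rho] x.
have bB : bcs B by apply: bcs_eball => x; exact: cst_continuous.
have be : bcs (excess_wave t) by apply: bcs_slice => x; exact: excess_wave0.
have bx : bcs (excess t) by apply: bcs_slice => x; exact: excess0.
apply: (@le_trans _ _ (I (fun x => expR rho * (excess t x + rb * B x)))).
  apply: le_integral_Rn => //; first by apply: bcsZ; apply: bcsD => //; exact: bcsZ.
  move=> x; rewrite [excess_wave t x](_ : _ = (r t x - rb) * expR (dotrv x s))//.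
  rewrite [excess t x](_ : _ = r t x - rb)// /B mul1r.
  have [xin|xout] := leP (enorm x) rho; last first.
    have [rE _] := support tT xout.
    rewrite rE subrr indicE memNset ?mulr0 ?mul0r ?addr0 ?mulr0//=.
    by apply/negP; rewrite -ltNge.
  rewrite indicE mem_set//= mulr1 subrK.
  have rt := r0 x tT.
  apply: (@le_trans _ _ (r t x * expR (dotrv x s))).
    by rewrite ler_wpM2r ?expR_ge0// gerBl ltW.
  rewrite mulrC ler_wpM2r// ler_expR; apply: le_trans xin.
  by apply: le_trans (dotrv_le x s) _; rewrite /enorm s1 sqrtr1 mulr1.
have bB' := bcsZ rb bB.
have -> : I (fun x => expR rho * (excess t x + rb * B x)) = expR rho * (I (excess t) + rb * I B).
  rewrite integral_RnZ; last exact: bcsD.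
  by congr (_ * _); rewrite -(integral_RnZ rb)//; exact: integral_RnD.
rewrite mass_conservation// ler_wpM2l ?expR_ge0// lerD2l ler_wpM2l ?(ltW rb0)//.
exact: integral_eball_le.
Qed.

End Direction.

Section Pair.
Variables (s1 s2 : E) (p1 p2 : R).
Hypotheses (s1u : dotrv s1 s1 = 1) (s2u : dotrv s2 s2 = 1) (p10 : 0 <= p1) (p20 : 0 <= p2).

Definition comb (F : E -> R) := p1 * F s1 + p2 * F s2.

Lemma comb_le F G : F s1 <= G s1 -> F s2 <= G s2 -> comb F <= comb G.
Proof. by move=> H1 H2; apply: lerD; rewrite ler_wpM2l. Qed.

Lemma comb_cst (x : R) : comb (fun=> x) = (p1 + p2) * x.
Proof. by rewrite /comb mulrDl. Qed.

(** The clamped time makes the moment continuous on the whole line, as [damped_blowup] asks. *)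
Definition excess_moment t := comb (fun s => I (excess_wave s (clamp T t))).
Definition flux_moment t := comb (fun s => I (flux_wave s (clamp T t))).
Definition flux_moment_dt t := comb (fun s => I (fdt (flux_wave s) t)).
Definition gap_moment t := comb (fun s => I (gap_wave s t)).

Lemma excess_momentE t : 0 <= t <= T -> excess_moment t = comb (fun s => I (excess_wave s t)).
Proof. by move=> tT; rewrite /excess_moment clampE. Qed.

Lemma flux_momentE t : 0 <= t <= T -> flux_moment t = comb (fun s => I (flux_wave s t)).
Proof. by move=> tT; rewrite /flux_moment clampE. Qed.

Lemma continuous_moments : continuous excess_moment /\ continuous flux_moment.
Proof.
have [c1 d1 _ _] := wave_moments s1; have [c2 d2 _ _] := wave_moments s2.
have cc (p : R) : continuous (fun _ : R => p) by move=> t; exact: cst_continuous.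
split.
  exact: (continuousD2 (continuousM2 (cc p1) c1) (continuousM2 (cc p2) c2)).
exact: (continuousD2 (continuousM2 (cc p1) d1) (continuousM2 (cc p2) d2)).
Qed.

Lemma is_derive_moments t : 0 < t < T ->
  is_derive t 1 excess_moment (flux_moment t) /\ is_derive t 1 flux_moment (flux_moment_dt t).
Proof.
move=> tT; have tT' : 0 <= t <= T by case/andP: tT => ? ?; rewrite !ltW.
have [_ _ c1 d1] := wave_moments s1; have [_ _ c2 d2] := wave_moments s2; split.
  rewrite (flux_momentE tT').
  exact: (is_derive_add (is_derive_scale p1 (c1 t tT)) (is_derive_scale p2 (c2 t tT))).
exact: (is_derive_add (is_derive_scale p1 (d1 t tT)) (is_derive_scale p2 (d2 t tT))).
Qed.

Lemma flux_moment_dt_ge t : 0 < t < T ->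
  c ^+ 2 * excess_moment t + gap_moment t - b t * flux_moment t <= flux_moment_dt t.
Proof.
move=> tT; have tT' : 0 <= t <= T by case/andP: tT => ? ?; rewrite !ltW.
rewrite excess_momentE// flux_momentE//.
have -> : c ^+ 2 * comb (fun s => I (excess_wave s t)) + gap_moment t - b t * comb (fun s => I (flux_wave s t)) =
    comb (fun s => c ^+ 2 * I (excess_wave s t) + I (gap_wave s t) - b t * I (flux_wave s t)).
  rewrite /gap_moment /comb.
  move: (I _) (I _) (I _) (I _) (I _) (I _) => x1 x2 y1 y2 z1 z2; ring.
by apply: comb_le; exact: dt_flux_wave_ge.
Qed.

(** The linear bounds of both directions, taken with the same [z], add up to one in the combined
    moment, which is the quantity known to be positive. *)
Lemma gap_moment_ge (k M t : R) : 0 < k -> 0 <= t <= T ->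
  (forall y, 0 <= y -> k * (y - rb) ^+ 2 / (y + rb) <= gap A a rb y) ->
  2 * rb * comb (fun s => ball_wave s (Rad + c * t)) <= M -> 0 < M ->
  0 < excess_moment t ->
  k * excess_moment t ^+ 2 / (excess_moment t + M) <= gap_moment t.
Proof.
move=> k0 tT Hk HM M0; rewrite excess_momentE//; set X := comb _ => X0.
have XM : 0 < X + M by rewrite addr_gt0.
(* The maximiser of [2 z X - z^2 (X + M)]. *)
pose z := X / (X + M).
have HN : k * (2 * z * X - z ^+ 2 * (X + 2 * rb * comb (fun s => ball_wave s (Rad + c * t)))) <= gap_moment t.
  have -> : k * (2 * z * X - z ^+ 2 * (X + 2 * rb * comb (fun s => ball_wave s (Rad + c * t)))) =
    comb (fun s => k * (2 * z * I (excess_wave s t) - z ^+ 2 * (I (excess_wave s t) +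
       2 * rb * ball_wave s (Rad + c * t)))).
    rewrite /X /comb; clearbody z; move: (I _) (I _) (ball_wave _ _) (ball_wave _ _) => x1 x2 y1 y2; ring.
  by apply: comb_le; apply: integral_gap_wave_ge => //; exact: ltW.
apply: le_trans HN.
have -> : k * X ^+ 2 / (X + M) = k * (2 * z * X - z ^+ 2 * (X + M)).
  by rewrite /z; clearbody X; field; rewrite gt_eqF.
by rewrite ler_pM2l// lerD2l lerN2 ler_wpM2l ?sqr_ge0// lerD2l.
Qed.

Lemma excess_moment_le t : 0 <= t <= T -> excess_moment t <=
  (p1 + p2) * (expR (Rad + c * t) * (I (excess 0) + rb * ((Rad + c * t) + (Rad + c * t)) ^+ n)).
Proof.
move=> tT; rewrite excess_momentE// -comb_cst.
by apply: comb_le; exact: excess_wave_le.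
Qed.

End Pair.

End PlaneWaveMoments.

(** * Blow-up *)

Section SolutionFlow.
Context {R : realType} {n : nat}.
Notation E := 'rV[R]_n.
Local Notation I := (integral_Rn setT).

(** As [T < T'], the closed slab up to [T] lies in the domain of the solution. There the density is
    nonnegative, so the pressure written with [ppow] is the given one. *)
Lemma C1_solution_flow (A a lambda mu T : R) (T' : \bar R) (rho_init : E -> R) (u_init : E -> E)
    (rho : R -> E -> R) (u : R -> E -> E) (a0 : 0 < a) : 0 < T -> (T%:E < T')%E ->
  C1_solution A (a + 1) lambda mu rho_init u_init T' rho u ->
  exists (r : @c1field R n T) (v : 'I_n -> @c1field R n T),
  [/\ forall t x, 0 <= t <= T -> 0 <= r t x,
      forall t x, 0 < t < T -> fdt r t x + \sum_i fdx (c1mul r (v i)) i t x = 0,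
      forall j t x, 0 < t < T ->
        fdt (c1mul r (v j)) t x + \sum_i fdx (c1mul (c1mul r (v i)) (v j)) i t x +
        fdx (c1pressure A a0 r) j t x + mu / (1 + t) `^ lambda * (r t x * v j t x) = 0,
      forall x, r 0 x = rho_init x &
      forall x i, v i 0 x = u_init x 0 i].
Proof.
move=> T0 TT' [[rhoC uC] rho0 mass mom init].
have [r rE] := C1_slab_c1field T0 TT' rhoC.
have /choice[v vE] i : exists v : @c1field R n T, forall t x, 0 <= t <= T -> v t x = u t x 0 i.
  exact: C1_slab_c1field T0 TT' (uC i).
have T00 : 0 <= (0 : R) <= T by rewrite lexx (ltW T0).
have sl t x : 0 <= t <= T -> slab T' (t, x).
  by move=> /andP[t0 tT]; split => //=; apply: le_lt_trans TT'; rewrite lee_fin.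
have closed_itv t : 0 < t < T -> 0 <= t <= T by move=> /andP[? ?]; rewrite !ltW.
have near_itv t : 0 < t < T -> \forall s \near t, 0 <= s <= T.
  move=> /andP[t0 tT]; near=> s; apply/andP; split; apply/ltW; near: s.
    exact: lt_nbhsr.
  exact: lt_nbhsl.
have dt_eq (F : @c1field R n T) (f : R -> E -> R) t x : (forall t x, 0 <= t <= T -> F t x = f t x) ->
    0 < t < T -> derive1 (f ^~ x) t = fdt F t x.
  move=> Ff tT; rewrite derive1E.
  have D : is_derive t 1 (f ^~ x) (fdt F t x).
    apply: near_eq_is_derive (is_derive_fdt F x tT).
    by apply: filterS (near_itv t tT) => s sT; exact: Ff.
  by rewrite derive_val.
have dx_eq (F : @c1field R n T) (f : E -> R) t x i : (forall x, F t x = f x) ->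
    partial i f x = fdx F i t x.
  move=> Ff; have -> : f = F t by apply/funext => y; rewrite Ff.
  by have D := is_derive_fdx F i t x; rewrite /partial derive_val.
exists r, v; split.
- by move=> t x tT; rewrite rE// rho0//; exact: sl.
- move=> t x tT; have tT' := closed_itv t tT.
  have /andP[t0 tT1] := tT; have tT2 : (t%:E < T')%E by apply: lt_trans TT'; rewrite lte_fin.
  rewrite -[RHS](mass t x t0 tT2) (dt_eq r rho)//; congr (_ + _); apply: eq_bigr => i _.
  by rewrite (dx_eq (c1mul r (v i)) _ t)// => y; rewrite /= rE// vE.
- move=> j t x tT; have tT' := closed_itv t tT.
  have /andP[t0 tT1] := tT; have tT2 : (t%:E < T')%E by apply: lt_trans TT'; rewrite lte_fin.
  rewrite -[RHS](mom t x j t0 tT2) (dt_eq (c1mul r (v j)) (fun s y => rho s y * u s y 0 j))//; last first.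
    by move=> s y sT; rewrite /= rE// vE.
  rewrite (dx_eq (c1pressure A a0 r) _ t); last first.
    move=> y; rewrite /pressure [LHS](_ : _ = A * ppow (a + 1) (r t y))// rE//.
    by rewrite ppow_ge0E// rho0//; exact: sl.
  have -> : mu * (rho t x * u t x 0 j) / (1 + t) `^ lambda = mu / (1 + t) `^ lambda * (r t x * v j t x).
    by rewrite rE// vE// mulrAC.
  congr (_ + _ + _ + _); apply: eq_bigr => i _.
  by rewrite (dx_eq (c1mul (c1mul r (v i)) (v j)) _ t)// => y; rewrite /= rE// !vE.
- by move=> x; rewrite rE//; exact: (init x).1.
- by move=> x i; rewrite vE// (init x).2.
Unshelve. all: by end_near. Qed.

End SolutionFlow.

Section LifespanWeight.
Context {R : realType}.

Lemma is_derive_pow1D (p t : R) : 0 <= t ->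
  is_derive t 1 (fun s : R => (1 + s) `^ p) (p * (1 + t) `^ (p - 1)).
Proof.
move=> t0; have t1 : 0 < 1 + t by rewrite ltr_wpDr.
have := is_derive_compR (h := fun y => y `^ p) (is_derive1_powR p t1) (is_derive_1D t).
by rewrite mulr1.
Qed.

Definition lifespan_bound (n : nat) (C e : R) : R :=
  if n == 3%N then expR (C * e^-1) else C * e `^ (- (2 / (3 - n%:R))).

(* The weight A measures the growth of the mass of a plane wave on the cone,
   relative to exp (c t). *)
Lemma lifespan_weight (n : nat) : n \in [:: 1; 2; 3]%N ->
  exists A dA S : R -> R,
  [/\ forall t : R, 0 <= t -> is_derive t 1 A (dA t) /\ 0 <= dA t,
      forall t : R, 0 <= t -> 1 <= A t /\ A t = Num.sqrt (1 + t) ^+ n.-1,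
      forall t : R, 0 <= t -> is_derive t 1 S (A t)^-1 &
      forall D : R, 0 < D -> exists2 C : R, 0 < C & forall e T : R, 0 < e <= 1 -> 0 < T ->
        (1 <= T -> S (T - 1) <= D / e) -> T <= lifespan_bound n C e].
Proof.
rewrite !inE => /or3P[] /eqP ->.
- exists (fun=> 1), (fun=> 0), id; split => //.
  + by move=> t _; split => //; exact: is_derive_cst.
  + by move=> t _; rewrite invr1; exact: is_derive_id.
  (* The extra 1 absorbs the shift [T - 1] and the case [T < 1], as [1 <= 1 / e]. *)
  move=> D D0; exists (D + 1); first by rewrite addr_gt0.
  move=> e T /andP[e0 e1] T0 H.
  have -> : lifespan_bound 1 (D + 1) e = (D + 1) / e.
    rewrite /lifespan_bound/= (_ : - (2 / (3 - 1)) = -1); last by field.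
    by rewrite powR_inv1// ltW.
  have ei : 1 <= e^-1 by rewrite -invr1 lef_pV2 ?posrE.
  have De : 0 < D / e by rewrite divr_gt0.
  rewrite mulrDl mul1r; have [T1|T1] := leP 1 T.
    by have := H T1; rewrite lerBlDr => /le_trans; apply; rewrite lerD2l.
  by apply: (le_trans (ltW T1)); apply: (le_trans ei); rewrite lerDr ltW.
- exists (fun t => (1 + t) `^ (2^-1)), (fun t => 2^-1 * (1 + t) `^ (2^-1 - 1)), (fun t => 2 * (1 + t) `^ (2^-1)); split.
  + move=> t t0; split; first exact: is_derive_pow1D.
    by rewrite mulr_ge0 ?powR_ge0.
  + move=> t t0; have t1 : 0 <= 1 + t by rewrite addr_ge0.
    rewrite powR12_sqrt// expr1; split => //.
    by rewrite -[leLHS]sqrtr1 ler_wsqrtr// lerDl.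
  + move=> t t0; apply: (is_derive_eq (is_derive_scale 2 (is_derive_pow1D 2^-1 t0))).
    by rewrite mulrA divff// mul1r -powRN; congr (_ `^ _); field.
  (* Here [S (T - 1) = 2 sqrt T], so squaring gives [T <= D^2 / (4 e^2)]; the extra 1 covers
     [T < 1]. *)
  move=> D D0; exists (D ^+ 2 / 4 + 1); first by rewrite addr_gt0// divr_gt0// exprn_gt0.
  move=> e T /andP[e0 e1] T0 H.
  have -> : lifespan_bound 2 (D ^+ 2 / 4 + 1) e = (D ^+ 2 / 4 + 1) * (e^-1) ^+ 2.
    rewrite /lifespan_bound/= (_ : - (2 / (3 - 2%:R)) = - 2%:R); last by field.
    by rewrite powR_invn ?(ltW e0)// exprVn.
  have ei : 1 <= e^-1 by rewrite -invr1 lef_pV2 ?posrE.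
  have [T1|T1] := leP 1 T; last first.
    apply: (le_trans (ltW T1)); rewrite -[leLHS]mul1r ler_pM//; last by rewrite exprn_ege1.
    by rewrite lerDr divr_ge0// sqr_ge0.
  have := H T1; rewrite subrKC powR12_sqrt ?(ltW T0)// => h.
  have {}h : Num.sqrt T <= D / e / 2 by rewrite ler_pdivlMr// mulrC.
  have : Num.sqrt T ^+ 2 <= (D / e / 2) ^+ 2 by rewrite ler_pXn2r ?nnegrE ?sqrtr_ge0// (le_trans (sqrtr_ge0 _) h).
  rewrite sqr_sqrtr ?(ltW T0)// => /le_trans; apply.
  have -> : (D / e / 2) ^+ 2 = D ^+ 2 / 4 * e^-1 ^+ 2.
    by field; rewrite gt_eqF.
  by rewrite ler_wpM2r ?sqr_ge0// lerDl.
- exists (fun t => 1 + t), (fun=> 1), (fun t => ln (1 + t)); split.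
  + by move=> t t0; split => //; exact: is_derive_1D.
  + move=> t t0; rewrite sqr_sqrtr ?lerDl// addr_ge0//.
  + move=> t t0; have t1 : 0 < 1 + t by rewrite ltr_wpDr.
    by apply: (is_derive_eq (is_derive_ln t1 (is_derive_1D t))); rewrite mul1r.
  move=> D D0; exists D => // e T /andP[e0 e1] T0 H.
  rewrite /lifespan_bound/=; have [T1|T1] := leP 1 T.
    by have := H T1; rewrite subrKC -ler_expR lnK.
  by apply: (le_trans (ltW T1)); rewrite -expR0 ler_expR ltW// divr_gt0.
Qed.

(** [m] is the exponential of the integral of the damping from 0 to [t]; for [lambda > 1] that
    integral increases to the finite limit [k]. *)
Lemma damping_factor (mu lambda : R) : 0 <= mu -> 1 < lambda ->
  let k := mu / (lambda - 1) in
  let m t := expR (k * (1 - (1 + t) `^ (1 - lambda))) in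
  [/\ forall t : R, 0 <= t -> is_derive t 1 m (mu / (1 + t) `^ lambda * m t),
      forall t : R, 0 <= t -> 0 <= mu / (1 + t) `^ lambda &
      forall t : R, 0 <= t -> 1 <= m t <= expR k].
Proof.
move=> mu0 l1 k m; have l0 : 0 < lambda - 1 by rewrite subr_gt0.
have k0 : 0 <= k by rewrite divr_ge0 ?(ltW l0).
split=> t t0.
- have H := is_derive_exp (is_derive_scale k (is_derive_sub (is_derive_cst (1 : R) t 1)
    (is_derive_pow1D (1 - lambda) t0))).
  apply: (is_derive_eq H); rewrite /m /cst mulrC; congr (_ * _).
  rewrite (_ : 1 - lambda - 1 = - lambda); last by ring.
  by rewrite powRN /k; field; rewrite gt_eqF ?powR_gt0 ?ltr_wpDr// gt_eqF.
- by rewrite divr_ge0 ?powR_ge0.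
- have p1 : (1 + t) `^ (1 - lambda) <= 1.
    rewrite -[leRHS](powRr0 (1 + t)); apply: ler_powR; first by rewrite lerDl.
    by rewrite subr_le0 ltW.
  rewrite -{1}expR0 !ler_expR mulr_ge0 ?subr_ge0//=.
  by rewrite ler_piMr// gerBl powR_ge0.
Qed.

End LifespanWeight.

Section Blowup.
Context {R : realType}.
Local Notation I := (integral_Rn setT).

Lemma plane_wave_average n (f : 'rV[R]_n -> R) (v : 'rV[R]_n -> 'rV[R]_n) (K p q : R) :
  (0 < n)%N ->
  continuous f -> (forall x, K < `|x| -> f x = 0) ->
  (forall i, continuous (fun x => v x 0 i)) -> (forall x, K < `|x| -> v x = 0) ->
  0 < p * integral_Rn setT (fun x => f x * phi x) +
      q * integral_Rn setT (fun x => dotrv (v x) (gradient (@phi R n) x)) ->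
  exists2 s, enorm s = 1 &
    0 < p * integral_Rn setT (fun x => f x * expR (dotrv x s)) +
        q * integral_Rn setT (fun x => dotrv (v x) s * expR (dotrv x s)).
Proof.
by case: n f v => [|[|m]] f v // _; [exact: plane_wave_average_1|exact: plane_wave_average_ge2].
Qed.

Lemma ball_wave_le n (C Rad c t : R) (s : 'rV[R]_n) : (0 < n)%N -> 0 < Rad -> 0 < c -> 0 <= t ->
  0 < C ->
  (forall (s : 'rV[R]_n) (r : R), 0 < r -> dotrv s s = 1 ->
    Num.sqrt r * integral_Rn setT (fun x => expR (dotrv x s) * \1_[set x | enorm x <= r] x)
     <= C * expR r * Num.sqrt r ^+ n) ->
  dotrv s s = 1 ->
  ball_wave s (Rad + c * t) <=
    C * expR Rad * Num.sqrt (Rad + c) ^+ n.-1 * Num.sqrt (1 + t) ^+ n.-1 * expR (c * t).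
Proof.
move=> n0 Rad0 c0 t0 C0 HC s1.
have rho0 : 0 < Rad + c * t by rewrite ltr_pwDl// mulr_ge0// ltW.
have sr0 : 0 < Num.sqrt (Rad + c * t) by rewrite sqrtr_gt0.
have sE : Num.sqrt (Rad + c * t) ^+ n = Num.sqrt (Rad + c * t) * Num.sqrt (Rad + c * t) ^+ n.-1.
  by rewrite -exprS prednK.
have := HC s _ rho0 s1; rewrite sE mulrCA ler_pM2l// => /le_trans; apply.
rewrite expRD.
(* Uses [Rad + c t <= (Rad + c) (1 + t)], which isolates the weight [(1 + t)^((n - 1) / 2)]. *)
have sq : Num.sqrt (Rad + c * t) ^+ n.-1 <= Num.sqrt (Rad + c) ^+ n.-1 * Num.sqrt (1 + t) ^+ n.-1.
  rewrite -exprMn lerXn2r ?nnegrE ?mulr_ge0 ?sqrtr_ge0// -sqrtrM ?addr_ge0 ?(ltW Rad0) ?(ltW c0)//.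
  rewrite ler_wsqrtr//; have := mulr_ge0 (ltW Rad0) t0; rewrite mulrDl !mulrDr !mulr1; lra.
have -> : C * expR Rad * Num.sqrt (Rad + c) ^+ n.-1 * Num.sqrt (1 + t) ^+ n.-1 * expR (c * t) =
  C * (expR Rad * expR (c * t)) * (Num.sqrt (Rad + c) ^+ n.-1 * Num.sqrt (1 + t) ^+ n.-1) by ring.
by rewrite ler_wpM2l// !mulr_ge0 ?expR_ge0// ltW.
Qed.

Lemma blowup_time n (A a lambda mu rb Rad : R) (rho0 : 'rV[R]_n -> R) (u0 : 'rV[R]_n -> 'rV[R]_n) :
  n \in [:: 1; 2; 3]%N -> 0 < A -> 0 < a -> 1 < lambda -> 0 <= mu -> 0 < rb -> 0 < Rad ->
  continuous rho0 -> (forall i, continuous (fun x => u0 x 0 i)) ->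
  (forall x, Rad < enorm x -> rho0 x = 0) -> (forall x, Rad < enorm x -> u0 x = 0) ->
  0 < integral_Rn setT (fun x => rho0 x * phi x) ->
  0 < integral_Rn setT (fun x => dotrv (u0 x) (gradient (@phi R n) x)) ->
  exists2 eps0 : R, 0 < eps0 & exists2 C : R, 0 < C & forall eps T T' rho u,
    0 < eps <= eps0 -> 0 < T -> (T%:E < T')%E ->
    C1_solution A (a + 1) lambda mu (fun x => rb + eps * rho0 x) (fun x => eps *: u0 x) T' rho u ->
    T <= lifespan_bound n C eps.
Proof.
move=> hn A0 a0 l1 mu0 rb0 Rad0 cr cu sr su rpos upos.
have n0 : (0 < n)%N by move: hn; rewrite !inE => /or3P[] /eqP ->.
have comb0 (q1 q2 x y : R) : q1 = 0 -> q2 = 0 -> q1 * x + q2 * y = 0 by move=> -> ->; rewrite !mul0r addr0.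
have half_le (x y : R) : - (x / 2) <= y -> x / 2 <= x + y by lra.
have double_le (x y t : R) : 0 < y -> 0 <= x * t -> x + y * t + (x + y * t) <= 2 * (x + y) * (1 + t) by lra.
have exc_alg (q1 q2 e x y : R) : q1 * (e * x) + q2 * (e * y) = e * (q1 * x + q2 * y) by ring.
have comb_alg (q1 q2 e d x1 x2 y1 y2 : R) : q1 * (e * (d * x1 + e * y1)) + q2 * (e * (d * x2 + e * y2)) =
   e * (d * (q1 * x1 + q2 * x2) + e * (q1 * y1 + q2 * y2)) by ring.
pose c := Num.sqrt (A * (a + 1) * ppow a rb).
have c20 : 0 < A * (a + 1) * ppow a rb.
  by rewrite !mulr_gt0 ?addr_gt0// ppow_ge0E ?(ltW rb0)// powR_gt0.
have c0 : 0 < c by rewrite sqrtr_gt0.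
have cE : c ^+ 2 = A * (a + 1) * ppow a rb by rewrite sqr_sqrtr// ltW.
have [k k0 Hk] := gap_lower_bound A0 a0 rb0.
have [Cw Cw0 HCw] := @integral_exp_eball_le R n.
have [W [dW [S [dWP W1 dS HS]]]] := @lifespan_weight R n hn.
have [dm b0 m1] := damping_factor mu0 l1.
have sr' x : Rad < `|x| -> rho0 x = 0 by move=> Rx; apply/sr/(lt_le_trans Rx)/ler_norm_enorm.
have su' x : Rad < `|x| -> u0 x = 0 by move=> Rx; apply/su/(lt_le_trans Rx)/ler_norm_enorm.
pose al s := I (fun x => rho0 x * expR (dotrv x s)).
pose be s := I (fun x => dotrv (u0 x) s * expR (dotrv x s)).
(* The initial momentum is [eps (rb + eps rho0) u0]; [de] is its part of second order in [eps]. *)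
pose de s := I (fun x => rho0 x * (dotrv (u0 x) s * expR (dotrv x s))).
have cexp s : continuous (fun x : 'rV[R]_n => expR (dotrv x s)).
  by apply: (continuous_comp_real (@continuous_expR R)); exact: continuous_dotrvl.
have cus s : continuous (fun x => dotrv (u0 x) s * expR (dotrv x s)).
  apply: continuousM2 => //; apply: continuous_sum => i; apply: continuousM2 => // x.
  exact: cst_continuous.
have us0 s x : Rad < `|x| -> dotrv (u0 x) s * expR (dotrv x s) = 0.
  by move=> /su' ->; rewrite /dotrv big1 ?mul0r// => i _; rewrite mxE mul0r.
have bal s : bcs (fun x => rho0 x * expR (dotrv x s)).
  by apply: (bcs_continuous (K := Rad)); [exact: continuousM2|move=> x /sr' ->; rewrite mul0r].
have bbe s : bcs (fun x => dotrv (u0 x) s * expR (dotrv x s)).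
  by apply: (bcs_continuous (K := Rad)); [exact: cus|exact: us0].
have bde s : bcs (fun x => rho0 x * (dotrv (u0 x) s * expR (dotrv x s))) by exact: bcsM.
have [s1 [s2 [p1 [p2 [S1 S2 p10 p20 [Apos Bpos]]]]]] :
    exists s1 s2 (p1 p2 : R), [/\ enorm s1 = 1, enorm s2 = 1, 0 <= p1, 0 <= p2 &
      0 < p1 * al s1 + p2 * al s2 /\ 0 < p1 * be s1 + p2 * be s2].
  (* For each nonzero [(p, q) >= 0] the positivity assumptions make the combined integral against
     [phi] positive, hence also that against some plane wave. *)
  apply: (@two_directions R 'rV[R]_n [set s | enorm s = 1] al be) => p q pge qge pq.
  apply: (plane_wave_average (K := Rad)) => //.
  have [p0|p0] := eqVneq p 0; first by rewrite p0 mul0r add0r mulr_gt0//; move: pq; rewrite p0 add0r.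
  by rewrite ltr_pwDl ?mulr_gt0// ?lt_neqAle 1?eq_sym ?p0// mulr_ge0// ltW.
have unit (s : 'rV[R]_n) : enorm s = 1 -> dotrv s s = 1 by rewrite -sqr_enorm => ->; rewrite expr1n.
pose cmb := comb s1 s2 p1 p2.
pose th := p1 + p2; have th0 : 0 < th.
  rewrite lt_neqAle addr_ge0// andbT; apply/eqP => th0.
  have p1z : p1 = 0 by apply/eqP; rewrite eq_le p10 andbT th0 lerDl.
  have p2z : p2 = 0 by apply/eqP; rewrite eq_le p20 andbT th0 lerDr.
  by move: Apos; rewrite comb0// ltxx.
pose L := Rad + c; have L0 : 0 < L by rewrite addr_gt0.
(* [2 rb] times the bound of [ball_wave_le], summed over the two directions with total weight
   [th]. *)
pose Cm := 2 * rb * (th * (Cw * expR Rad * Num.sqrt L ^+ n.-1)).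
have Cm0 : 0 < Cm by rewrite !mulr_gt0 ?expR_gt0 ?exprn_gt0 ?sqrtr_gt0.
pose m0 := `|I rho0|.
pose C1 := th * (expR Rad * (m0 + rb * (2 * L) ^+ n)).
have C10 : 0 < C1.
  by rewrite !mulr_gt0 ?expR_gt0// ltr_wpDl ?normr_ge0// mulr_gt0// exprn_gt0// mulr_gt0.
(* This is the constant [c0] of [damped_blowup]: initially [Y + c X >= c X = c eps cmb al]. *)
have cA0 : 0 < c * cmb al by rewrite mulr_gt0.
have minf1 : 1 <= expR (mu / (lambda - 1)).
  by rewrite -[leLHS]expR0 ler_expR divr_ge0// subr_ge0 ltW.
(* For [eps <= eps0] the second-order part of the initial momentum is at most half of the
   first-order part in absolute value when negative, so [Y 0 > 0]. *)
pose eps0 := Num.min 1 (rb * cmb be / (2 * (`|cmb de| + 1))).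
have dn0 : 0 < `|cmb de| + 1 by rewrite ltr_wpDl.
have eps00 : 0 < eps0 by rewrite lt_min ltr01 divr_gt0 ?mulr_gt0.
have small_perturbation eps : 0 < eps -> eps <= eps0 -> - (rb * cmb be / 2) <= eps * cmb de.
  move=> e0 ele.
  have h1 : eps * (`|cmb de| + 1) <= rb * cmb be / 2.
    have : eps <= rb * cmb be / (2 * (`|cmb de| + 1)) by apply: le_trans ele _; rewrite ge_min lexx orbT.
    by rewrite invfM mulrA ler_pdivlMr.
  rewrite lerNl -mulrN; apply: le_trans h1; rewrite ler_pM2l// ler_wpDr//.
  by rewrite -normrN ler_norm.
have [D D0 HD] := damped_blowup n c0 k0 Cm0 C10 minf1 cA0
  (fun t t0 => (dWP t t0).1) (fun t t0 => (dWP t t0).2) (fun t t0 => (W1 t t0).1) dS dm b0 m1.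
have [C C0 HC] := HS D D0.
exists eps0 => //; exists C => // eps T T' rho u /andP[e0 ele] T0 TT' sol.
have e1 : eps <= 1 by apply: le_trans ele _; rewrite ge_min lexx.
apply: HC => //; first by rewrite e0.
move=> T1.
have [r [v [r0 mass mom ri vi]]] := C1_solution_flow a0 T0 TT' sol.
have binit x : Rad < enorm x -> r 0 x = rb /\ forall i, v i 0 x = 0.
  move=> Rx; rewrite ri sr// mulr0 addr0; split=> // i.
  by rewrite vi su// scaler0 mxE.
have bpos t : 0 < t < T -> 0 <= mu / (1 + t) `^ lambda by move=> /andP[/ltW + _]; exact: b0.
have cA : A * (a + 1) * ppow a rb <= c ^+ 2 by rewrite cE.
have support := finite_propagation T0 A0 rb0 bpos r0 mass mom c0 cA binit.
have T00 : 0 <= (0 : R) <= T by rewrite lexx (ltW T0).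
pose X := excess_moment rb r s1 s2 p1 p2.
pose Y := flux_moment r v s1 s2 p1 p2.
have G0 s : I (excess_wave rb r s 0) = eps * al s.
  rewrite /al -integral_RnZ//; congr (integral_Rn _ _); apply/funext => x.
  by rewrite [LHS](_ : _ = (r 0 x - rb) * expR (dotrv x s))// ri addrAC subrr add0r mulrA.
have F0 s : I (flux_wave r v s 0) = eps * (rb * be s + eps * de s).
  have z1 := bcsZ rb (bbe s); have z2 := bcsZ eps (bde s).
  rewrite /be /de -(integral_RnZ rb (bbe s)) -(integral_RnZ eps (bde s)) -(integral_RnD z1 z2).
  rewrite -(integral_RnZ eps (bcsD z1 z2)); congr (integral_Rn _ _); apply/funext => x.
  rewrite [LHS](_ : _ = (\sum_j s 0 j * (r 0 x * v j 0 x)) * expR (dotrv x s))//.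
  have -> : \sum_j s 0 j * (r 0 x * v j 0 x) = eps * (rb + eps * rho0 x) * dotrv (u0 x) s.
    by rewrite /dotrv mulr_sumr; apply: eq_bigr => j _; rewrite ri vi mxE; ring.
  by ring.
have X0E : X 0 = eps * cmb al by rewrite /X excess_momentE// /comb G0 G0 exc_alg.
have Y0E : Y 0 = eps * (rb * cmb be + eps * cmb de) by rewrite /Y flux_momentE// /comb F0 F0 comb_alg.
have mE : I (excess rb r 0) = eps * I rho0.
  rewrite -integral_RnZ; last by apply: (bcs_continuous (K := Rad)).
  congr (integral_Rn _ _); apply/funext => x.
  by rewrite [LHS](_ : _ = r 0 x - rb)// ri addrAC subrr add0r.
have [cX cY] := continuous_moments T0 mass c0 support s1 s2 p1 p2.
have dXY := is_derive_moments T0 mass c0 support s1 s2 p1 p2.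
have dYge := flux_moment_dt_ge (b := fun t => mu / (1 + t) `^ lambda) r0 mom c0 cE support (unit s1 S1) (unit s2 S2) p10 p20.
have Xle := excess_moment_le T0 rb0 r0 mass Rad0 c0 support (unit s1 S1) (unit s2 S2) p10 p20.
have Y0ge : eps * (rb * cmb be / 2) <= Y 0.
  rewrite Y0E ler_pM2l//; apply: half_le; exact: small_perturbation.
have cX0 : c * cmb al * eps <= Y 0 + c * X 0.
  have Y00 : 0 <= Y 0 by apply: le_trans Y0ge; apply: mulr_ge0; rewrite ?(ltW e0)// divr_ge0// mulr_ge0// ltW.
  by rewrite X0E -mulrA [cmb al * _]mulrC lerDr.
have Y00 : 0 < Y 0 by apply: lt_le_trans Y0ge; rewrite mulr_gt0// divr_gt0// mulr_gt0.
have X00 : 0 < X 0 by rewrite X0E mulr_gt0.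
have WM t : 0 <= t -> 0 < Cm * W t * expR (c * t).
  by move=> t0; rewrite mulr_gt0 ?expR_gt0// mulr_gt0// (lt_le_trans ltr01)// (W1 t t0).1.
clear G0 F0 X0E Y0E Y0ge.
apply: (HD eps T X Y _ (gap_moment A a rb r s1 s2 p1 p2) (fun t => Cm * W t * expR (c * t)) _ T1 cX cY
  (fun t tT => (dXY t tT).1) (fun t tT => (dXY t tT).2) dYge _ _ _ X00 Y00 cX0).
- by rewrite e0.
- move=> t tT; have tT' : 0 <= t <= T by case/andP: tT => ? ?; rewrite !ltW.
  have t0 : 0 <= t by case/andP: tT'.
  apply: (gap_moment_ge a0 rb0 r0 c0 support p10 p20 k0 tT' Hk _ (WM t t0)).
  rewrite /Cm -!mulrA ler_pM2l// ler_pM2l//.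
  have -> : th * (Cw * (expR Rad * (Num.sqrt L ^+ n.-1 * (W t * expR (c * t))))) =
      comb s1 s2 p1 p2 (fun=> Cw * expR Rad * Num.sqrt L ^+ n.-1 * Num.sqrt (1 + t) ^+ n.-1 * expR (c * t)).
    by rewrite comb_cst (W1 t t0).2 !mulrA.
  by apply: comb_le => //; apply: ball_wave_le => //; exact: unit.
- by move=> t tT; rewrite lexx andbT WM//; case/andP: tT => /ltW.
- move=> t tT; have t0 : 0 <= t by case/andP: tT.
  apply: le_trans (Xle t tT) _.
  rewrite /C1 -/th -!mulrA ler_pM2l// expRD -!mulrA ler_pM2l ?expR_gt0//.
  rewrite [X in _ <= X]mulrA [X in _ <= X]mulrC ler_pM2l ?expR_gt0//.
  have p1n : 1 <= (1 + t) ^+ n by rewrite exprn_ege1// lerDl.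
  have h1 : I (excess rb r 0) <= m0 * (1 + t) ^+ n.
    rewrite mE; apply: (@le_trans _ _ m0); last by rewrite ler_peMr// normr_ge0.
    apply: le_trans (ler_norm _) _; rewrite normrM (gtr0_norm e0).
    by rewrite ler_piMl// normr_ge0.
  have h2 : (Rad + c * t + (Rad + c * t)) ^+ n <= (2 * L) ^+ n * (1 + t) ^+ n.
    have rt : 0 <= Rad + c * t by rewrite addr_ge0 ?mulr_ge0 ?(ltW c0) ?(ltW Rad0).
    have Lt : 0 <= 2 * L * (1 + t) by apply: mulr_ge0; [rewrite mulr_ge0// ltW|rewrite addr_ge0].
    rewrite -exprMn lerXn2r ?nnegrE ?(addr_ge0 rt rt)//.
    by apply: double_le => //; rewrite mulr_ge0// ltW.
  by rewrite mulrDl; apply: lerD => //; rewrite -mulrA ler_wpM2l// ltW.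
Qed.

End Blowup.

Theorem theorem1 (R : realType) (n : nat) (hn : n \in [:: 1; 2; 3]%N)
  (gamma lambda mu A rhobar Rad : R)
  (hgamma : 1 < gamma) (hlambda : 1 < lambda) (hmu : 0 <= mu)
  (hA : 0 < A) (hrhobar : 0 < rhobar) (hRad : 0 < Rad)
  (rho0 : 'rV[R]_n -> R) (u0 : 'rV[R]_n -> 'rV[R]_n)
  (rho0_smooth : smooth rho0) (rho0_compact : compact (supp rho0))
  (u0_smooth : forall i : 'I_n, smooth (fun x => u0 x 0 i))
  (u0_compact : compact (supp u0))
  (rho0_supp : supp rho0 `<=` [set x | enorm x <= Rad])
  (u0_supp : supp u0 `<=` [set x | enorm x <= Rad])
  (rho0_pos : 0 < integral_Rn setT (fun x => rho0 x * phi x))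
  (u0_pos : 0 < integral_Rn setT
     (fun x => dotrv (u0 x) (gradient (@phi R n) x))) :
  exists eps0 : R, 0 < eps0 /\ exists C : R, 0 < C /\
  forall eps : R, 0 < eps -> eps <= eps0 ->
    let rho_init := fun x => rhobar + eps * rho0 x in
    let u_init := fun x => eps *: u0 x in
    ~ global_solution_exists A gamma lambda mu rho_init u_init /\
    (lifespan A gamma lambda mu rho_init u_init <=
       (if n == 3%N then expR (C * eps^-1)
        else C * eps `^ (- (2 / (3 - n%:R))))%:E)%E.
Proof.
have a0 : 0 < gamma - 1 by rewrite subr_gt0.
have vanish (V : zmodType) (f : 'rV[R]_n -> V) : supp f `<=` [set x | enorm x <= Rad] ->
    forall x, Rad < enorm x -> f x = 0.
  move=> fS x Rx; apply/eqP; apply: contraTT Rx => fx; rewrite -leNgt.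
  by apply: fS; exact: subset_closure.
have [eps0 eps00 [C C0 H]] := blowup_time hn hA a0 hlambda hmu hrhobar hRad
  (rho0_smooth [::]).1 (fun i => (u0_smooth i [::]).1) (vanish _ _ rho0_supp) (vanish _ _ u0_supp)
  rho0_pos u0_pos.
rewrite subrK in H.
exists eps0; split=> //; exists C; split=> // eps e0 ele rho_init u_init.
have ee : 0 < eps <= eps0 by rewrite e0.
have B0 : 0 < lifespan_bound n C eps.
  by rewrite /lifespan_bound; case: ifP => _; rewrite ?expR_gt0// mulr_gt0// powR_gt0.
split.
  move=> [rho [u sol]].
  (* A global solution could be stopped one unit of time past the bound. *)
  have := H eps (lifespan_bound n C eps + 1) +oo%E rho u ee _ _ sol.
  rewrite addr_gt0// ltry => /(_ isT isT).
  by rewrite gerDl leNgt ltr01.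
apply: ge_ereal_sup => T' [T'0 [rho [u sol]]].
rewrite leNgt; apply/negP => lt.
(* [blowup_time] concerns finite times strictly before [T'], so such a time is chosen beyond the
   bound, [T'] being finite or infinite. *)
have [T lT TT'] : exists2 T : R, lifespan_bound n C eps < T & (T%:E < T')%E.
  move: lt {sol T'0}; case: T' => [t| |] //.
    rewrite lte_fin => lt; exists ((lifespan_bound n C eps + t) / 2).
      by rewrite ltr_pdivlMr// mulr2n mulrDr mulr1 ltrD2l.
    by rewrite lte_fin ltr_pdivrMr// mulr2n mulrDr mulr1 ltrD2r.
  by move=> _; exists (lifespan_bound n C eps + 1); rewrite ?ltrDl ?ltry.
have := H eps T T' rho u ee (lt_trans B0 lT) TT' sol.
by rewrite leNgt lT.
Qed.
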